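(* Let $r\geq 1$ be an integer, let $(\bm{a},\bm{j})=\big((a_i,j_i)\big)_{i=0}^{r-1}\in\mathcal{P}^r$, and let $\bm{\varepsilon}\in\mathcal{X}_r(\bm{a},\bm{j})$. For every integer $i\geq 0$, $$\mathrm{rad}^i_{\mathcal{A}_r}\big(\mathcal{A}_r\cdot B^{(\bm{\varepsilon})}(\bm{a},\bm{j})\big)=\sum_{\substack{\bm{\theta}\in\mathcal{X}_r(\bm{a},\bm{j}),\ d(\bm{\theta},\bm{\varepsilon})=i,\\ \bm{\theta}\geq\bm{\varepsilon}}}\mathcal{A}_r\cdot B^{(\bm{\theta})}(\bm{a},\bm{j})=\sum_{\substack{\bm{\theta}\in\mathcal{X}_r(\bm{a},\bm{j}),\ d(\bm{\theta},\bm{\varepsilon})\geq i,\\ \bm{\theta}\geq\bm{\varepsilon}}}k\cdot B^{(\bm{\theta})}(\bm{a},\bm{j}),$$ and the Loewy length of $\mathcal{A}_r\cdot B^{(\bm{\varepsilon})}(\bm{a},\bm{j})$ is $w+1-\mathcal{W}(\bm{\varepsilon})$. Moreover, for every integer $i$ with $0\leq i\leq w-\mathcal{W}(\bm{\varepsilon})$ the quotient $$\mathrm{rad}^{i}_{\mathcal{A}_r}\big(\mathcal{A}_r\cdot B^{(\bm{\varepsilon})}(\bm{a},\bm{j})\big)/\mathrm{rad}^{i+1}_{\mathcal{A}_r}\big(\mathcal{A}_r\cdot B^{(\bm{\varepsilon})}(\bm{a},\bm{j})\big)$$ is isomorphic to a direct sum of $\binom{w-\mathcal{W}(\bm{\varepsilon})}{i}$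 copies of $S_{(\bm{a},\bm{j})}$. In particular, $\mathcal{A}_r\cdot B^{(\bm{\varepsilon})}(\bm{a},\bm{j})$ is an indecomposable $\mathcal{A}_r$-module whose head is isomorphic to $S_{(\bm{a},\bm{j})}$.
   Context: Let $k$ be an algebraically closed field of characteristic $p>0$. The hyperalgebra. Let $X,Y,H$ be the standard basis of $\mathfrak{sl}_2(\mathbb{C})$ ($X$ upper triangular nilpotent, $Y$ lower triangular nilpotent, $H=\mathrm{diag}(1,-1)$). Let $\mathcal{U}_{\mathbb{Z}}$ be the subring of the universal enveloping algebra of $\mathfrak{sl}_2(\mathbb{C})$ generated by $X^{(m)}=X^m/m!$ and $Y^{(m)}=Y^m/m!$ ($m\geq 0$). Put $\binom{H+c}{m}=\frac{(H+c)(H+c-1)\cdots(H+c-m+1)}{m!}$ for $c\in\mathbb{Z}$, $m\geq 0$. The elements $Y^{(m)}\binom{H}{n}X^{(m')}$ ($m,n,m'\geq 0$) form a $\mathbb{Z}$-basis of $\mathcal{U}_{\mathbb{Z}}$. Let $\mathcal{U}=\mathcal{U}_{\mathbb{Z}}\otimes_{\mathbb{Z}}k$ (the hyperalgebra of $\mathrm{SL}_2(k)$); the same notation is used for images in $\mathcal{U}$. For $r\geq 1$, $\mathcal{U}_r$ is the subalgebra of $\mathcal{U}$ generated by $X^{(p^i)},Y^{(p^i)}$ with $0\leq i\leq r-1$. Let $\mathcal{A}$ be the subalgebra of $\mathcal{U}$ generated by all $\binom{H}{p^i}$ and $Y^{(p^i)}X^{(p^i)}$ ($i\geq 0$), and $\mathcal{A}_r=\mathcal{A}\cap\mathcal{U}_r$;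 $\mathcal{A}_r$ is commutative, is generated by $\binom{H}{p^i}$ and $Y^{(p^i)}X^{(p^i)}$ with $0\leq i\leq r-1$, and has the $k$-basis $Y^{(m)}\binom{H}{n}X^{(m)}$, $0\leq m,n\leq p^r-1$. Let $\mathrm{Fr}':\mathcal{U}\to\mathcal{U}$ be the $k$-linear map with $Y^{(m)}\binom{H}{n}X^{(m')}\mapsto Y^{(mp)}\binom{H}{np}X^{(m'p)}$. For $a\in\mathbb{Z}$ put $\mu_a=\binom{H-a-1}{p-1}\in\mathcal{U}$. The elements $B^{(\varepsilon)}(a,j)$, $\varepsilon\in\{0,1\}$. If $p$ is odd: $\mathcal{S}=\{0,1,\dots,(p-1)/2\}$ (also identified with its image in $\mathbb{F}_p$), $\mathcal{P}=\{0,1,\dots,p-1\}\times\mathcal{S}$. In $\mathbb{F}_p[x]$ put $\psi(x)=\prod_{i\in\mathbb{F}_p}(x-i^2)$, $\psi^{(1)}_j(x)=\psi(x)/(x-j^2)$ for $j\in\mathcal{S}$, $\psi^{(0)}_0(x)=\prod_{i\in\mathbb{F}_p^\times}(x-i^2)$, and $\psi^{(0)}_s(x)=2x(x+s^2)\prod_{i\in\mathbb{F}_p^\times\setminus\{s,p-s\}}(x-i^2)$ for $s\in\mathcal{S}\setminus\{0\}$. Set $B^{(\varepsilon)}(a,j)=\psi^{(\varepsilon)}_j\big(\mu_aYX+((a+1)/2)^2\big)\cdot\mu_a$ for $(a,j)\in\mathcal{P}$. If $p=2$: $\mathcal{P}=\{(0,1/2),(1,0),(1,1)\}$ and $B^{(0)}(0,1/2)=\mu_0$,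 $B^{(1)}(0,1/2)=\mu_0YX$, $B^{(0)}(1,0)=B^{(1)}(1,0)=\mu_1YX$, $B^{(0)}(1,1)=B^{(1)}(1,1)=\mu_1YX+\mu_1$. Types. $(a,j)\in\mathcal{P}$ is of type (A) if $a$ is even and $(p-a+1)/2\leq j\leq(p-1)/2$; (B) if $a$ is even and $0\leq j\leq(p-a-1)/2$; (C) if $a$ is odd and $0\leq j\leq(a-1)/2$; (D) if $a$ is odd and $(a+1)/2\leq j\leq(p-1)/2$. For $p=2$ the pairs $(0,1/2),(1,0),(1,1)$ are of type (B), (C), (D) respectively. For types (A) and (C) put $s(a,j)=(p-a+1)/2$ if $p$ is odd and $a$ is even, $s(a,j)=(p-a)/2$ if $p$ and $a$ are odd, and $s(a,j)=1$ if $p=2$. The maps $Z^{(\varepsilon)}$. Each $B^{(\varepsilon)}(a,j)$ can be written uniquely as $\mu_a\sum_{m=0}^{p-1}c^{(\varepsilon)}_mY^mX^m$ with $c^{(\varepsilon)}_m\in\mathbb{F}_p$; for types (A), (C) one has $c_m^{(\varepsilon)}=0$ for $m<s(a,j)$. For $z\in\mathcal{U}$ define $Z^{(\varepsilon)}(z;(a,j))=\mu_a\sum_{m=s(a,j)}^{p-1}c^{(\varepsilon)}_mY^mX^{m-s(a,j)}\,\mathrm{Fr}'(z)\,X^{s(a,j)}$ for types (A), (C), and $Z^{(\varepsilon)}(z;(a,j))=\mathrm{Fr}'(z)B^{(\varepsilon)}(a,j)$ for types (B), (D). The elements $B^{(\bm{\varepsilon})}(\bm{a},\bm{j})$. For $\bm{\varepsilon}=(\varepsilon_0,\dots,\varepsilon_{r-1})\in\{0,1\}^r$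 and $(\bm{a},\bm{j})=\big((a_i,j_i)\big)_{i=0}^{r-1}\in\mathcal{P}^r$ (with $\bm{a}=(a_0,\dots,a_{r-1})$, $\bm{j}=(j_0,\dots,j_{r-1})$), define recursively $B^{(\bm{\varepsilon})}(\bm{a},\bm{j})=B^{(\varepsilon_0)}(a_0,j_0)$ if $r=1$, and $B^{(\bm{\varepsilon})}(\bm{a},\bm{j})=Z^{(\varepsilon_0)}\big(B^{(\varepsilon_1,\dots,\varepsilon_{r-1})}((a_1,\dots,a_{r-1}),(j_1,\dots,j_{r-1}));(a_0,j_0)\big)$ if $r\geq 2$. These lie in $\mathcal{A}_r$. Index sets. $\mathcal{X}_r(\bm{a},\bm{j})$ is the set of $(\varepsilon_0,\dots,\varepsilon_{r-1})\in\{0,1\}^r$ such that $\varepsilon_i=0$ whenever $j_i=0$ (if $p$ is odd), respectively $\varepsilon_i=0$ whenever $a_i=1$ (if $p=2$). The partial order on $\{0,1\}^r$ is componentwise: $\bm{\varepsilon}\leq\bm{\theta}$ iff $\varepsilon_i\leq\theta_i$ for all $i$. $\mathcal{W}(\bm{m})$ is the number of nonzero entries of $\bm{m}$ (Hamming weight) and $d(\bm{m},\tilde{\bm{m}})$ is the number of positions at which $\bm{m},\tilde{\bm{m}}$ differ (Hamming distance). $w$ is the number of $s\in\{0,\dots,r-1\}$ with $j_s\neq 0$ (if $p$ is odd), respectively with $a_s\neq 1$ (if $p=2$). $\bm{\tau}=(\tau_0,\dots,\tau_{r-1})\in\mathcal{X}_r(\bm{a},\bm{j})$ is the unique element of Hamming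 weight $w$: $\tau_s=0$ if $j_s=0$ ($p$ odd), resp. $a_s=1$ ($p=2$), and $\tau_s=1$ otherwise. $S_{(\bm{a},\bm{j})}=\mathcal{A}_r\cdot B^{(\bm{\tau})}(\bm{a},\bm{j})=k\cdot B^{(\bm{\tau})}(\bm{a},\bm{j})$, a simple $\mathcal{A}_r$-module. Radicals. For a finite-dimensional $k$-algebra $R$ with Jacobson radical $\mathrm{rad}R$ and a finite-dimensional left $R$-module $M$, $\mathrm{rad}^n_RM=(\mathrm{rad}R)^nM$ for $n\geq 1$ and $\mathrm{rad}^0_RM=M$. The Loewy length of $M$ is the least $n$ with $\mathrm{rad}^n_RM=0$; the head of $M$ is $M/\mathrm{rad}^1_RM$. *)

(* Defs.v *)
From HB Require Import structures.
From mathcomp Require Import all_boot all_order all_algebra.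
From mathcomp Require Import boolp classical_sets.
From mathcomp Require Import complex Rstruct.

Set Implicit Arguments.
Unset Strict Implicit.
Unset Printing Implicit Defensive.

Import GRing.Theory.
Local Open Scope ring_scope.
Local Open Scope quotient_scope.

(* [presented rel] is the associative unital [k]-algebra generated by [G]
   subject to the relations [rel]: formal expressions modulo the least
   congruence that contains [rel] and the axioms of [k]-algebras. *)
Inductive alg_term (k : comNzRingType) (G : Type) : Type :=
| tgen of G
| tzero
| topp of alg_term k G
| tadd of alg_term k G & alg_term k G
| tone
| tmul of alg_term k G & alg_term k G
| tscale of k & alg_term k G.

Arguments tgen {k G}.
Arguments tzero {k G}.
Arguments tone {k G}.

HB.instance Definition _ (k : comNzRingType) (G : Type) :=
  gen_eqMixin (alg_term k G).
HB.instance Definition _ (k : comNzRingType) (G : Type) :=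
  gen_choiceMixin (alg_term k G).

Inductive tcong (k : comNzRingType) (G : Type)
    (rel : alg_term k G -> alg_term k G -> Prop) : alg_term k G -> alg_term k G -> Prop :=
| tc_rel x y : rel x y -> tcong rel x y
| tc_refl x : tcong rel x x
| tc_sym x y : tcong rel x y -> tcong rel y x
| tc_trans x y z : tcong rel x y -> tcong rel y z -> tcong rel x z
| tc_opp x y : tcong rel x y -> tcong rel (topp x) (topp y)
| tc_add x y x' y' : tcong rel x x' -> tcong rel y y' ->
    tcong rel (tadd x y) (tadd x' y')
| tc_mul x y x' y' : tcong rel x x' -> tcong rel y y' ->
    tcong rel (tmul x y) (tmul x' y')
| tc_scale c x y : tcong rel x y -> tcong rel (tscale c x) (tscale c y)
| tc_addA x y z : tcong rel (tadd x (tadd y z)) (tadd (tadd x y) z)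
| tc_addC x y : tcong rel (tadd x y) (tadd y x)
| tc_add0 x : tcong rel (tadd tzero x) x
| tc_addN x : tcong rel (tadd (topp x) x) tzero
| tc_mulA x y z : tcong rel (tmul x (tmul y z)) (tmul (tmul x y) z)
| tc_mul1l x : tcong rel (tmul tone x) x
| tc_mul1r x : tcong rel (tmul x tone) x
| tc_mulDl x y z : tcong rel (tmul (tadd x y) z) (tadd (tmul x z) (tmul y z))
| tc_mulDr x y z : tcong rel (tmul x (tadd y z)) (tadd (tmul x y) (tmul x z))
| tc_scaleA a b x : tcong rel (tscale a (tscale b x)) (tscale (a * b) x)
| tc_scale1 x : tcong rel (tscale 1 x) x
| tc_scaleDr a x y :
    tcong rel (tscale a (tadd x y)) (tadd (tscale a x) (tscale a y))
| tc_scaleDl a b x :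
    tcong rel (tscale (a + b) x) (tadd (tscale a x) (tscale b x))
| tc_scaleAl a x y : tcong rel (tscale a (tmul x y)) (tmul (tscale a x) y)
| tc_scaleAr a x y : tcong rel (tscale a (tmul x y)) (tmul x (tscale a y)).

Section Presented.
Variables (k : comNzRingType) (G : Type).
Variable rel : alg_term k G -> alg_term k G -> Prop.

Definition tcongb (x y : alg_term k G) : bool := `[< tcong rel x y >].

Lemma tcongb_refl : reflexive tcongb.
Proof. by move=> x; apply/asboolP; apply: tc_refl. Qed.

Lemma tcongb_sym : symmetric tcongb.
Proof.
by move=> x y; apply/idP/idP => /asboolP h; apply/asboolP; apply: tc_sym.
Qed.

Lemma tcongb_trans : transitive tcongb.
Proof.
move=> y x z /asboolP h1 /asboolP h2; apply/asboolP.
exact: tc_trans h1 h2.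
Qed.

Canonical tcongb_equiv :=
  EquivRel tcongb tcongb_refl tcongb_sym tcongb_trans.

Definition presented : Type := {eq_quot tcongb_equiv}.
HB.instance Definition _ := EqQuotient.on presented.
HB.instance Definition _ := Choice.on presented.

Definition pclass (t : alg_term k G) : presented := \pi_presented t.

Lemma pclass_eq t u : tcong rel t u -> pclass t = pclass u.
Proof. by move=> h; apply/eqmodP/asboolP. Qed.

Lemma pclassP t u : pclass t = pclass u -> tcong rel t u.
Proof. by move=> /eqmodP/asboolP. Qed.

Lemma pclassK (x : presented) : pclass (repr x) = x.
Proof. exact: reprK. Qed.

Lemma repr_pclass t : tcong rel (repr (pclass t)) t.
Proof. by apply: pclassP; rewrite pclassK. Qed.

Lemma pclass_ind (P : presented -> Prop) :
  (forall t, P (pclass t)) -> forall x, P x.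
Proof. by move=> h x; rewrite -(pclassK x). Qed.

Definition padd (x y : presented) : presented := pclass (tadd (repr x) (repr y)).
Definition popp (x : presented) : presented := pclass (topp (repr x)).
Definition pmul (x y : presented) : presented := pclass (tmul (repr x) (repr y)).
Definition pscale (c : k) (x : presented) : presented :=
  pclass (tscale c (repr x)).

Lemma paddE t u : padd (pclass t) (pclass u) = pclass (tadd t u).
Proof. by apply: pclass_eq; apply: tc_add; apply: repr_pclass. Qed.
Lemma poppE t : popp (pclass t) = pclass (topp t).
Proof. by apply: pclass_eq; apply: tc_opp; apply: repr_pclass. Qed.
Lemma pmulE t u : pmul (pclass t) (pclass u) = pclass (tmul t u).
Proof. by apply: pclass_eq; apply: tc_mul; apply: repr_pclass. Qed.
Lemma pscaleE c t : pscale c (pclass t) = pclass (tscale c t).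
Proof. by apply: pclass_eq; apply: tc_scale; apply: repr_pclass. Qed.

Let pE := (paddE, poppE, pmulE, pscaleE).

Lemma paddA : associative padd.
Proof.
elim/pclass_ind=> x; elim/pclass_ind=> y; elim/pclass_ind=> z.
by rewrite !pE; apply/pclass_eq/tc_addA.
Qed.
Lemma paddC : commutative padd.
Proof.
elim/pclass_ind=> x; elim/pclass_ind=> y.
by rewrite !pE; apply/pclass_eq/tc_addC.
Qed.
Lemma padd0 : left_id (pclass tzero) padd.
Proof. by elim/pclass_ind=> x; rewrite !pE; apply/pclass_eq/tc_add0. Qed.
Lemma paddN : left_inverse (pclass tzero) popp padd.
Proof. by elim/pclass_ind=> x; rewrite !pE; apply/pclass_eq/tc_addN. Qed.

HB.instance Definition _ :=
  GRing.isZmodule.Build presented paddA paddC padd0 paddN.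

Lemma pmulA : associative pmul.
Proof.
elim/pclass_ind=> x; elim/pclass_ind=> y; elim/pclass_ind=> z.
by rewrite !pE; apply/pclass_eq/tc_mulA.
Qed.
Lemma pmul1l : left_id (pclass tone) pmul.
Proof. by elim/pclass_ind=> x; rewrite !pE; apply/pclass_eq/tc_mul1l. Qed.
Lemma pmul1r : right_id (pclass tone) pmul.
Proof. by elim/pclass_ind=> x; rewrite !pE; apply/pclass_eq/tc_mul1r. Qed.
Lemma pmulDl : left_distributive pmul +%R.
Proof.
elim/pclass_ind=> x; elim/pclass_ind=> y; elim/pclass_ind=> z.
by rewrite -![_ + _]/(padd _ _) !pE; apply/pclass_eq/tc_mulDl.
Qed.
Lemma pmulDr : right_distributive pmul +%R.
Proof.
elim/pclass_ind=> x; elim/pclass_ind=> y; elim/pclass_ind=> z.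
by rewrite -![_ + _]/(padd _ _) !pE; apply/pclass_eq/tc_mulDr.
Qed.

HB.instance Definition _ :=
  GRing.Zmodule_isPzRing.Build presented pmulA pmul1l pmul1r pmulDl pmulDr.

Lemma pscaleA a b v : pscale a (pscale b v) = pscale (a * b) v.
Proof.
by elim/pclass_ind: v => x; rewrite !pE; apply/pclass_eq/tc_scaleA.
Qed.
Lemma pscale1 : left_id 1 pscale.
Proof. by elim/pclass_ind=> x; rewrite !pE; apply/pclass_eq/tc_scale1. Qed.
Lemma pscaleDr : right_distributive pscale +%R.
Proof.
move=> a; elim/pclass_ind=> x; elim/pclass_ind=> y.
by rewrite -![_ + _]/(padd _ _) !pE; apply/pclass_eq/tc_scaleDr.
Qed.
Lemma pscaleDl v : {morph pscale^~ v : a b / a + b}.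
Proof.
elim/pclass_ind: v => x a b.
rewrite -![pscale a _ + _]/(padd _ _) !pE; exact/pclass_eq/tc_scaleDl.
Qed.

HB.instance Definition _ :=
  GRing.Zmodule_isLmodule.Build k presented pscaleA pscale1 pscaleDr pscaleDl.

Lemma pscaleAl (a : k) (u v : presented) : a *: (u * v) = (a *: u) * v.
Proof.
elim/pclass_ind: u => x; elim/pclass_ind: v => y.
rewrite -![_ * _]/(pmul _ _) -![_ *: _]/(pscale _ _) !pE.
exact/pclass_eq/tc_scaleAl.
Qed.
Lemma pscaleAr (a : k) (u v : presented) : a *: (u * v) = u * (a *: v).
Proof.
elim/pclass_ind: u => x; elim/pclass_ind: v => y.
rewrite -![_ * _]/(pmul _ _) -![_ *: _]/(pscale _ _) !pE.
exact/pclass_eq/tc_scaleAr.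
Qed.

Definition pgen (g : G) : presented := pclass (tgen g).

(* [presented] may be the zero ring. A one-dimensional representation shows that
   it is not, as [algType] requires. *)
Fixpoint teval (f : G -> k) (t : alg_term k G) : k :=
  match t with
  | tgen g => f g
  | tzero => 0
  | topp x => - teval f x
  | tadd x y => teval f x + teval f y
  | tone => 1
  | tmul x y => teval f x * teval f y
  | tscale c x => c * teval f x
  end.

Variable f : G -> k.
Hypothesis f_rel : forall x y, rel x y -> teval f x = teval f y.

Lemma teval_cong x y : tcong rel x y -> teval f x = teval f y.
Proof.
elim=> //=.
- by move=> ? ? ? _ -> _ ->.
- by move=> ? ? _ ->.
- by move=> ? ? ? ? _ -> _ ->.
- by move=> ? ? ? ? _ -> _ ->.
- by move=> ? ? ? _ ->.
- by move=> *; rewrite addrA.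
- by move=> *; rewrite addrC.
- by move=> *; rewrite add0r.
- by move=> *; rewrite addNr.
- by move=> *; rewrite mulrA.
- by move=> *; rewrite mul1r.
- by move=> *; rewrite mulr1.
- by move=> *; rewrite mulrDl.
- by move=> *; rewrite mulrDr.
- by move=> *; rewrite mulrA.
- by move=> *; rewrite mul1r.
- by move=> *; rewrite mulrDr.
- by move=> *; rewrite mulrDl.
- by move=> *; rewrite mulrA.
- by move=> *; rewrite mulrCA.
Qed.

Definition peval (x : presented) : k := teval f (repr x).

Lemma pevalE t : peval (pclass t) = teval f t.
Proof. exact/teval_cong/repr_pclass. Qed.
Lemma peval1 : peval 1 = 1. Proof. exact: pevalE. Qed.
Lemma peval0 : peval 0 = 0. Proof. exact: pevalE. Qed.
Lemma pevalD x y : peval (x + y) = peval x + peval y.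
Proof.
elim/pclass_ind: x => x; elim/pclass_ind: y => y.
by rewrite -![_ + _]/(padd _ _) !pE !pevalE.
Qed.
Lemma pevalB x y : peval (x - y) = peval x - peval y.
Proof.
elim/pclass_ind: x => x; elim/pclass_ind: y => y.
by rewrite -![_ + _]/(padd _ _) -[- pclass y]/(popp _) !pE !pevalE.
Qed.
Lemma pevalM x y : peval (x * y) = peval x * peval y.
Proof.
elim/pclass_ind: x => x; elim/pclass_ind: y => y.
by rewrite -[pclass x * _]/(pmul _ _) !pE !pevalE.
Qed.
Lemma pevalZ c x : peval (c *: x) = c * peval x.
Proof.
elim/pclass_ind: x => x.
by rewrite -[c *: _]/(pscale _ _) !pE !pevalE.
Qed.

Lemma presented_oner_neq0 : (1 : presented) != 0.
Proof.
apply/eqP => /(congr1 peval); rewrite peval1 peval0.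
exact/eqP/oner_neq0.
Qed.

End Presented.

Definition subring (R : pzRingType) (S : set R) : Prop :=
  [/\ S 1, (forall x y, S x -> S y -> S (x - y))
    & forall x y, S x -> S y -> S (x * y)].

Definition subalgebra (k : comNzRingType) (A : algType k) (S : set A) : Prop :=
  subring S /\ forall (c : k) x, S x -> S (c *: x).

Definition subring_gen (R : pzRingType) (E : set R) : set R :=
  fun x => forall S : set R, subring S -> (E `<=` S)%classic -> S x.

Definition subalg_gen (k : comNzRingType) (A : algType k) (E : set A) : set A :=
  fun x => forall S : set A, subalgebra S -> (E `<=` S)%classic -> S x.

Lemma subring_genP (R : pzRingType) (E : set R) : subring (subring_gen E).
Proof.
split.
- by move=> S [h1 _ _] _.
- move=> x y hx hy S hS hE; case: (hS) => _ hB _.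
  by apply: hB; [apply: hx | apply: hy].
- move=> x y hx hy S hS hE; case: (hS) => _ _ hM.
  by apply: hM; [apply: hx | apply: hy].
Qed.

Lemma subalg_genP (k : comNzRingType) (A : algType k) (E : set A) :
  subring (subalg_gen E).
Proof.
split.
- by move=> S [[h1 _ _] _] _.
- move=> x y hx hy S hS hE; case: (hS) => -[_ hB _] _.
  by apply: hB; [apply: hx | apply: hy].
- move=> x y hx hy S hS hE; case: (hS) => -[_ _ hM] _.
  by apply: hM; [apply: hx | apply: hy].
Qed.

Lemma subringI (R : pzRingType) (S T : set R) :
  subring S -> subring T -> subring (S `&` T)%classic.
Proof.
move=> [s1 sB sM] [t1 tB tM]; split=> //.
- by move=> x y [? ?] [? ?]; split; [apply: sB | apply: tB].
- by move=> x y [? ?] [? ?]; split; [apply: sM | apply: tM].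
Qed.

Section SubringType.
Variables (R : nzRingType) (S : set R).

Definition subring_pred (hS : subring S) : {pred R} := fun x => `[< S x >].

Variable hS : subring S.

Lemma subring_pred_closed : subring_closed (subring_pred hS).
Proof.
case: (hS) => s1 sB sM; split.
- exact/asboolP.
- by move=> x y /asboolP ? /asboolP ?; apply/asboolP; apply: sB.
- by move=> x y /asboolP ? /asboolP ?; apply/asboolP; apply: sM.
Qed.

HB.instance Definition _ :=
  GRing.isSubringClosed.Build R (subring_pred hS) subring_pred_closed.

Definition subring_type : Type := {x : R | subring_pred hS x}.

HB.instance Definition _ := [isSub of subring_type for @sval _ _].
HB.instance Definition _ := [Choice of subring_type by <:].
HB.instance Definition _ := [SubChoice_isSubNzRing of subring_type by <:].

(* The ambient ring as a left module over the subring. *)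
Definition restr_module : Type := let _ := hS in R.
HB.instance Definition _ := GRing.Zmodule.on restr_module.

Definition restr_scale (a : subring_type) (x : restr_module) : restr_module :=
  (val a * (x : R) : R).

Lemma restr_scaleA a b v :
  restr_scale a (restr_scale b v) = restr_scale (a * b) v.
Proof. by rewrite /restr_scale mulrA. Qed.
Lemma restr_scale1 : left_id 1 restr_scale.
Proof. by move=> x; rewrite /restr_scale mul1r. Qed.
Lemma restr_scaleDr : right_distributive restr_scale +%R.
Proof. by move=> a x y; rewrite /restr_scale mulrDr. Qed.
Lemma restr_scaleDl v : {morph restr_scale^~ v : a b / a + b}.
Proof. by move=> a b; rewrite /restr_scale mulrDl. Qed.

HB.instance Definition _ :=
  GRing.Zmodule_isLmodule.Build subring_type restr_module
    restr_scaleA restr_scale1 restr_scaleDr restr_scaleDl.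

End SubringType.

Record submodule (R : pzRingType) (M : lmodType R) := Submodule {
  subm_set :> set M;
  subm0 : subm_set 0;
  submD : forall x y, subm_set x -> subm_set y -> subm_set (x + y);
  submZ : forall (a : R) x, subm_set x -> subm_set (a *: x) }.

Section SubmoduleType.
Variables (R : pzRingType) (M : lmodType R) (N : submodule M).

Definition submodule_pred : {pred M} := fun x => `[< subm_set N x >].

Lemma submodule_pred_closed : submod_closed submodule_pred.
Proof.
split; first exact/asboolP/subm0.
move=> a x y /asboolP hx /asboolP hy; apply/asboolP.
by apply: submD => //; apply: submZ.
Qed.

HB.instance Definition _ :=
  GRing.isSubmodClosed.Build R M submodule_pred submodule_pred_closed.

Definition submodule_type : Type := {x : M | submodule_pred x}.

HB.instance Definition _ := [isSub of submodule_type for @sval _ _].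
HB.instance Definition _ := [Choice of submodule_type by <:].
HB.instance Definition _ := [SubChoice_isSubLmodule of submodule_type by <:].

End SubmoduleType.

Section QuotientModule.
Variables (R : pzRingType) (M : lmodType R) (N : submodule M).

Definition qrel (x y : M) : bool := `[< subm_set N (x - y) >].

Lemma submN (x : M) : subm_set N x -> subm_set N (- x).
Proof. by rewrite -scaleN1r; apply: submZ. Qed.

Lemma qrel_refl : reflexive qrel.
Proof. by move=> x; apply/asboolP; rewrite subrr; apply: subm0. Qed.
Lemma qrel_sym : symmetric qrel.
Proof.
by move=> x y; apply/idP/idP => /asboolP h; apply/asboolP;
   rewrite -opprB; apply: submN.
Qed.
Lemma qrel_trans : transitive qrel.
Proof.
move=> y x z /asboolP h1 /asboolP h2; apply/asboolP.
by rewrite -(subrKA y); apply: submD.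
Qed.

Canonical qrel_equiv := EquivRel qrel qrel_refl qrel_sym qrel_trans.

Definition quotient_module : Type := {eq_quot qrel_equiv}.
HB.instance Definition _ := EqQuotient.on quotient_module.
HB.instance Definition _ := Choice.on quotient_module.

Definition qclass (x : M) : quotient_module := \pi_quotient_module x.

Lemma qclass_eq x y : subm_set N (x - y) -> qclass x = qclass y.
Proof. by move=> h; apply/eqmodP/asboolP. Qed.
Lemma qclassP x y : qclass x = qclass y -> subm_set N (x - y).
Proof. by move=> /eqmodP/asboolP. Qed.
Lemma qclassK (x : quotient_module) : qclass (repr x) = x.
Proof. exact: reprK. Qed.
Lemma repr_qclass x : subm_set N (repr (qclass x) - x).
Proof. by apply: qclassP; rewrite qclassK. Qed.
Lemma qclass_ind (P : quotient_module -> Prop) :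
  (forall x, P (qclass x)) -> forall x, P x.
Proof. by move=> h x; rewrite -(qclassK x). Qed.

Definition qadd (x y : quotient_module) := qclass (repr x + repr y).
Definition qopp (x : quotient_module) := qclass (- repr x).
Definition qscale (a : R) (x : quotient_module) := qclass (a *: repr x).

Lemma qaddE x y : qadd (qclass x) (qclass y) = qclass (x + y).
Proof.
by apply: qclass_eq; rewrite opprD addrACA; apply: submD; apply: repr_qclass.
Qed.
Lemma qoppE x : qopp (qclass x) = qclass (- x).
Proof. by apply: qclass_eq; rewrite -opprD; apply/submN/repr_qclass. Qed.
Lemma qscaleE a x : qscale a (qclass x) = qclass (a *: x).
Proof. by apply: qclass_eq; rewrite -scalerBr; apply/submZ/repr_qclass. Qed.

Let qE := (qaddE, qoppE, qscaleE).

Lemma qaddA : associative qadd.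
Proof.
elim/qclass_ind=> x; elim/qclass_ind=> y; elim/qclass_ind=> z.
by rewrite !qE addrA.
Qed.
Lemma qaddC : commutative qadd.
Proof. by elim/qclass_ind=> x; elim/qclass_ind=> y; rewrite !qE addrC. Qed.
Lemma qadd0 : left_id (qclass 0) qadd.
Proof. by elim/qclass_ind=> x; rewrite !qE add0r. Qed.
Lemma qaddN : left_inverse (qclass 0) qopp qadd.
Proof. by elim/qclass_ind=> x; rewrite !qE addNr. Qed.

HB.instance Definition _ :=
  GRing.isZmodule.Build quotient_module qaddA qaddC qadd0 qaddN.

Lemma qscaleA a b v : qscale a (qscale b v) = qscale (a * b) v.
Proof. by elim/qclass_ind: v => x; rewrite !qE scalerA. Qed.
Lemma qscale1 : left_id 1 qscale.
Proof. by elim/qclass_ind=> x; rewrite !qE scale1r. Qed.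
Lemma qscaleDr : right_distributive qscale +%R.
Proof.
move=> a; elim/qclass_ind=> x; elim/qclass_ind=> y.
by rewrite -![_ + _]/(qadd _ _) !qE scalerDr.
Qed.
Lemma qscaleDl v : {morph qscale^~ v : a b / a + b}.
Proof.
elim/qclass_ind: v => x a b.
by rewrite -![qscale a _ + _]/(qadd _ _) !qE scalerDl.
Qed.

HB.instance Definition _ :=
  GRing.Zmodule_isLmodule.Build R quotient_module
    qscaleA qscale1 qscaleDr qscaleDl.

End QuotientModule.

Section Radical.
Variable R : pzRingType.

Definition maximal_left_ideal (I : submodule R^o) : Prop :=
  ~ subm_set I 1 /\
  forall J : submodule R^o, (I `<=` J)%classic -> ~ subm_set J 1 ->
    (J `<=` I)%classic.

Definition jacobson : set R :=
  fun x => forall I : submodule R^o, maximal_left_ideal I -> subm_set I x.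

(* [ideal_prod I N] is I N, the set of finite sums of products. *)
Definition ideal_prod (I : set R) (M : lmodType R) (N : set M) : set M :=
  fun u => exists (n : nat) (a : 'I_n -> R) (v : 'I_n -> M),
    [/\ (forall i, I (a i)), (forall i, N (v i)) & u = \sum_(i < n) a i *: v i].

Fixpoint ideal_pow (I : set R) (n : nat) : set R :=
  match n with
  | 0 => setT
  | 1 => I
  | n'.+1 => ideal_prod I (ideal_pow I n' : set R^o)
  end.

Definition rad_set (M : lmodType R) (n : nat) (N : set M) : set M :=
  if n is 0 then N else ideal_prod (ideal_pow jacobson n) N.

Lemma jacobson_left (a x : R) : jacobson x -> jacobson (a * x).
Proof. by move=> hx I hI; apply: (@submZ _ _ I a); apply: hx. Qed.

Lemma ideal_pow_left (I : set R) n (a x : R) :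
  (forall b y, I y -> I (b * y)) -> ideal_pow I n x -> ideal_pow I n (a * x).
Proof.
move=> hI; case: n => [|[|n]] //=; first exact: hI.
move=> [m [b [v [hb hv ->]]]].
exists m, (fun i => a * b i), v; split=> // [i|]; first exact: hI.
by rewrite mulr_sumr; apply: eq_bigr => i _; rewrite -[_ *: _]/(_ * _)
  -[RHS]/(_ * _) mulrA.
Qed.

Section RadicalSubmodule.
Variables (M : lmodType R) (n : nat) (N : submodule M).

Lemma rad_set0 : rad_set n N 0.
Proof.
rewrite /rad_set; case: n => [|m]; first exact: subm0.
by exists 0, (fun=> 0), (fun=> 0); split=> [[]|[]|]; rewrite ?big_ord0.
Qed.

Lemma rad_setD x y : rad_set n N x -> rad_set n N y -> rad_set n N (x + y).
Proof.
rewrite /rad_set; case: n => [|m]; first exact: submD.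
move=> [m1 [a1 [v1 [ha1 hv1 ->]]]] [m2 [a2 [v2 [ha2 hv2 ->]]]].
exists (m1 + m2),
  (fun i => match split i with inl i1 => a1 i1 | inr i2 => a2 i2 end),
  (fun i => match split i with inl i1 => v1 i1 | inr i2 => v2 i2 end).
split=> [i|i|]; try by case: (split i).
rewrite big_split_ord /=; congr (_ + _); apply: eq_bigr => i _.
  by rewrite (unsplitK (inl i)).
by rewrite (unsplitK (inr i)).
Qed.

Lemma rad_setZ (a : R) x : rad_set n N x -> rad_set n N (a *: x).
Proof.
rewrite /rad_set; case: n => [|m]; first exact: submZ.
move=> [m1 [a1 [v1 [ha1 hv1 ->]]]].
exists m1, (fun i => a * a1 i), v1; split=> // [i|].
  by apply: ideal_pow_left => //; apply: jacobson_left.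
by rewrite scaler_sumr; apply: eq_bigr => i _; rewrite scalerA.
Qed.

Definition mod_rad : submodule M := Submodule rad_set0 rad_setD rad_setZ.

End RadicalSubmodule.

Definition has_loewy_length (M : lmodType R) (N : submodule M) (n : nat) : Prop :=
  mod_rad n N = [set 0]%classic :> set M /\
  forall m, mod_rad m N = [set 0]%classic :> set M -> (n <= m)%N.

Definition lmod_iso (M1 M2 : lmodType R) : Prop :=
  exists f : {linear M1 -> M2}, bijective f.

Definition indecomposable (M : lmodType R) : Prop :=
  (exists x : M, x <> 0) /\
  forall N1 N2 : submodule M,
    (forall x : M, exists x1 x2, [/\ subm_set N1 x1, subm_set N2 x2 & x = x1 + x2]) ->
    (N1 `&` N2 = [set 0])%classic ->
    N1 = [set 0]%classic :> set M \/ N2 = [set 0]%classic :> set M.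

(* The trace of N2 on N1; it is N2 itself when N2 is contained in N1. *)
Definition inner_submodule (M : lmodType R) (N1 N2 : submodule M) :
    submodule (submodule_type N1) :=
  @Submodule R (submodule_type N1) (fun x => subm_set N2 (val x))
    (subm0 N2)
    (fun x y => @submD _ _ N2 (val x) (val y))
    (fun a x => @submZ _ _ N2 a (val x)).

(* The module N1 / N2, for N2 contained in N1. *)
Definition subquotient (M : lmodType R) (N1 N2 : submodule M) : Type :=
  quotient_module (inner_submodule N1 N2).
HB.instance Definition _ (M : lmodType R) (N1 N2 : submodule M) :=
  GRing.Lmodule.on (subquotient N1 N2).

Section Cyclic.
Variables (M : lmodType R) (v : M).

Definition cyclic_set : set M := fun u => exists a : R, u = a *: v.

Lemma cyclic_set0 : cyclic_set 0.
Proof. by exists 0; rewrite scale0r. Qed.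
Lemma cyclic_setD x y : cyclic_set x -> cyclic_set y -> cyclic_set (x + y).
Proof. by move=> [a ->] [b ->]; exists (a + b); rewrite scalerDl. Qed.
Lemma cyclic_setZ (a : R) x : cyclic_set x -> cyclic_set (a *: x).
Proof. by move=> [b ->]; exists (a * b); rewrite scalerA. Qed.

Definition cyclic_submodule : submodule M :=
  Submodule cyclic_set0 cyclic_setD cyclic_setZ.

End Cyclic.

End Radical.

Definition sum_of_sets (V : zmodType) (I : finType) (P : pred I)
    (N : I -> set V) : set V :=
  fun u => exists v : I -> V,
    (forall i, P i -> N i (v i)) /\ u = \sum_(i | P i) v i.

Definition line (k : comNzRingType) (V : lmodType k) (v : V) : set V :=
  fun u => exists c : k, u = c *: v.

Local Notation C := (Rdefinitions.R)[i].

Record sl2 : Type := Sl2 { sl2_mx : 'M[C]_2; _ : \tr sl2_mx == 0 }.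
HB.instance Definition _ := [isSub for sl2_mx].

(* The relations making the inclusion of sl2 linear and bracket-preserving, so
   that [env] is the universal enveloping algebra. *)
Inductive env_rel : alg_term C sl2 -> alg_term C sl2 -> Prop :=
| env_add (x y z : sl2) : val z = val x + val y ->
    env_rel (tgen z) (tadd (tgen x) (tgen y))
| env_scale (c : C) (x z : sl2) : val z = c *: val x ->
    env_rel (tgen z) (tscale c (tgen x))
| env_bracket (x y z : sl2) : val z = val x *m val y - val y *m val x ->
    env_rel (tgen z)
      (tadd (tmul (tgen x) (tgen y)) (topp (tmul (tgen y) (tgen x)))).

Definition env : Type := presented env_rel.

Lemma env_rel_counit x y :
  env_rel x y -> teval (fun=> 0) x = teval (fun=> 0) y.
Proof. by case=> /= *; rewrite ?mulr0 ?subrr ?addr0. Qed.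

HB.instance Definition _ := GRing.PzRing.on env.
HB.instance Definition _ := GRing.Lmodule.on env.
HB.instance Definition _ := GRing.PzSemiRing_isNonZero.Build env
  (presented_oner_neq0 env_rel_counit).
HB.instance Definition _ := GRing.LSemiModule_isLSemiAlgebra.Build C env
  (@pscaleAl _ _ env_rel).
HB.instance Definition _ := GRing.LSemiAlgebra_isSemiAlgebra.Build C env
  (@pscaleAr _ _ env_rel).

Lemma slX_proof : \tr (delta_mx 0 1 : 'M[C]_2) == 0.
Proof. by rewrite /mxtrace !big_ord_recl big_ord0 !mxE /= !addr0. Qed.
Lemma slY_proof : \tr (delta_mx 1 0 : 'M[C]_2) == 0.
Proof. by rewrite /mxtrace !big_ord_recl big_ord0 !mxE /= !addr0. Qed.
Lemma slH_proof : \tr (delta_mx 0 0 - delta_mx 1 1 : 'M[C]_2) == 0.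
Proof.
by rewrite /mxtrace !big_ord_recl big_ord0 !mxE /= subr0 sub0r addr0 subrr.
Qed.

Definition envX : env := pgen env_rel (Sl2 slX_proof).
Definition envY : env := pgen env_rel (Sl2 slY_proof).
Definition envH : env := pgen env_rel (Sl2 slH_proof).

Definition env_div (x : env) (m : nat) : env := (m`!%:R : C)^-1 *: x ^+ m.

Definition env_binH (c : int) (m : nat) : env :=
  (m`!%:R : C)^-1 *: \prod_(i < m) (envH + (c - i%:Z)%:~R).

Definition UZ_set : set env :=
  subring_gen (fun x => exists m, x = env_div envX m \/ x = env_div envY m).

Definition UZ : nzRingType := subring_type (subring_genP _ : subring UZ_set).

(* UZ (x)_Z k as the k-algebra generated by the symbols [x], x in UZ, subject to
   [1] = 1, [x + y] = [x] + [y], [x y] = [x] [y]. *)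
Inductive hyper_rel (k : comNzRingType) : alg_term k UZ -> alg_term k UZ -> Prop :=
| hyper_one : hyper_rel (tgen 1) tone
| hyper_add x y : hyper_rel (tgen (x + y)) (tadd (tgen x) (tgen y))
| hyper_mul x y : hyper_rel (tgen (x * y)) (tmul (tgen x) (tgen y)).

Definition env_counit : env -> C := peval (fun=> 0).

Lemma UZ_counit (x : UZ) : exists n : int, env_counit (val x) = n%:~R.
Proof.
case: x => x /= /asboolP h; rewrite /env_counit.
apply: (h (fun y => exists n : int, peval (fun=> 0) y = n%:~R)); first split.
- by exists 1; rewrite (peval1 env_rel_counit).
- move=> y z [m hm] [n hn]; exists (m - n).
  by rewrite (pevalB env_rel_counit) hm hn rmorphB.
- move=> y z [m hm] [n hn]; exists (m * n).
  by rewrite (pevalM env_rel_counit) hm hn rmorphM.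
have evX (y : env) m : peval (fun=> 0) y = 0 ->
    exists n : int, peval (fun=> 0) (env_div y m) = n%:~R.
  move=> hy; rewrite /env_div (pevalZ env_rel_counit).
  case: m => [|m].
    exists 1; rewrite expr0 (peval1 env_rel_counit) mulr1.
    by rewrite (_ : 0`! = 1)%N // invr1.
  by exists 0; rewrite exprS (pevalM env_rel_counit) hy mul0r mulr0.
by move=> y [m [->|->]]; apply: evX; rewrite (pevalE env_rel_counit).
Qed.

Definition UZ_counit_int (x : UZ) : int := sval (cid (UZ_counit x)).

Lemma UZ_counit_intP (x : UZ) (n : int) :
  env_counit (val x) = n%:~R -> UZ_counit_int x = n.
Proof.
rewrite /UZ_counit_int; case: cid => m /= -> /eqP.
by rewrite eqr_int => /eqP.
Qed.

Lemma UZ_counit_intE (x : UZ) : env_counit (val x) = (UZ_counit_int x)%:~R.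
Proof. by rewrite /UZ_counit_int; case: cid. Qed.

Section Hyperalgebra.
Variables (k : closedFieldType) (p : nat).

Definition hyper : Type := presented (@hyper_rel k).
Local Notation U := hyper.

Lemma hyper_rel_counit x y : @hyper_rel k x y ->
  teval (fun u => (UZ_counit_int u)%:~R) x =
  teval (fun u => (UZ_counit_int u)%:~R) y.
Proof.
case=> /= [|u v|u v].
- rewrite (@UZ_counit_intP _ 1) //; exact: (peval1 env_rel_counit).
- rewrite -intrD (@UZ_counit_intP _ (UZ_counit_int u + UZ_counit_int v)) //.
  by rewrite intrD -!UZ_counit_intE -(pevalD env_rel_counit).
- rewrite -intrM (@UZ_counit_intP _ (UZ_counit_int u * UZ_counit_int v)) //.
  by rewrite intrM -!UZ_counit_intE -(pevalM env_rel_counit).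
Qed.

HB.instance Definition _ := GRing.PzRing.on hyper.
HB.instance Definition _ := GRing.Lmodule.on hyper.
HB.instance Definition _ := GRing.PzSemiRing_isNonZero.Build hyper
  (presented_oner_neq0 hyper_rel_counit).
HB.instance Definition _ := GRing.LSemiModule_isLSemiAlgebra.Build k hyper
  (@pscaleAl _ _ (@hyper_rel k)).
HB.instance Definition _ := GRing.LSemiAlgebra_isSemiAlgebra.Build k hyper
  (@pscaleAr _ _ (@hyper_rel k)).

(* Image in U of an element of UZ. It is only applied to elements of UZ (in
   particular all [env_binH c m] lie there); it sends everything else to 0. *)
Definition to_hyper (x : env) : U := pgen (@hyper_rel k) (insubd (0 : UZ) x).

Definition hX : U := to_hyper envX.
Definition hY : U := to_hyper envY.
Definition divX (m : nat) : U := to_hyper (env_div envX m).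
Definition divY (m : nat) : U := to_hyper (env_div envY m).
Definition binH (c : int) (m : nat) : U := to_hyper (env_binH c m).

Definition hyper_trunc (r : nat) : set U :=
  subalg_gen (fun x => exists i, (i < r)%N /\
    (x = divX (p ^ i)%N \/ x = divY (p ^ i)%N)).

Definition hyperA : set U :=
  subalg_gen (fun x => exists i,
    x = binH 0 (p ^ i)%N \/ x = divY (p ^ i)%N * divX (p ^ i)%N).

Definition Ar_set (r : nat) : set U := (hyperA `&` hyper_trunc r)%classic.

Lemma Ar_subring r : subring (Ar_set r).
Proof. by apply: subringI; apply: subalg_genP. Qed.

Definition Ar (r : nat) : nzRingType := subring_type (Ar_subring r).

(* U as a left A_r-module; it contains all modules considered below. *)
Definition U_mod (r : nat) : lmodType (Ar r) := restr_module (Ar_subring r).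

Definition is_Fr' (f : U -> U) : Prop :=
  linear f /\ forall m n m' : nat,
    f (divY m * binH 0 n * divX m') =
    divY (m * p)%N * binH 0 (n * p)%N * divX (m' * p)%N.

(* The unique map satisfying [is_Fr']. *)
Definition Fr' : U -> U := xget (fun=> 0) [set f | is_Fr' f]%classic.

Definition mu_ (a : int) : U := binH (- a - 1) p.-1.

(* A pair (a, j); j is rational because of the label 1/2 used for p = 2. *)
Definition label : Type := (nat * rat)%type.

Definition in_P (x : label) : Prop :=
  if p == 2%N then is_true (x \in [:: (0%N, 1 / 2%:R); (1%N, 0); (1%N, 1)])
  else (x.1 < p)%N /\ exists2 s : nat, (s <= p.-1./2)%N & x.2 = s%:R.

Definition psi : {poly 'F_p} := \prod_(i : 'F_p) ('X - (i ^+ 2)%:P).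

Definition psi_eps (e : bool) (j : 'F_p) : {poly 'F_p} :=
  if e then psi %/ ('X - (j ^+ 2)%:P)
  else if j == 0 then \prod_(i : 'F_p | i != 0) ('X - (i ^+ 2)%:P)
  else 2%:R *: 'X * ('X + (j ^+ 2)%:P)
       * \prod_(i : 'F_p | [&& i != 0, i != j & i != - j]) ('X - (i ^+ 2)%:P).

Definition Fp_to_k (c : 'F_p) : k := (nat_of_ord c)%:R.

Definition eval_Fp (q : {poly 'F_p}) (u : U) : U :=
  horner_alg u (map_poly Fp_to_k q).

Definition B1 (e : bool) (x : label) : U :=
  let: (a, j) := x in
  let m := mu_ a%:Z in
  if p == 2%N then
    if a == 0%N then if e then m * hY * hX else m
    else if j == 0 then m * hY * hX else m * hY * hX + m
  else eval_Fp (psi_eps e (ratr j))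
         (m * hY * hX + Fp_to_k (((a%:R + 1) / 2%:R) ^+ 2) *: 1) * m.

Definition typeA (x : label) : bool :=
  let: (a, j) := x in
  [&& p != 2%N, ~~ odd a, ((p%:R - a%:R + 1) / 2%:R <= j)%R & (j <= (p%:R - 1) / 2%:R)%R].

Definition typeC (x : label) : bool :=
  let: (a, j) := x in
  if p == 2%N then (a == 1%N) && (j == 0)
  else [&& odd a, (0 <= j)%R & (j <= (a%:R - 1) / 2%:R)%R].

Definition shift (x : label) : nat :=
  (if p == 2 then 1 else if odd x.1 then (p - x.1)./2 else (p - x.1 + 1)./2)%N.

(* The unique coefficients c_m, 0 <= m < p, with
   B1 e (a, j) = mu_a \sum_m c_m Y^m X^m. *)
Definition B_coef (e : bool) (x : label) : {ffun 'I_p -> 'F_p} :=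
  xget [ffun=> 0] [set c : {ffun 'I_p -> 'F_p} |
    B1 e x = mu_ x.1%:Z * \sum_(m < p) Fp_to_k (c m) *: (hY ^+ m * hX ^+ m)]%classic.

(* Pairs in [in_P] not of type (A) or (C) are exactly those of type (B) or (D). *)
Definition Zmap (e : bool) (z : U) (x : label) : U :=
  let s := shift x in
  if typeA x || typeC x then
    mu_ x.1%:Z * (\sum_(m < p | (s <= m)%N)
      Fp_to_k (B_coef e x m) *: (hY ^+ m * hX ^+ (m - s) * Fr' z * hX ^+ s))
  else Fr' z * B1 e x.

(* The value at [::] is never used, since r >= 1. *)
Fixpoint B_seq (s : seq (bool * label)) : U :=
  match s with
  | [::] => 1
  | [:: ex] => B1 ex.1 ex.2
  | ex :: s' => Zmap ex.1 (B_seq s') ex.2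
  end.

Definition Bvec (r : nat) (e : r.-tuple bool) (x : r.-tuple label) : U :=
  B_seq (zip e x).

(* The positions at which a member of X_r(a, j) must be 0. *)
Definition forced0 (x : label) : bool := if p == 2%N then x.1 == 1%N else x.2 == 0.

Definition in_X (r : nat) (x : r.-tuple label) (e : r.-tuple bool) : bool :=
  [forall i, forced0 (tnth x i) ==> ~~ tnth e i].

Definition w_of (r : nat) (x : r.-tuple label) : nat :=
  #|[set i | ~~ forced0 (tnth x i)]|.

Definition tau (r : nat) (x : r.-tuple label) : r.-tuple bool :=
  [tuple ~~ forced0 (tnth x i) | i < r].

Definition cyc (r : nat) (v : U) : submodule (U_mod r) :=
  @cyclic_submodule (Ar r) (U_mod r) v.

Definition S_mod (r : nat) (x : r.-tuple label) : submodule (U_mod r) :=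
  cyc r (Bvec (tau x) x).

End Hyperalgebra.

Definition hamming_weight (r : nat) (e : r.-tuple bool) : nat :=
  #|[set i | tnth e i]|.

Definition hamming_dist (r : nat) (e f : r.-tuple bool) : nat :=
  #|[set i | tnth e i != tnth f i]|.

Definition tuple_le (r : nat) (e f : r.-tuple bool) : bool :=
  [forall i, tnth e i ==> tnth f i].

(* Main.v *)
(* Write y = YX. The idempotent mu_a projects onto the weights congruent to a
   modulo p, and on it the products Y^m X^m become polynomials in y. Thus
   B^(e)(a, j) = f_e(y) mu_a, where, modulo the polynomial in y that kills mu_a,
   f_0^2 = f_0 and y f_0 is a combination of f_0 and f_1. If e = 1 is allowed at
   (a, j), then also f_0 f_1 = f_1, f_1^2 = 0 and y f_1 is a multiple of f_1;
   otherwise y f_0 is a multiple of f_0. Let phi_d send Y^(m) g(H) X^(n) to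
   Y^(mp) g(floor(H/p) + d) X^(np), with d = 1 for the types (A), (C) and d = 0
   for (B), (D). Then Z^(e)(z; (a, j)) = phi_d(z) B^(e)(a, j), and phi_d is
   multiplicative when applied to B^(e)(a, j): the only obstruction is
   sum_(0 < i < p) binom(a, i) Y^(p-i) X^(p-i), which acts on it by the scalar d.
   By induction on r, for members eps, theta of X_r(a, j), the product
   B^(eps) B^(theta) is B^(eps + theta) when the supports are disjoint and 0
   otherwise, A_r B^(eps) is spanned by the B^(theta) with theta >= eps, and
   B^(tau) <> 0. Hence a B^(eps) with eps <> 0 squares to zero for every a in
   A_r, so B^(eps) lies in the radical, while the radical kills the simple module
   k B^(tau) and therefore strictly raises eps. Multiplication by
   B^(tau - theta) reads off coefficients of B^(theta), which identifies the
   radical layers. *)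
Require Import Defs.
From HB Require Import structures.
From mathcomp Require Import all_boot all_order all_algebra.
From mathcomp Require Import boolp classical_sets.
From mathcomp Require Import finfield ring zify lra complex Rstruct.
Set Implicit Arguments.
Unset Strict Implicit.
Unset Printing Implicit Defensive.
Import GRing.Theory.
Local Open Scope ring_scope.

(** [hyper k] is known only through generators and relations, so its basis has to be proved:
    spanning by commutation formulas, independence by integral representations reduced to [k]. The
    torus part is then treated as the algebra of p-adically locally constant functions of the weight
    ([Hfun]). Lucas's theorem says that binom(z, np) depends on floor(z/p) only, so phi_d becomes
    composition with floor(z/p) + d. The scalar d has the following origin. With 2b = a + 1, the
    polynomial in y = YX that kills mu_a has the roots (b + t)^2 - b^2 for 0 <= t < p. The factors
    with t < p - a come from Y^(p-a) X^(p-a), the last a ones from X^a Y^a. The first group turns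
    the defect into 1, the second turns it into 0. The polynomial of a label contains every factor
    with b + t different from j and -j, and the type of the label records which of the two groups
    avoids these two values; parity decides it. The radical computation uses only the product rule,
    the triangular action and B^(tau) <> 0, so it is carried out for an abstract family indexed by
    subsets. *)

Section BinomialPolynomial.
Variable F : numFieldType.

Lemma fact_neq0 n : (n`!%:R : F) != 0.
Proof. by rewrite Num.Theory.pnatr_eq0 -lt0n fact_gt0. Qed.

Lemma natS_neq0 n : (n.+1%:R : F) != 0.
Proof. by rewrite Num.Theory.pnatr_eq0. Qed.

Definition binp (c : int) (m : nat) : {poly F} :=
  (m`!%:R : F)^-1 *: \prod_(i < m) ('X + (c - i%:Z)%:~R).

Lemma binp0 c : binp c 0 = 1.
Proof. by rewrite /binp big_ord0 fact0 invr1 scale1r. Qed.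

Lemma binp_succ c k : k.+1%:R *: binp c k.+1 = binp c k * ('X + (c - k%:Z)%:~R).
Proof.
rewrite /binp big_ord_recr /= scalerA factS natrM invfM mulrA.
by rewrite divff ?natS_neq0 // mul1r scalerAl.
Qed.

Lemma binp_succ_l c k : k.+1%:R *: binp (c + 1) k.+1 = binp c k * ('X + (c + 1)%:~R).
Proof.
rewrite /binp big_ord_recl /= scalerA factS natrM invfM mulrA.
rewrite divff ?natS_neq0 // mul1r -scalerAl subr0 mulrC; congr (_ *: (_ * _)).
by apply: eq_bigr => i _; congr (_ + _%:~R); rewrite /bump /=; lia.
Qed.

Lemma binp_pascal c k : binp (c + 1) k.+1 = binp c k.+1 + binp c k.
Proof.
apply: (scalerI (natS_neq0 k)); rewrite scalerDr binp_succ_l binp_succ.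
rewrite scaler_nat -[binp _ _ *+ _]mulr_natr -mulrDr; congr (_ * _).
rewrite -[k.+1]addn1 natrD !(rmorphB, rmorphD) /=.
rewrite -!pmulrn; ring.
Qed.

Lemma comp_poly_int (z : int) (q : {poly F}) : z%:~R \Po q = z%:~R.
Proof. by rewrite -(rmorph_int (@polyC F)) comp_polyC. Qed.

Lemma binp_comp c k (d : int) : binp c k \Po ('X + d%:~R) = binp (c + d) k.
Proof.
rewrite /binp comp_polyZ; congr (_ *: _); rewrite rmorph_prod /=.
apply: eq_bigr => i _; rewrite comp_polyD comp_polyX -addrA.
by congr (_ + _); rewrite comp_poly_int -intrD; congr (_%:~R); ring.
Qed.

Lemma size_binp c m : (size (binp c m) <= m.+1)%N.
Proof.
apply: leq_trans (size_scale_leq _ _) _.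
apply: leq_trans (size_poly_prod_leq _ _) _; rewrite /= card_ord.
rewrite (eq_bigr (fun=> 2%N)) => [|i _].
  by rewrite sum_nat_const card_ord; lia.
by rewrite -[_%:~R](rmorph_int (@polyC F)) size_XaddC.
Qed.

End BinomialPolynomial.

(** * Divided powers in an algebra with an sl2-triple *)

Section Sl2Triple.
Variables (F : numFieldType) (E : algType F).

Definition divpow (Z : E) (m : nat) : E := (m`!%:R : F)^-1 *: Z ^+ m.
(* [Z^(m-k)], with junk-free value [0] when [k > m]. *)
Definition divpow_sub (Z : E) (m k : nat) : E :=
  if (k <= m)%N then divpow Z (m - k) else 0.

Lemma divpow0 Z : divpow Z 0 = 1.
Proof. by rewrite /divpow fact0 invr1 scale1r. Qed.

Lemma divpow1 Z : divpow Z 1 = Z.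
Proof. by rewrite /divpow invr1 scale1r. Qed.

Lemma divpow_subnn Z m : divpow_sub Z m m = 1.
Proof. by rewrite /divpow_sub leqnn subnn divpow0. Qed.

Lemma mul_divpow Z n : Z * divpow Z n = n.+1%:R *: divpow Z n.+1.
Proof.
rewrite /divpow -scalerAr -exprS scalerA factS natrM invfM mulrA.
by rewrite divff ?natS_neq0 // mul1r.
Qed.

Lemma divpowM Z m n : divpow Z m * divpow Z n = 'C(m + n, m)%:R *: divpow Z (m + n).
Proof.
rewrite /divpow -scalerAl -scalerAr -exprD !scalerA; congr (_ *: _).
have := @bin_fact (m + n) m (leq_addr _ _); rewrite addKn => <-.
rewrite !natrM; field; rewrite !fact_neq0 /=.
by rewrite Num.Theory.pnatr_eq0 -lt0n bin_gt0 leq_addr.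
Qed.

Lemma horner_shift (H Z : E) (c : F) (P : {poly F}) :
  H * Z = Z * (H + c *: 1) ->
  horner_alg H P * Z = Z * horner_alg H (P \Po ('X + c%:P)).
Proof.
move=> HZ; elim/poly_ind: P => [|P d IH].
  by rewrite comp_poly0 !rmorph0 mul0r mulr0.
have hq : horner_alg H ('X + c%:P) = H + c *: 1.
  by rewrite rmorphD /= horner_algX horner_algC.
rewrite comp_poly_MXaddC !rmorphD !rmorphM /= hq !horner_algX !horner_algC.
rewrite mulrDl -mulrA HZ mulrA IH -mulrA [RHS]mulrDr; congr (_ + _).
by rewrite mulr_algl mulr_algr.
Qed.

Lemma comm_expr (H Z : E) (c : F) n :
  H * Z = Z * (H + c%:A) -> H * Z ^+ n = Z ^+ n * (H + (c * n%:R)%:A).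
Proof.
move=> HZ; elim: n => [|n IH]; first by rewrite mulr0 scale0r addr0 mulr1 mul1r.
rewrite exprSr mulrA IH -!mulrA; congr (_ * _).
rewrite mulrDl HZ mulr_algl -[_ *: Z]mulr_algr -mulrDr -addrA -scalerDl.
by rewrite -natr1 [c * (_ + 1)]mulrDr mulr1 [c + _]addrC.
Qed.

Lemma horner_shift_divpow (H Z : E) (c : int) n (P : {poly F}) :
  H * Z = Z * (H + (c%:~R)%:A) ->
  horner_alg H P * divpow Z n =
    divpow Z n * horner_alg H (P \Po ('X + (c * n%:Z)%:~R)).
Proof.
move=> HZ; rewrite -[in RHS](rmorph_int (@polyC F)); apply: horner_shift.
rewrite /divpow -scalerAl -scalerAr; congr (_ *: _).
by rewrite (comm_expr _ HZ) intrM.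
Qed.

Variables X Y H : E.
Hypothesis XY : X * Y = Y * X + H.
Hypothesis HX : H * X = X * (H + (2%:~R)%:A).
Hypothesis HY : H * Y = Y * (H + ((- 2)%:~R)%:A).
Local Notation hp := (horner_alg H).

Lemma X_expY j :
  X * Y ^+ j.+1 = Y ^+ j.+1 * X + Y ^+ j * hp (j.+1%:R * ('X - j%:R)).
Proof.
elim: j => [|j IH].
  by rewrite !expr1 expr0 !mul1r subr0 horner_algX XY.
rewrite [in LHS]exprSr mulrA IH mulrDl -[_ * X * Y]mulrA XY mulrDr mulrA -exprSr -addrA.
congr (_ + _); rewrite -mulrA (@horner_shift H Y (- 2)%:~R) //.
rewrite mulrA -exprSr -mulrDr -[X in _ * (X + _)](horner_algX H) -rmorphD /=.
congr (_ * hp _); rewrite comp_polyM comp_polyB comp_polyX.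
rewrite -!(rmorph_nat (@polyC F)) !comp_polyC !rmorph_nat rmorph_int.
rewrite -[j.+2]addn2 -[j.+1]addn1 !natrD !rmorphN /= -!pmulrn; ring.
Qed.

Lemma X_divY_sub n k :
  X * divpow_sub Y n k = divpow_sub Y n k * X +
    divpow_sub Y n k.+1 * hp ('X - n%:R + (k.+1)%:R).
Proof.
rewrite /divpow_sub; case: (ltnP k n) => [kn|].
  rewrite (ltnW kn).
  have -> : (n - k = (n - k.+1).+1)%N by lia.
  set j := (n - k.+1)%N; rewrite /divpow -!scalerAl -scalerAr X_expY scalerDr.
  congr (_ + _); rewrite factS natrM invfM [_^-1 * _]mulrC -scalerA scalerAr.
  congr (_ *: (_ * _)); rewrite rmorphM rmorph_nat /= mulr_natl -scaler_nat.
  rewrite scalerA mulVf ?natS_neq0 // scale1r; congr hp.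
  have -> : (n%:R = j%:R + k.+1%:R :> {poly F}) by rewrite -natrD; congr _%:R; lia.
  by rewrite opprD addrA addrNK.
rewrite leq_eqVlt => /predU1P[->|nk].
  by rewrite leqnn subnn divpow0 mulr1 mul1r mul0r addr0.
by rewrite ifF ?mulr0 ?mul0r ?addr0 //; lia.
Qed.

Lemma X_divX_sub m k :
  X * divpow_sub X m k = (m.+1%:R - k%:R) *: divpow_sub X m.+1 k.
Proof.
rewrite /divpow_sub; case: leqP => [km|mk].
  rewrite mul_divpow ifT; last by lia.
  by rewrite subSn // -natrB; [rewrite subSn|lia].
rewrite mulr0; case: leqP => [km|]; last by rewrite scaler0.
by have -> : k = m.+1; [lia | rewrite subrr scale0r].
Qed.

(** Kostant's formula. After multiplication by m + 1 the induction moves one more [X] through the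
    sum: passing Y^(n-k) leaves a term of index k and a bracket term of index k + 1, and Pascal's
    rule merges them. The triple is arbitrary because the formula is used again for (Y, X, -H). *)
Lemma divpow_commutation m n :
  divpow X m * divpow Y n =
    \sum_(k < m.+1) divpow_sub Y n k *
       hp (binp F (2 * k%:Z - m%:Z - n%:Z) k) * divpow_sub X m k.
Proof.
elim: m => [|m IH].
  by rewrite big_ord1 /divpow_sub /= binp0 rmorph1 divpow0 !mulr1 mul1r subn0.
apply: (scalerI (natS_neq0 F m)).
rewrite scalerAl -mul_divpow -mulrA IH mulr_sumr scaler_sumr.
pose c (k : nat) : int := 2 * k%:Z - m%:Z - n%:Z.
have Xhp P : X * hp P = hp (P \Po ('X + (- 2)%:~R)) * X.
  have := @horner_shift_divpow H X 2 1 (P \Po ('X + (- 2)%:~R)) HX.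
  rewrite divpow1 => ->; congr (_ * hp _); rewrite -comp_polyA.
  by rewrite comp_polyD comp_polyX comp_poly_int -addrA -intrD addr0 comp_polyXr.
pose f k := (m.+1%:R - k%:R : F) *: (divpow_sub Y n k *
  hp (binp F (c k - 2) k) * divpow_sub X m.+1 k).
pose g k := divpow_sub Y n k.+1 *
  hp (('X - n%:R + k.+1%:R) * binp F (c k) k) * divpow_sub X m.+1 k.+1.
transitivity (\sum_(k < m.+1) (f k + g k)).
  apply: eq_bigr => k _; rewrite -[_ * _ * divpow_sub _ _ _]mulrA [X * _]mulrA.
  rewrite X_divY_sub [(_ + _) * _]mulrDl; congr (_ + _).
    rewrite -[_ * X * _]mulrA [X * (hp _ * _)]mulrA Xhp binp_comp.
    by rewrite -[_ * X * _]mulrA X_divX_sub /f -!scalerAr !mulrA.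
  by rewrite /g rmorphM !mulrA.
rewrite big_split /=.
(* The coefficient m + 1 - k of [f] vanishes at k = m + 1, so the sum can be extended by one term to
   match [g] after its shift of index. *)
transitivity (\sum_(k < m.+2) f k + \sum_(k < m.+1) g k).
  by rewrite [\sum_(k < m.+2) f k]big_ord_recr /= [f m.+1]/f subrr scale0r addr0.
rewrite big_ord_recl [RHS]big_ord_recl -addrA -big_split /=; congr (_ + _).
  by rewrite /f subr0 !binp0.
apply: eq_bigr => k _; rewrite /f /g /bump /= !add1n.
have hpZ a P : a *: hp P = hp (a *: P)
  by rewrite -[a *: P]mul_polyC rmorphM /= horner_algC mulr_algl.
rewrite scalerAl scalerAr [RHS]scalerAl [_ *: _ in RHS]scalerAr !hpZ -mulrDl -mulrDr -rmorphD.
have -> : c k.+1 - 2 = c k by rewrite /c; lia.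
have -> : 2 * k.+1%:Z - m.+1%:Z - n%:Z = c k + 1 by rewrite /c; lia.
congr (_ * hp _ * _); rewrite binp_pascal scalerBl scalerDr binp_succ.
have -> : m.+1%:R *: binp F (c k) k = binp F (c k) k * m.+1%:R.
  by rewrite scaler_nat mulr_natr.
rewrite /c; ring.
Qed.
End Sl2Triple.

(** * Binomials at integers and Lucas's theorem *)

(** [Negz n] stands for -(n + 1), and upper negation turns binom(-(n+1), m) into the second
    formula. *)
Definition binz (z : int) (m : nat) : int :=
  match z with
  | Posz n => 'C(n, m)
  | Negz n => (-1) ^+ m * 'C(n + m, m)%:Z
  end.

Lemma binz0 z : binz z 0 = 1.
Proof. by case: z => n; rewrite /= bin0 ?expr0 ?mul1r. Qed.

Lemma binz0l m : binz 0 m = (m == 0%N)%:Z.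
Proof. by rewrite /= bin0n. Qed.

Lemma binz_pascal z m : binz (z + 1) m.+1 = binz z m.+1 + binz z m.
Proof.
case: z => [n|[|n]].
- by rewrite -PoszD addn1 /= binS.
- by rewrite (_ : Negz 0 + 1 = 0) //= !add0n !binn bin0n exprS mulN1r mulNr addNr.
rewrite (_ : Negz n.+1 + 1 = Negz n); last by rewrite !NegzE; lia.
rewrite /= !addSn !addnS (binS (n + m).+1) PoszD exprS; ring.
Qed.

(** Pascal's rule propagates upwards from z = 0 directly, and downwards by an inner induction on m
    that starts at the column m = 0. It serves to identify binomials given by different formulas. *)
Lemma pascal_unique (R : zmodType) (f g : int -> nat -> R) :
  (forall z m, f (z + 1) m.+1 = f z m.+1 + f z m) ->
  (forall z m, g (z + 1) m.+1 = g z m.+1 + g z m) ->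
  (forall z, f z 0 = g z 0) -> (forall m, f 0 m = g 0 m) -> f =2 g.
Proof.
move=> fS gS fg0 f0g; elim/int_rec => [|n IH|n IH] m //.
  by case: m => [|m]; rewrite ?fg0 // -addn1 PoszD fS gS !IH.
have e : - (n.+1%:Z) + 1 = - (n%:Z) by lia.
elim: m => [|m IHm]; first exact: fg0.
have := IH m.+1; rewrite -e fS gS IHm => /addIr; exact.
Qed.

Section EvalBinp.
Variable F : numFieldType.

Lemma horner_binp c m (z : int) : (binp F c m).[z%:~R] = (binz (z + c) m)%:~R.
Proof.
have -> : (binp F c m).[z%:~R] = (binp F (z + c) m).[0].
  rewrite [z + c]addrC -binp_comp horner_comp hornerD hornerX add0r.
  by rewrite -[z%:~R in RHS](rmorph_int (@polyC F)) hornerC.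
have h := @pascal_unique F (fun c m => (binp F c m).[0])
  (fun c m => (binz c m)%:~R) _ _ _ _; apply: h.
- by move=> z' m'; rewrite binp_pascal hornerD.
- by move=> z' m'; rewrite binz_pascal rmorphD.
- by move=> z'; rewrite binp0 binz0 hornerC.
case=> [|m']; first by rewrite binp0 binz0 hornerC.
rewrite binz0l /= /binp hornerZ horner_prod big_ord_recl /=.
by rewrite subrr addr0 hornerX mul0r mulr0.
Qed.

(** The matrix of the ['C(n, i)] is unitriangular, so Newton interpolation at 0, ..., N - 1 needs no
    division and works over any ring. *)
Lemma binomial_interpolation (R : pzRingType) (f : nat -> R) N :
  exists c : nat -> R, forall n, (n < N)%N ->
    f n = \sum_(i < N) c i * 'C(n, i)%:R.
Proof.
elim: N => [|N [c hc]]; first by exists f.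
exists (fun i => if i == N then f N - \sum_(i < N) c i * 'C(N, i)%:R else c i).
have e n : \sum_(i < N) (if (i : nat) == N then f N - \sum_(i < N) c i * 'C(N, i)%:R
    else c i) * 'C(n, i)%:R = \sum_(i < N) c i * 'C(n, i)%:R.
  by apply: eq_bigr => i _; rewrite ifF // ltn_eqF.
move=> n; rewrite ltnS leq_eqVlt big_ord_recr /= eqxx e => /predU1P[->|nN].
  by rewrite binn mulr1 addrC subrK.
by rewrite bin_small // mulr0 addr0 hc.
Qed.

(** Interpolating the integral values at 0, ..., N - 1 leaves a difference with N roots and size at
    most N. This is what places integer-valued polynomials in H inside [UZ_set]. *)
Lemma newton_expansion (P : {poly F}) N :
  (size P <= N)%N -> (forall n : nat, exists z : int, P.[n%:R] = z%:~R) ->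
  exists z : nat -> int, P = \sum_(i < N) (z i)%:~R *: binp F 0 i.
Proof.
move=> sP hP; have [v hv] := boolp.choice hP.
have [z hz] := binomial_interpolation v N; exists z.
apply/eqP; rewrite -subr_eq0; apply/eqP.
set Q := P - _; apply: (@roots_geq_poly_eq0 _ _ [seq (n%:R : F) | n <- iota 0 N]).
- apply/allP => y /mapP[n]; rewrite mem_iota => /= nN ->.
  rewrite /root /Q hornerD hornerN horner_sum hv hz //.
  rewrite rmorph_sum /= -sumrB big1 // => i _.
  by rewrite hornerZ [n%:R]pmulrn horner_binp addr0 rmorphM /= natz subrr.
- rewrite map_inj_uniq ?iota_uniq // => m n /eqP.
  by rewrite Num.Theory.eqr_nat => /eqP.
rewrite size_map size_iota; apply: leq_trans (size_polyD _ _) _.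
rewrite geq_max sP size_polyN; apply: (leq_trans (size_sum _ _ _)).
apply/bigmax_leqP => i _; apply: leq_trans (size_scale_leq _ _) _.
exact: leq_trans (size_binp _ _ _) _.
Qed.

End EvalBinp.

Section Lucas.
Variables (k : fieldType) (p : nat).
Hypothesis hp : p \in [pchar k].

Definition kbin (z : int) (m : nat) : k := (binz z m)%:~R.

Lemma kbin_nat (n m : nat) : kbin n m = 'C(n, m)%:R.
Proof. by rewrite /kbin /= -pmulrn. Qed.

Lemma kbin0 z : kbin z 0 = 1.
Proof. by rewrite /kbin binz0. Qed.

Lemma kbin_pascal z m : kbin (z + 1) m.+1 = kbin z m.+1 + kbin z m.
Proof. by rewrite /kbin binz_pascal rmorphD. Qed.

Let p_prime : prime p. Proof. exact: pcharf_prime hp. Qed.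
Let p_gt0 : (0 < p)%N. Proof. exact: prime_gt0. Qed.
Let pZ : (p%:Z != 0). Proof. by rewrite -lt0n. Qed.

(** With floor division Lucas's theorem also covers negative z. The right-hand side obeys Pascal's
    rule, so [pascal_unique] applies; the cases are the possible carries in the last base-p digit of
    z + 1 and of m + 1. *)
Lemma lucas (z : int) (m : nat) :
  kbin z m = kbin (z %/ p)%Z (m %/ p)%N * 'C(`|(z %% p)%Z|%N, m %% p)%:R.
Proof.
have h := @pascal_unique k kbin (fun z m =>
   kbin (z %/ p)%Z (m %/ p)%N * 'C(`|(z %% p)%Z|%N, m %% p)%:R) _ _ _ _; apply: h.
- exact: kbin_pascal.
- move=> {}z {}m.
  have [r rp ez] : exists2 r : nat, (r < p)%N & z = (z %/ p)%Z * p%:Z + r%:Z.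
    exists `|(z %% p)%Z|%N; last by rewrite gez0_abs ?modz_ge0 // -divz_eq.
    have := ltz_pmod z (p_gt0 : 0 < p%:Z :> int); have := modz_ge0 z pZ; lia.
  set q := (z %/ p)%Z in ez; have em := divn_eq m p.
  set n := (m %/ p)%N in em; set i := (m %% p)%N in em.
  have ip : (i < p)%N by rewrite ltn_mod.
  have D (q' : int) r' : (r' < p)%N -> ((q' * p%:Z + r'%:Z)%R %/ p)%Z = q' /\
      `|((q' * p%:Z + r'%:Z)%R %% p)%Z|%N = r'.
    move=> r'p; rewrite divzMDl // modzMDl divz_small ?addr0 ?modz_small //; lia.
  have Dn q' r' : (r' < p)%N -> ((q' * p + r') %/ p)%N = q' /\
      ((q' * p + r') %% p)%N = r'.
    by move=> r'p; rewrite divnMDl // modnMDl divn_small // modn_small // addn0.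
  have [e1 e2] := D q r rp; have [e3 e4] := Dn n i ip.
  have [rp'|rp'] : (r.+1 < p)%N \/ r.+1 = p by lia.
  - have -> : z + 1 = q * p%:Z + r.+1%:Z by lia.
    rewrite (D q r.+1 rp').1 (D q r.+1 rp').2 ez e1 e2.
    have [ip'|ip'] : (i.+1 < p)%N \/ i.+1 = p by lia.
      have -> : m.+1 = (n * p + i.+1)%N by lia.
      rewrite (Dn n i.+1 ip').1 (Dn n i.+1 ip').2 em e3 e4 binS natrD; ring.
    have -> : m.+1 = (n.+1 * p + 0)%N by lia.
    rewrite (Dn n.+1 0%N p_gt0).1 (Dn n.+1 0%N p_gt0).2 em e3 e4 !bin0.
    by rewrite (@bin_small r i) ?mulr0 ?addr0 //; lia.
  have -> : z + 1 = (q + 1) * p%:Z + 0%:Z by lia.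
  rewrite (D (q + 1) 0%N p_gt0).1 (D (q + 1) 0%N p_gt0).2 ez e1 e2.
  have [ip'|ip'] : (i.+1 < p)%N \/ i.+1 = p by lia.
    have -> : m.+1 = (n * p + i.+1)%N by lia.
    rewrite (Dn n i.+1 ip').1 (Dn n i.+1 ip').2 em e3 e4 bin0n mulr0 -mulrDr -natrD.
    (* Here the last digit of z + 1 wraps to 0 while that of m + 1 does not: the two Pascal terms
       add up to ['C(p, i.+1)], which p divides. *)
    rewrite -binS rp'; suff -> : 'C(p, i.+1)%:R = 0 :> k by rewrite mulr0.
    by apply/eqP; rewrite -(dvdn_pcharf hp) prime_dvd_bin.
  have -> : m.+1 = (n.+1 * p + 0)%N by lia.
  rewrite (Dn n.+1 0%N p_gt0).1 (Dn n.+1 0%N p_gt0).2 em e3 e4 !bin0.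
  have -> : r = i by lia.
  by rewrite binn !mulr1 kbin_pascal.
- by move=> {}z; rewrite div0n mod0n !kbin0 bin0 mulr1.
move=> {}m; rewrite div0z mod0z !kbin_nat !bin0n.
rewrite {1}(divn_eq m p); case: (posnP (m %% p)%N) => [->|m0]; last first.
  by rewrite addn_eq0 (gtn_eqF m0) andbF mulr0.
by rewrite addn0 muln_eq0 (gtn_eqF p_gt0) orbF mulr1.
Qed.

Lemma lucas_split (z : int) (n i : nat) : (i < p)%N ->
  kbin z (n * p + i) = kbin (z %/ p)%Z n * 'C(`|(z %% p)%Z|%N, i)%:R.
Proof.
by move=> ip; rewrite lucas divnMDl // modnMDl divn_small // modn_small // addn0.
Qed.

Lemma lucas_mulp (z : int) (n : nat) : kbin z (n * p) = kbin (z %/ p)%Z n.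
Proof. by rewrite -[(n * p)%N]addn0 lucas_split // bin0 mulr1. Qed.

(** By Lucas an m < p^r sees only the last r base-p digits of z. This is what makes binomials in H
    locally constant functions of the weight. *)
Lemma kbin_periodic r (z : int) m : (m < p ^ r)%N ->
  kbin (z + (p ^ r)%:Z) m = kbin z m.
Proof.
elim: r z m => [|r IH] z m.
  by rewrite expn0 ltnS leqn0 => /eqP ->; rewrite !kbin0.
rewrite expnS => mr; rewrite lucas [RHS]lucas.
have -> : z + (p * p ^ r)%N = (p ^ r)%N%:Z * p%:Z + z by rewrite PoszM; ring.
by rewrite modzMDl divzMDl // [_ + (z %/ p)%Z]addrC IH // ltn_divLR // mulnC.
Qed.

End Lucas.

(** * The integral form and its reduction modulo p *)

Section EnvelopingAlgebra.
Local Notation C := (Rdefinitions.R)[i].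
Local Notation hp := (horner_alg envH).

Lemma pgen_bracket (x y z : sl2) : val z = val x *m val y - val y *m val x ->
  (pgen env_rel z : env) = (pgen env_rel x : env) * pgen env_rel y -
    (pgen env_rel y : env) * pgen env_rel x.
Proof.
move=> h; rewrite /GRing.mul /= -![_ - _]/(padd _ (popp _)) !pmulE poppE paddE.
exact/pclass_eq/tc_rel/env_bracket.
Qed.

Lemma pgen_scale (c : C) (x z : sl2) : val z = c *: val x ->
  (pgen env_rel z : env) = c *: (pgen env_rel x : env).
Proof.
move=> h; rewrite -![_ *: _]/(pscale _ _) pscaleE.
exact/pclass_eq/tc_rel/env_scale.
Qed.

Lemma sl2_scale_proof (c : C) (x : sl2) : \tr (c *: val x) == 0.
Proof. by case: x => x /= /eqP hx; rewrite mxtraceZ hx mulr0. Qed.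

Lemma envXY : envX * envY = envY * envX + envH.
Proof.
rewrite /envH (@pgen_bracket (Sl2 slX_proof) (Sl2 slY_proof) (Sl2 slH_proof)).
  by rewrite [RHS]addrC subrK.
by rewrite /= !mul_delta_mx.
Qed.

Lemma envH_comm (x : sl2) (c : C) :
  val (Sl2 slH_proof) *m val x - val x *m val (Sl2 slH_proof) = c *: val x ->
  envH * pgen env_rel x = (pgen env_rel x : env) * (envH + c%:A).
Proof.
move=> h; rewrite mulrDr mulr_algr /envH.
rewrite -(@pgen_scale c x (Sl2 (sl2_scale_proof c x))) //.
rewrite (@pgen_bracket (Sl2 slH_proof) x (Sl2 (sl2_scale_proof c x))) //.
by rewrite [RHS]addrC subrK.
Qed.

Lemma envHX : envH * envX = envX * (envH + (2%:~R)%:A).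
Proof.
apply: envH_comm; apply/matrixP => i j; rewrite !mxE !big_ord_recl !big_ord0 !mxE /=.
by case: i => [[|[|//]]] /= ?; case: j => [[|[|//]]] /= ?; ring.
Qed.

Lemma envHY : envH * envY = envY * (envH + ((- 2)%:~R)%:A).
Proof.
apply: envH_comm; apply/matrixP => i j; rewrite !mxE !big_ord_recl !big_ord0 !mxE /=.
by case: i => [[|[|//]]] /= ?; case: j => [[|[|//]]] /= ?; ring.
Qed.

Lemma env_binHE c m : env_binH c m = hp (binp _ c m).
Proof.
rewrite /env_binH /binp -mul_polyC rmorphM /= horner_algC mulr_algl.
congr (_ *: _); rewrite rmorph_prod /=; apply: eq_bigr => i _.
by rewrite [hp _]rmorphD /= horner_algX rmorph_int.
Qed.

Lemma UZ_subring : subring UZ_set.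
Proof. exact: subring_genP. Qed.

Lemma UZ1 : UZ_set 1. Proof. by case: UZ_subring. Qed.
Lemma UZB x y : UZ_set x -> UZ_set y -> UZ_set (x - y).
Proof. by case: UZ_subring => _ h _; exact: h. Qed.
Lemma UZM x y : UZ_set x -> UZ_set y -> UZ_set (x * y).
Proof. by case: UZ_subring => _ _; exact. Qed.
Lemma UZ0 : UZ_set 0.
Proof. by rewrite -(subrr 1); apply: UZB; exact: UZ1. Qed.
Lemma UZN x : UZ_set x -> UZ_set (- x).
Proof. by move=> hx; rewrite -sub0r; apply: UZB => //; exact: UZ0. Qed.
Lemma UZD x y : UZ_set x -> UZ_set y -> UZ_set (x + y).
Proof. by move=> hx hy; rewrite -[y]opprK; apply: UZB => //; exact: UZN. Qed.
Lemma UZ_sum (I : Type) (r : seq I) (P : pred I) (F : I -> env) :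
  (forall i, P i -> UZ_set (F i)) -> UZ_set (\sum_(i <- r | P i) F i).
Proof. by move=> h; apply: big_ind => //; [exact: UZ0 | exact: UZD]. Qed.
Lemma UZ_muln x n : UZ_set x -> UZ_set (x *+ n).
Proof.
move=> hx; elim: n => [|n IH]; first by rewrite mulr0n; exact: UZ0.
by rewrite mulrS; exact: UZD.
Qed.
Lemma UZ_int x (z : int) : UZ_set x -> UZ_set (z%:~R *: x).
Proof.
by move=> hx; rewrite scaler_int; case: z => n; [|apply: UZN]; exact: UZ_muln.
Qed.

Lemma UZ_divX m : UZ_set (divpow envX m).
Proof. by move=> S _; apply; exists m; left. Qed.
Lemma UZ_divY m : UZ_set (divpow envY m).
Proof. by move=> S _; apply; exists m; right. Qed.

Lemma UZ_divX_sub m k : UZ_set (divpow_sub envX m k).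
Proof. by rewrite /divpow_sub; case: ifP => _; [exact: UZ_divX | exact: UZ0]. Qed.
Lemma UZ_divY_sub m k : UZ_set (divpow_sub envY m k).
Proof. by rewrite /divpow_sub; case: ifP => _; [exact: UZ_divY | exact: UZ0]. Qed.

(** The last term of the expansion of X^(m) Y^(m) is binom(H, m), and all other terms involve
    binomials of smaller degree. For general c the polynomial is integer-valued, hence an integral
    combination of the case c = 0. *)
Lemma UZ_binp c m : UZ_set (hp (binp _ c m)).
Proof.
elim/ltn_ind: m c => m IH.
have h0 : UZ_set (hp (binp _ 0 m)).
  have := divpow_commutation envXY envHX envHY m m.
  rewrite big_ord_recr /= !divpow_subnn mul1r mulr1.
  have -> : 2 * m%:Z - m%:Z - m%:Z = 0 by lia.
  move/eqP; rewrite addrC -subr_eq => /eqP <-; apply: UZB.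
    by apply: UZM; [exact: UZ_divX | exact: UZ_divY].
  apply: UZ_sum => i _; apply: UZM (UZ_divX_sub _ _); apply: UZM (UZ_divY_sub _ _) _.
  exact: IH.
move=> c; have [n|z ->] := newton_expansion (size_binp (C : numFieldType) c m).
  by exists (binz (n%:Z + c) m); rewrite -horner_binp.
rewrite rmorph_sum /=; apply: UZ_sum => i _.
rewrite -mul_polyC rmorphM /= horner_algC mulr_algl; apply: UZ_int.
have := ltn_ord i; rewrite ltnS leq_eqVlt => /predU1P[->//|im]; exact: IH.
Qed.

Lemma UZ_poly (P : {poly C}) :
  (forall n : nat, exists z : int, P.[n%:R] = z%:~R) -> UZ_set (hp P).
Proof.
move=> hP; have [z ->] := newton_expansion (leqnn _) hP.
rewrite rmorph_sum /=; apply: UZ_sum => i _.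
rewrite -mul_polyC rmorphM /= horner_algC mulr_algl; apply: UZ_int.
exact: UZ_binp.
Qed.

End EnvelopingAlgebra.

Section ToHyper.
Variable k : closedFieldType.
Local Notation toH := (@to_hyper k).

Lemma to_hyperE (u : UZ) : toH (val u) = pgen (@hyper_rel k) u.
Proof. by rewrite /to_hyper valKd. Qed.

Lemma UZ_sub x : UZ_set x -> exists u : UZ, x = val u.
Proof. by move=> /asboolP hx; exists (Sub x hx); rewrite SubK. Qed.

Lemma to_hyper1 : toH 1 = 1.
Proof.
have -> : (1 : env) = val (1 : UZ) by rewrite rmorph1.
by rewrite to_hyperE; apply/pclass_eq/tc_rel/hyper_one.
Qed.

Lemma to_hyperD x y : UZ_set x -> UZ_set y -> toH (x + y) = toH x + toH y.
Proof.
move=> /UZ_sub[u ->] /UZ_sub[v ->]; rewrite -rmorphD !to_hyperE.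
rewrite -![_ + _ in RHS]/(padd _ _) paddE.
exact/pclass_eq/tc_rel/hyper_add.
Qed.

Lemma to_hyperM x y : UZ_set x -> UZ_set y -> toH (x * y) = toH x * toH y.
Proof.
move=> /UZ_sub[u ->] /UZ_sub[v ->]; rewrite -rmorphM !to_hyperE.
rewrite /GRing.mul /= pmulE.
exact/pclass_eq/tc_rel/hyper_mul.
Qed.

Lemma to_hyper0 : toH 0 = 0.
Proof. by apply: (addIr (toH 0)); rewrite -to_hyperD ?add0r //; exact: UZ0. Qed.

Lemma to_hyperN x : UZ_set x -> toH (- x) = - toH x.
Proof.
by move=> hx; apply: (addIr (toH x)); rewrite -to_hyperD ?addNr ?to_hyper0 //; exact: UZN.
Qed.

Lemma to_hyper_sum (I : Type) (r : seq I) (P : pred I) (F : I -> env) :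
  (forall i, P i -> UZ_set (F i)) ->
  toH (\sum_(i <- r | P i) F i) = \sum_(i <- r | P i) toH (F i).
Proof.
move=> hF; elim: r => [|i r IH]; first by rewrite !big_nil to_hyper0.
rewrite !big_cons; case: ifP => // Pi; rewrite to_hyperD ?IH //; first exact: hF.
exact: UZ_sum.
Qed.

Lemma to_hyper_int x (z : int) : UZ_set x -> toH (z%:~R *: x) = z%:~R *: toH x.
Proof.
move=> hx.
have pos n : toH (x *+ n) = toH x *+ n.
  elim: n => [|n IH]; first by rewrite !mulr0n to_hyper0.
  by rewrite !mulrS to_hyperD ?IH //; exact: UZ_muln.
rewrite !scaler_int; case: z => n; first by rewrite -!pmulrn pos.
rewrite /intmul /= to_hyperN ?pos //.
exact: UZ_muln.
Qed.

End ToHyper.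

(** * The torus part as locally constant functions on the integers *)

Section TorusPart.
Variable k : closedFieldType.
Local Notation C := (Rdefinitions.R)[i].
Local Notation U := (hyper k).
Local Notation toH := (@to_hyper k).
Local Notation hp := (horner_alg envH).
Local Notation bp := (binp (C : numFieldType)).

Lemma divXE m : divX k m = toH (divpow envX m). Proof. by []. Qed.
Lemma divYE m : divY k m = toH (divpow envY m). Proof. by []. Qed.

Lemma binH_binp c m : binH k c m = toH (hp (bp c m)).
Proof. by rewrite /binH env_binHE. Qed.

Lemma divX0 : divX k 0 = 1.
Proof. by rewrite divXE divpow0 to_hyper1. Qed.
Lemma divY0 : divY k 0 = 1.
Proof. by rewrite divYE divpow0 to_hyper1. Qed.
Lemma divX1 : divX k 1 = hX k.
Proof. by rewrite divXE divpow1. Qed.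
Lemma divY1 : divY k 1 = hY k.
Proof. by rewrite divYE divpow1. Qed.

Lemma to_hyper_nat x n : UZ_set x -> toH (n%:R *: x) = n%:R *: toH x.
Proof. by move=> /(to_hyper_int k n%:Z); rewrite -!pmulrn. Qed.

Lemma divXM m n : divX k m * divX k n = 'C(m + n, m)%:R *: divX k (m + n).
Proof.
rewrite !divXE -to_hyperM; try exact: UZ_divX.
by rewrite divpowM to_hyper_nat //; exact: UZ_divX.
Qed.

Lemma divYM m n : divY k m * divY k n = 'C(m + n, m)%:R *: divY k (m + n).
Proof.
rewrite !divYE -to_hyperM; try exact: UZ_divY.
by rewrite divpowM to_hyper_nat //; exact: UZ_divY.
Qed.

Lemma hX_exp m : hX k ^+ m = m`!%:R *: divX k m.
Proof.
elim: m => [|m IH]; first by rewrite expr0 divX0 scale1r.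
rewrite exprSr IH -divX1 -scalerAl divXM scalerA addn1.
by rewrite -natrM mulnC binSn -factS.
Qed.

Lemma hY_exp m : hY k ^+ m = m`!%:R *: divY k m.
Proof.
elim: m => [|m IH]; first by rewrite expr0 divY0 scale1r.
rewrite exprSr IH -divY1 -scalerAl divYM scalerA addn1.
by rewrite -natrM mulnC binSn -factS.
Qed.

Variable p : nat.
Hypothesis hchar : p \in [pchar k].
Local Notation kb := (kbin k).

(* [h] acts on vectors of integral weight [z] by the scalar [f z]. *)
Definition hval (h : U) (f : int -> k) : Prop :=
  exists (N : nat) (c : nat -> k), h = \sum_(i < N) c i *: binH k 0 i /\
    forall z, f z = \sum_(i < N) c i * kb z i.

Lemma hval_eq h f g : hval h f -> f =1 g -> hval h g.
Proof. by move=> [N [c [-> hf]]] fg; exists N, c; split=> // z; rewrite -fg. Qed.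

Lemma hval_pad h f : hval h f -> exists N0, forall N, (N0 <= N)%N ->
  exists c : nat -> k, h = \sum_(i < N) c i *: binH k 0 i /\
    forall z, f z = \sum_(i < N) c i * kb z i.
Proof.
move=> [N0 [c [-> hf]]]; exists N0 => N hN.
exists (fun i => if (i < N0)%N then c i else 0); split=> [|z].
  rewrite (big_ord_widen N (fun i => c i *: binH k 0 i) hN) big_mkcond.
  by apply: eq_bigr => i _; case: ifP => // _; rewrite scale0r.
rewrite hf (big_ord_widen N (fun i => c i * kb z i) hN) big_mkcond.
by apply: eq_bigr => i _; case: ifP => // _; rewrite mul0r.
Qed.

Lemma hval0 : hval 0 (fun=> 0).
Proof. by exists 0%N, (fun=> 0); split=> [|z]; rewrite big_ord0. Qed.

Lemma hvalD h1 h2 f1 f2 :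
  hval h1 f1 -> hval h2 f2 -> hval (h1 + h2) (fun z => f1 z + f2 z).
Proof.
move=> /hval_pad[N1 H1] /hval_pad[N2 H2].
have [c1 [-> e1]] := H1 _ (leq_maxl N1 N2).
have [c2 [-> e2]] := H2 _ (leq_maxr N1 N2).
exists (maxn N1 N2), (fun i => c1 i + c2 i); split=> [|z].
  by rewrite -big_split; apply: eq_bigr => i _; rewrite scalerDl.
by rewrite e1 e2 -big_split; apply: eq_bigr => i _; rewrite mulrDl.
Qed.

Lemma hvalZ a h f : hval h f -> hval (a *: h) (fun z => a * f z).
Proof.
move=> [N [c [-> e]]]; exists N, (fun i => a * c i); split=> [|z].
  by rewrite scaler_sumr; apply: eq_bigr => i _; rewrite scalerA.
by rewrite e mulr_sumr; apply: eq_bigr => i _; rewrite mulrA.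
Qed.

Lemma hval_sum (I : Type) (r : seq I) (P : pred I) (h : I -> U) (f : I -> int -> k) :
  (forall i, P i -> hval (h i) (f i)) ->
  hval (\sum_(i <- r | P i) h i) (fun z => \sum_(i <- r | P i) f i z).
Proof.
move=> hf; elim: r => [|i r IH].
  by rewrite big_nil; apply: hval_eq hval0 _ => z; rewrite big_nil.
rewrite big_cons; case: (boolP (P i)) => Pi.
  apply: hval_eq (hvalD (hf _ Pi) IH) _ => z; by rewrite big_cons Pi.
by apply: hval_eq IH _ => z; rewrite big_cons (negPf Pi).
Qed.

Lemma hval_poly (P : {poly C}) (F : int -> int) :
  (forall z : int, P.[z%:~R] = (F z)%:~R) ->
  hval (toH (hp P)) (fun z => (F z)%:~R).
Proof.
move=> hP; have [n|c eP] := newton_expansion (leqnn (size P)).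
  by exists (F n%:Z); rewrite -hP.
exists (size P), (fun i => (c i)%:~R); split=> [|z].
  rewrite {1}eP rmorph_sum /= to_hyper_sum => [|i _].
    apply: eq_bigr => i _; rewrite -mul_polyC rmorphM /= horner_algC mulr_algl.
    by rewrite to_hyper_int ?binH_binp //; exact: UZ_binp.
  rewrite -mul_polyC rmorphM /= horner_algC mulr_algl; apply: UZ_int.
  exact: UZ_binp.
have : P.[z%:~R] = (\sum_(i < size P) c i * binz z i)%:~R.
  rewrite {1}eP horner_sum rmorph_sum; apply: eq_bigr => i _.
  by rewrite hornerZ horner_binp addr0 rmorphM.
rewrite hP => /eqP; rewrite eqr_int => /eqP ->.
by rewrite rmorph_sum; apply: eq_bigr => i _; rewrite rmorphM.
Qed.

Lemma hval_binH c m : hval (binH k c m) (fun z => kb (z + c) m).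
Proof. by rewrite binH_binp; apply: hval_poly => z; rewrite horner_binp. Qed.

(** A product of two binomial polynomials is integer-valued, so it expands in binomials with
    integral coefficients, and this expansion can be transported to [k]. *)
Lemma hvalM h1 h2 f1 f2 :
  hval h1 f1 -> hval h2 f2 -> hval (h1 * h2) (fun z => f1 z * f2 z).
Proof.
move=> [N1 [c1 [-> e1]]] [N2 [c2 [-> e2]]].
rewrite mulr_suml.
apply: (@hval_eq _ (fun z => \sum_(i < N1) \sum_(j < N2)
   (c1 i * c2 j) * (kb z i * kb z j))); last first.
  move=> z; rewrite e1 e2 mulr_suml; apply: eq_bigr => i _; rewrite mulr_sumr.
  by apply: eq_bigr => j _; ring.
apply: hval_sum => i _; rewrite mulr_sumr; apply: hval_sum => j _.
rewrite -scalerAl -scalerAr scalerA; apply: hvalZ.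
rewrite !binH_binp -to_hyperM; try exact: UZ_binp.
rewrite -rmorphM; apply: hval_eq.
  apply: (@hval_poly _ (fun z => binz z i * binz z j)) => z.
  by rewrite hornerM !horner_binp !addr0 rmorphM.
by move=> z; rewrite /kbin rmorphM.
Qed.

Lemma hval1 : hval 1 (fun=> 1).
Proof.
have := hval_binH 0 0; rewrite binH_binp binp0 rmorph1 to_hyper1 => h.
by apply: hval_eq h _ => z; rewrite kbin0.
Qed.

Lemma kbin_indep N (c : nat -> k) :
  (forall n : nat, \sum_(i < N) c i * kb n i = 0) -> forall i, (i < N)%N -> c i = 0.
Proof.
move=> f0; elim/ltn_ind => i IH iN.
have := f0 i; rewrite (bigD1 (Ordinal iN)) //= kbin_nat binn mulr1.
rewrite big1 ?addr0 // => j ji; have [ij|ij|ij] := ltngtP j i.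
- by rewrite IH ?mul0r.
- by rewrite kbin_nat bin_small ?mulr0.
by case/eqP: ji; apply: val_inj.
Qed.

(** Natural weights suffice: evaluating binomials of degree below N at 0, ..., N - 1 gives a
    unitriangular matrix. *)
Lemma hval_eq0 h f : hval h f -> (forall n : nat, f n = 0) -> h = 0.
Proof.
move=> [N [c [-> e]]] f0; apply: big1 => i _.
by rewrite (@kbin_indep N c) ?scale0r // => n; rewrite -e.
Qed.

Lemma hval_inj h1 h2 f1 f2 : hval h1 f1 -> hval h2 f2 ->
  (forall n : nat, f1 n = f2 n) -> h1 = h2.
Proof.
move=> H1 H2 e; apply/eqP; rewrite -subr_eq0 -scaleN1r; apply/eqP.
apply: hval_eq0 (hvalD H1 (hvalZ (-1) H2)) _ => n.
by rewrite e mulN1r subrr.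
Qed.

Lemma hval_divX h f n : hval h f ->
  forall h', hval h' (fun z => f (z + 2 * n%:Z)) -> h * divX k n = divX k n * h'.
Proof.
move=> [N [a [-> e]]] h' Hh'.
have -> : h' = \sum_(i < N) a i *: binH k (2 * n%:Z) i.
  apply: hval_inj Hh' _ _.
    by apply: hval_sum => i _; apply: hvalZ; exact: hval_binH.
  by move=> z; rewrite e.
rewrite mulr_suml mulr_sumr; apply: eq_bigr => i _.
rewrite -scalerAl -scalerAr; congr (_ *: _).
rewrite !binH_binp divXE -!to_hyperM; try exact: UZ_binp; try exact: UZ_divX.
by rewrite (horner_shift_divpow _ _ envHX) binp_comp add0r.
Qed.

Lemma hval_divY h f n : hval h f ->
  forall h', hval h' (fun z => f (z - 2 * n%:Z)) -> h * divY k n = divY k n * h'.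
Proof.
move=> [N [a [-> e]]] h' Hh'.
have -> : h' = \sum_(i < N) a i *: binH k (- (2 * n%:Z)) i.
  apply: hval_inj Hh' _ _.
    by apply: hval_sum => i _; apply: hvalZ; exact: hval_binH.
  by move=> z; rewrite e.
rewrite mulr_suml mulr_sumr; apply: eq_bigr => i _.
rewrite -scalerAl -scalerAr; congr (_ *: _).
rewrite !binH_binp divYE -!to_hyperM; try exact: UZ_binp; try exact: UZ_divY.
by rewrite (horner_shift_divpow _ _ envHY) binp_comp add0r mulNr.
Qed.

(* Locally constant functions for the p-adic topology. *)
Definition periodic (r : nat) (f : int -> k) : Prop :=
  forall z, f (z + (p ^ r)%:Z) = f z.
Definition loc_const (f : int -> k) : Prop := exists r, periodic r f.

Lemma periodic_muln r f z (q : nat) : periodic r f -> f (z + (p ^ r * q)%:Z) = f z.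
Proof.
move=> hf; elim: q => [|q IH]; first by rewrite muln0 addr0.
by rewrite mulnS addnC PoszD addrA hf.
Qed.

Lemma periodic_mul r f z (q : int) : periodic r f -> f (z + (p ^ r)%:Z * q) = f z.
Proof.
move=> hf; case: q => q; first by rewrite -PoszM periodic_muln.
rewrite -[in RHS](subrK ((p ^ r)%:Z * q.+1%:Z) z) NegzE mulrN -PoszM.
by rewrite periodic_muln.
Qed.

Lemma periodic_leq r s f : (r <= s)%N -> periodic r f -> periodic s f.
Proof.
by move=> rs hf z; rewrite -(subnKC rs) expnD; apply: periodic_muln.
Qed.

(** Interpolation on 0, ..., p^r - 1 determines the coefficients; elsewhere both sides agree because
    the binomials of degree below p^r have period p^r. *)
Lemma periodic_expansion r f : periodic r f ->
  exists c : nat -> k, forall z, f z = \sum_(i < p ^ r) c i * kb z i.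
Proof.
move=> hf; have [c hc] := binomial_interpolation (fun n => f n%:Z) (p ^ r).
exists c => z; have P0 : (0 < (p ^ r)%:Z :> int).
  by rewrite ltz_nat expn_gt0 prime_gt0 // (pcharf_prime hchar).
have := divz_eq z (p ^ r)%N; have := ltz_pmod z P0.
have := @modz_ge0 z (p ^ r)%N; rewrite (Num.Theory.lt0r_neq0 P0) => /(_ isT).
case: (z %% (p ^ r)%N)%Z => // n _ nlt ->; rewrite addrC mulrC periodic_mul // hc //.
apply: eq_bigr => i _; rewrite -kbin_nat; congr (_ * _).
by rewrite (@periodic_mul r (kb^~ i)) // => z'; apply: kbin_periodic.
Qed.

Lemma periodic_hval r f : periodic r f ->
  exists c : nat -> k, hval (\sum_(i < p ^ r) c i *: binH k 0 i) f.
Proof.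
by move=> /periodic_expansion[c hc]; exists c, (p ^ r)%N, c; split.
Qed.

Lemma hval_loc_const h f : hval h f -> loc_const f.
Proof.
move=> [N [c [_ hf]]]; exists N => z; rewrite !hf; apply: eq_bigr => i _.
rewrite kbin_periodic //; apply: leq_trans (ltn_ord i) _.
by apply/ltnW/ltn_expl/prime_gt1; exact: pcharf_prime hchar.
Qed.

(** The inverse of [hval]. The choice is determined by [hval_inj] and succeeds exactly for locally
    constant [f]; otherwise the default 0 results. *)
Definition Hfun (f : int -> k) : U := xget 0 [set h | hval h f]%classic.

Lemma HfunP f : loc_const f -> hval (Hfun f) f.
Proof.
move=> [r /periodic_hval[c hc]].
by rewrite /Hfun; case: xgetP => [h _|/(_ _ hc)].
Qed.

Lemma Hfun_eq h f : hval h f -> h = Hfun f.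
Proof. by move=> hf; apply: hval_inj hf (HfunP (hval_loc_const hf)) _. Qed.

End TorusPart.

Lemma horner_alg_comp (R : comNzRingType) (A : algType R) (a : A) (P q : {poly R}) :
  horner_alg a (P \Po q) = horner_alg (horner_alg a q) P.
Proof.
elim/poly_ind: P => [|P c IH]; first by rewrite comp_poly0 !rmorph0.
by rewrite comp_poly_MXaddC !rmorphD !rmorphM /= IH !horner_algC horner_algX.
Qed.

Section HfunCalculus.
Variables (k : closedFieldType) (p : nat).
Hypothesis hchar : p \in [pchar k].
Local Notation C := (Rdefinitions.R)[i].
Local Notation kb := (kbin k).
Local Notation loc_const := (@loc_const k p).
Local Notation Hfun := (@Hfun k).
Let HfunP f := @HfunP k p hchar f.
Let Hfun_eq h f := @Hfun_eq k p hchar h f.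

Lemma p_gt0 : (0 < p)%N.
Proof. exact: prime_gt0 (pcharf_prime hchar). Qed.

Lemma pz_neq0 : (p%:Z != 0).
Proof. by rewrite -lt0n; exact: p_gt0. Qed.

Lemma loc_const_cst a : loc_const (fun=> a).
Proof. by exists 0%N. Qed.

Lemma loc_const_op2 (op : k -> k -> k) f g :
  loc_const f -> loc_const g -> loc_const (fun z => op (f z) (g z)).
Proof.
move=> [r hr] [s hs]; exists (maxn r s) => z.
by rewrite (periodic_leq (leq_maxl r s) hr) (periodic_leq (leq_maxr r s) hs).
Qed.

Lemma loc_constM f g : loc_const f -> loc_const g -> loc_const (fun z => f z * g z).
Proof. exact: loc_const_op2. Qed.

Lemma loc_constD f g : loc_const f -> loc_const g -> loc_const (fun z => f z + g z).
Proof. exact: loc_const_op2. Qed.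

Lemma loc_const_shift f c : loc_const f -> loc_const (fun z => f (z + c)).
Proof. by move=> [r hr]; exists r => z; rewrite addrAC hr. Qed.

Lemma loc_const_opp f : loc_const f -> loc_const (fun z => f (- z)).
Proof. by move=> [r hr]; exists r => z; rewrite -[LHS]hr opprD subrK. Qed.

Lemma loc_const_kbin c m : loc_const (fun z => kb (z + c) m).
Proof. exact: hval_loc_const hchar _ _ (hval_binH k c m). Qed.

Lemma loc_const_divp f d : loc_const f -> loc_const (fun z => f ((z %/ p)%Z + d)).
Proof.
move=> [r hr]; exists r.+1 => z.
have -> : z + (p ^ r.+1)%N = (p ^ r)%N%:Z * p%:Z + z by rewrite expnSr PoszM addrC.
rewrite divzMDl ?pz_neq0 //.
have -> : (p ^ r)%N%:Z + (z %/ p)%Z + d = (z %/ p)%Z + d + (p ^ r)%N by ring.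
by rewrite hr.
Qed.

Lemma eq_Hfun f g : f =1 g -> Hfun f = Hfun g.
Proof. by move=> /funext ->. Qed.

Lemma HfunM f g : loc_const f -> loc_const g ->
  Hfun f * Hfun g = Hfun (fun z => f z * g z).
Proof. by move=> hf hg; apply: Hfun_eq; apply: hvalM; exact: HfunP. Qed.

Lemma HfunD f g : loc_const f -> loc_const g ->
  Hfun f + Hfun g = Hfun (fun z => f z + g z).
Proof. by move=> hf hg; apply: Hfun_eq; apply: hvalD; exact: HfunP. Qed.

Lemma HfunZ a f : loc_const f -> a *: Hfun f = Hfun (fun z => a * f z).
Proof. by move=> hf; apply: Hfun_eq; apply: hvalZ; exact: HfunP. Qed.

Lemma Hfun_cst a : Hfun (fun=> a) = a%:A.
Proof.
have h1 : Hfun (fun=> 1) = 1 by rewrite -(Hfun_eq (hval1 k)).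
by rewrite -h1 HfunZ; [apply: eq_Hfun => z; rewrite mulr1 | exact: loc_const_cst].
Qed.

Lemma Hfun_binH c m : binH k c m = Hfun (fun z => kb (z + c) m).
Proof. by apply: Hfun_eq; exact: hval_binH. Qed.

Lemma Hfun_comm f g : loc_const f -> loc_const g -> Hfun f * Hfun g = Hfun g * Hfun f.
Proof. by move=> hf hg; rewrite !HfunM //; apply: eq_Hfun => z; rewrite mulrC. Qed.

Lemma Hfun_divX f n : loc_const f ->
  Hfun f * divX k n = divX k n * Hfun (fun z => f (z + 2 * n%:Z)).
Proof. by move=> hf; apply: hval_divX (HfunP hf) _ _; exact/HfunP/loc_const_shift. Qed.

Lemma Hfun_divY f n : loc_const f ->
  Hfun f * divY k n = divY k n * Hfun (fun z => f (z - 2 * n%:Z)).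
Proof. by move=> hf; apply: hval_divY (HfunP hf) _ _; exact/HfunP/loc_const_shift. Qed.

Lemma divX_Hfun f n : loc_const f ->
  divX k n * Hfun f = Hfun (fun z => f (z - 2 * n%:Z)) * divX k n.
Proof.
move=> hf; rewrite Hfun_divX; last exact: loc_const_shift.
by congr (_ * _); apply: eq_Hfun => z; rewrite addrK.
Qed.

Lemma divY_Hfun f n : loc_const f ->
  divY k n * Hfun f = Hfun (fun z => f (z + 2 * n%:Z)) * divY k n.
Proof.
move=> hf; rewrite Hfun_divY; last exact: loc_const_shift.
by congr (_ * _); apply: eq_Hfun => z; rewrite subrK.
Qed.

Lemma divX_divY m n : divX k m * divY k n =
  \sum_(i < m.+1 | (i <= n)%N)
    divY k (n - i) * Hfun (fun z => kb (z + (2 * i%:Z - m%:Z - n%:Z)) i) * divX k (m - i).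
Proof.
rewrite divXE divYE -to_hyperM; [|exact: UZ_divX|exact: UZ_divY].
rewrite (divpow_commutation envXY envHX envHY) to_hyper_sum => [|i _]; last first.
  apply: UZM (UZ_divX_sub _ _); apply: UZM (UZ_divY_sub _ _) _; exact: UZ_binp.
rewrite [RHS]big_mkcond; apply: eq_bigr => i _; rewrite /divpow_sub (leq_ord i).
case: ifP => _; last by rewrite !mul0r to_hyper0.
rewrite !to_hyperM; try exact: UZ_divX; try exact: UZ_divY; try exact: UZ_binp.
  by rewrite -binH_binp Hfun_binH.
by apply: UZM; [exact: UZ_divY | exact: UZ_binp].
Qed.

(** Kostant's formula for the triple (Y, X, -H), which satisfies the same relations; this is why -z
    appears in the binomials. *)
Lemma divY_divX m n : divY k m * divX k n =
  \sum_(i < m.+1 | (i <= n)%N)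
    divX k (n - i) * Hfun (fun z => kb (- z + (2 * i%:Z - m%:Z - n%:Z)) i) * divY k (m - i).
Proof.
have XY' : envY * envX = envX * envY + - envH by rewrite envXY addrK.
have HX' : - envH * envY = envY * (- envH + (2%:~R)%:A).
  by rewrite mulNr envHY -mulrN opprD -scaleNr -rmorphN opprK.
have HY' : - envH * envX = envX * (- envH + ((- 2)%:~R)%:A).
  by rewrite mulNr envHX -mulrN opprD -scaleNr -rmorphN.
have bpN c i : horner_alg (- envH) (binp (C : numFieldType) c i) =
    horner_alg envH (binp (C : numFieldType) c i \Po (- 'X)).
  by rewrite horner_alg_comp rmorphN /= horner_algX.
have bpNe c i (z : int) : (binp (C : numFieldType) c i \Po (- 'X)).[z%:~R] =
    (binz (- z + c) i)%:~R.
  by rewrite horner_comp hornerN hornerX -rmorphN horner_binp.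
have bpU c i : UZ_set (horner_alg envH (binp (C : numFieldType) c i \Po (- 'X))).
  by apply: UZ_poly => j; exists (binz (- j%:Z + c) i); rewrite -bpNe.
rewrite divXE divYE -to_hyperM; [|exact: UZ_divY|exact: UZ_divX].
rewrite (divpow_commutation XY' HX' HY') to_hyper_sum => [|i _]; last first.
  apply: UZM (UZ_divY_sub _ _); apply: UZM (UZ_divX_sub _ _) _.
  by rewrite bpN; exact: bpU.
rewrite [RHS]big_mkcond; apply: eq_bigr => i _; rewrite /divpow_sub (leq_ord i) bpN.
case: ifP => _; last by rewrite !mul0r to_hyper0.
rewrite !to_hyperM; try exact: UZ_divX; try exact: UZ_divY; try exact: bpU.
  congr (_ * _ * _); apply: Hfun_eq.
  by apply: (@hval_poly k _ (fun z => binz (- z + (2 * i%:Z - m%:Z - n%:Z)) i)).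
by apply: UZM; [exact: UZ_divX | exact: bpU].
Qed.

End HfunCalculus.

(** * Linear independence of the triangular products *)

Section MatrixEvaluation.
Variables (R : comNzRingType) (G : Type) (rel : alg_term R G -> alg_term R G -> Prop).
Variables (d : nat) (f : G -> 'M[R]_d).

Fixpoint mxeval (t : alg_term R G) : 'M[R]_d :=
  match t with
  | tgen g => f g
  | tzero => 0
  | topp x => - mxeval x
  | tadd x y => mxeval x + mxeval y
  | tone => 1%:M
  | tmul x y => mxeval x *m mxeval y
  | tscale c x => c *: mxeval x
  end.

Hypothesis f_rel : forall x y, rel x y -> mxeval x = mxeval y.

Lemma mxeval_cong x y : tcong rel x y -> mxeval x = mxeval y.
Proof.
elim=> //=.
- by move=> ? ? ? _ -> _ ->.
- by move=> ? ? _ ->.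
- by move=> ? ? ? ? _ -> _ ->.
- by move=> ? ? ? ? _ -> _ ->.
- by move=> ? ? ? _ ->.
- by move=> *; rewrite addrA.
- by move=> *; rewrite addrC.
- by move=> *; rewrite add0r.
- by move=> *; rewrite addNr.
- by move=> *; rewrite mulmxA.
- by move=> *; rewrite mul1mx.
- by move=> *; rewrite mulmx1.
- by move=> *; rewrite mulmxDl.
- by move=> *; rewrite mulmxDr.
- by move=> *; rewrite scalerA.
- by move=> *; rewrite scale1r.
- by move=> *; rewrite scalerDr.
- by move=> *; rewrite scalerDl.
- by move=> *; rewrite scalemxAl.
- by move=> *; rewrite scalemxAr.
Qed.

Definition mxrep (x : presented rel) : 'M[R]_d := mxeval (repr x).

Lemma mxrepE t : mxrep (pclass rel t) = mxeval t.
Proof. exact/mxeval_cong/repr_pclass. Qed.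
Lemma mxrep1 : mxrep 1 = 1%:M. Proof. exact: mxrepE. Qed.
Lemma mxrep0 : mxrep 0 = 0. Proof. exact: mxrepE. Qed.
Lemma mxrepD x y : mxrep (x + y) = mxrep x + mxrep y.
Proof.
elim/pclass_ind: x => x; elim/pclass_ind: y => y.
by rewrite -![_ + _]/(padd _ _) paddE !mxrepE.
Qed.
Lemma mxrepM x y : mxrep (x * y) = mxrep x *m mxrep y.
Proof.
elim/pclass_ind: x => x; elim/pclass_ind: y => y.
by rewrite -[pclass _ x * _]/(pmul _ _) pmulE !mxrepE.
Qed.
Lemma mxrepZ c x : mxrep (c *: x) = c *: mxrep x.
Proof.
elim/pclass_ind: x => x.
by rewrite -[c *: _]/(pscale _ _) pscaleE !mxrepE.
Qed.
Lemma mxrepN x : mxrep (- x) = - mxrep x.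
Proof. by rewrite -scaleN1r mxrepZ scaleN1r. Qed.

End MatrixEvaluation.

(** The comultiplication of divided powers: in each product the factor s + 1 is split as (s + 1 - i)
    + i, one part being absorbed by [P] and the other by [Q]. *)
Lemma divided_power_sum (R : pzRingType) (P Q : nat -> R) :
  P 0 = 1 -> Q 0 = 1 -> (forall i j, P i * Q j = Q j * P i) ->
  (forall s, P 1 * P s = P s.+1 *+ s.+1) -> (forall s, Q 1 * Q s = Q s.+1 *+ s.+1) ->
  forall s, (P 1 + Q 1) * (\sum_(i < s.+1) P (s - i)%N * Q i) =
    (\sum_(i < s.+2) P (s.+1 - i)%N * Q i) *+ s.+1.
Proof.
move=> P0 Q0 PQ PS QS s.
transitivity (\sum_(i < s.+2) (P (s.+1 - i)%N * Q i) *+ (s.+1 - i) +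
   \sum_(i < s.+2) (P (s.+1 - i)%N * Q i) *+ i); last first.
  rewrite -big_split -sumrMnl; apply: eq_bigr => i _ /=; rewrite -mulrnDr.
  by rewrite subnK // -ltnS.
rewrite mulrDl !mulr_sumr; congr (_ + _).
  rewrite [RHS]big_ord_recr /= subnn mulr0n addr0; apply: eq_bigr => i _.
  by rewrite mulrA PS mulrnAl -subSn // -ltnS.
rewrite [RHS]big_ord_recl mulr0n add0r; apply: eq_bigr => i _.
by rewrite lift0 subSS mulrA -PQ -mulrA QS mulrnAr.
Qed.

Section WeylMatrices.
Variable n : nat.
Implicit Types (i l : 'I_n.+1).

(** Binary forms of degree n in the monomials u^(n-l) v^l, with X = u d/dv and Y = v d/du: these are
    the matrices of X^(s) and, below, of Y^(s) and H. *)
Definition mx_up (s : nat) : 'M[int]_n.+1 :=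
  \matrix_(i, l) (if (i + s == l)%N then 'C(l, s)%:Z else 0).
Definition mx_dn (s : nat) : 'M[int]_n.+1 :=
  \matrix_(i, l) (if (l + s == i)%N then 'C(n - l, s)%:Z else 0).
Definition mx_wt : 'M[int]_n.+1 :=
  \matrix_(i, l) (if i == l then n%:Z - 2 * i%:Z else 0).

Lemma mx_up0 : mx_up 0 = 1.
Proof.
apply/matrixP => i l; rewrite !mxE addn0 bin0.
by rewrite -(inj_eq val_inj) /=; case: eqP.
Qed.

Lemma mx_dn0 : mx_dn 0 = 1.
Proof.
apply/matrixP => i l; rewrite !mxE addn0 bin0 eq_sym.
by rewrite -(inj_eq val_inj) /=; case: eqP.
Qed.

Lemma sum_ord_single (m : nat) (G : 'I_m -> int) (j : nat) (v : int) :
  (forall i : 'I_m, (i : nat) = j -> G i = v) ->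
  (forall i : 'I_m, (i : nat) != j -> G i = 0) ->
  \sum_(i < m) G i = if (j < m)%N then v else 0.
Proof.
move=> Gj G0; case: ltnP => jm; last first.
  by apply: big1 => i _; apply: G0; have := ltn_ord i; lia.
by rewrite (bigD1 (Ordinal jm)) //= Gj // big1 ?addr0.
Qed.

Lemma mx_upS s : mx_up 1 * mx_up s = mx_up s.+1 *+ s.+1.
Proof.
apply/matrixP => i l; rewrite mulmxnE !mxE.
rewrite (@sum_ord_single _ _ i.+1
   (i.+1%:Z * (if (i.+1 + s == l)%N then 'C(l, s)%:Z else 0))); last first.
- by move=> j /negPf; rewrite !mxE addn1 eq_sym => ->; rewrite mul0r.
- by move=> j e; rewrite !mxE addn1 e eqxx bin1.
rewrite addSnnS; case: eqP => [e|_]; last by rewrite mulr0 mul0rn if_same.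
rewrite ifT; last by have := ltn_ord l; lia.
have := mul_bin_left l s; rewrite -e => h; rewrite -mulr_natr.
by rewrite natz -!PoszM; congr Posz; rewrite [RHS]mulnC h; congr (_ * _)%N; lia.
Qed.

Lemma mx_dnS s : mx_dn 1 * mx_dn s = mx_dn s.+1 *+ s.+1.
Proof.
apply/matrixP => i l; rewrite mulmxnE !mxE.
rewrite (@sum_ord_single _ _ (l + s)%N
   ((if ((l + s).+1 == i)%N then (n - (l + s))%N%:Z else 0) * 'C(n - l, s)%:Z)); last first.
- by move=> j /negPf; rewrite !mxE [(l + s == j)%N]eq_sym => ->; rewrite mulr0.
- by move=> j e; rewrite !mxE addn1 e eqxx bin1.
rewrite -addnS; case: (eqVneq (l + s.+1)%N i) => [e|_]; last by rewrite mul0r mul0rn if_same.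
rewrite ifT; last by have := ltn_ord i; lia.
have := mul_bin_left (n - l) s => h; rewrite -mulr_natr.
by rewrite natz -!PoszM; congr Posz; rewrite [RHS]mulnC h; congr (_ * _)%N; lia.
Qed.

Lemma mx_up_dn : mx_up 1 * mx_dn 1 - mx_dn 1 * mx_up 1 = mx_wt.
Proof.
apply/matrixP => i l; rewrite !mxE.
rewrite (@sum_ord_single _ _ i.+1
   (i.+1%:Z * (if (l.+1 == i.+1)%N then (n - l)%N%:Z else 0))); last first.
- by move=> j /negPf; rewrite !mxE !addn1 eq_sym => ->; rewrite mul0r.
- by move=> j e; rewrite !mxE !addn1 e eqxx bin1 bin1.
have -> : \sum_j mx_dn 1 i j * mx_up 1 j l =
    if i == l then i%:Z * (n.+1 - i)%:Z else 0.
  have [i0|i0] := posnP i.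
    rewrite big1 ?i0 ?mul0r ?if_same // => j _.
    by rewrite !mxE i0 addn1 mul0r.
  rewrite (@sum_ord_single _ _ i.-1
     ((n - i.-1)%N%:Z * (if (i.-1.+1 == l)%N then l%:Z else 0))); last first.
  - move=> j; rewrite -eqSS prednK // => /negPf; rewrite !mxE addn1 => ->.
    by rewrite mul0r.
  - by move=> j e; rewrite !mxE !addn1 e prednK // eqxx !bin1.
  rewrite ifT ?(prednK i0); last by have := ltn_ord i; lia.
  rewrite -(inj_eq val_inj) /=; case: eqP => [e|_]; last by rewrite mulr0.
  by rewrite e mulrC (_ : n - l.-1 = n.+1 - l)%N //; lia.
rewrite eqSS [(l : nat) == i]eq_sym (inj_eq val_inj).
case: eqP => [->|_]; last by rewrite mulr0 subr0 if_same.
have ln := ltn_ord l.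
have -> : (n.+1 - l)%N%:Z = n%:Z - l%:Z + 1 by lia.
case: (ltnP l.+1 n.+1) => h; first by rewrite (_ : (n - l)%N%:Z = n%:Z - l%:Z); [ring|lia].
have -> : l%:Z = n%:Z by lia.
ring.
Qed.

Lemma mx_wt_up : mx_wt * mx_up 1 - mx_up 1 * mx_wt = mx_up 1 *+ 2.
Proof.
apply/matrixP => i l; rewrite mulmxnE !mxE.
rewrite (@sum_ord_single _ _ i ((n%:Z - 2 * i%:Z) * mx_up 1 i l)); last first.
- by move=> j; rewrite (inj_eq val_inj) eq_sym !mxE => /negPf ->; rewrite mul0r.
- by move=> j /val_inj ->; rewrite !mxE eqxx.
rewrite (@sum_ord_single _ _ l (mx_up 1 i l * (n%:Z - 2 * l%:Z))); last first.
- by move=> j; rewrite (inj_eq val_inj) !mxE => /negPf ->; rewrite mulr0.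
- by move=> j /val_inj ->; rewrite !mxE eqxx.
rewrite !ltn_ord !mxE addn1 bin1; case: eqP => [<-|_]; last by rewrite mulr0 mul0r.
by rewrite -mulr_natr; lia.
Qed.

Lemma mx_wt_dn : mx_wt * mx_dn 1 - mx_dn 1 * mx_wt = - (mx_dn 1 *+ 2).
Proof.
apply/matrixP => i l; rewrite [RHS]mxE mulmxnE !mxE.
rewrite (@sum_ord_single _ _ i ((n%:Z - 2 * i%:Z) * mx_dn 1 i l)); last first.
- by move=> j; rewrite (inj_eq val_inj) eq_sym !mxE => /negPf ->; rewrite mul0r.
- by move=> j /val_inj ->; rewrite !mxE eqxx.
rewrite (@sum_ord_single _ _ l (mx_dn 1 i l * (n%:Z - 2 * l%:Z))); last first.
- by move=> j; rewrite (inj_eq val_inj) !mxE => /negPf ->; rewrite mulr0.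
- by move=> j /val_inj ->; rewrite !mxE eqxx.
rewrite !ltn_ord !mxE addn1 bin1; case: eqP => [<-|_]; last by rewrite mulr0 mul0r.
by rewrite -mulr_natr; lia.
Qed.

End WeylMatrices.

(* The action on Hom(V_b, V_a), for Weyl modules V_a and V_b. Row vectors reverse
   the order of composition, so X is represented by the action of Y and Y by
   that of X. *)
Section HomRepresentation.
Variables a b : nat.
Local Notation N := (a.+1 * b.+1)%N.
Local Notation W := 'M[int]_(a.+1, b.+1).
Local Notation lm := (@lin_mulmx int a.+1 a.+1 b.+1).
Local Notation rm := (@lin_mulmxr int a.+1 b.+1 b.+1).

Lemma mul_vec_lm A (V : W) : mxvec V *m lm A = mxvec (A *m V).
Proof. by rewrite mul_vec_lin. Qed.
Lemma mul_vec_rm B (V : W) : mxvec V *m rm B = mxvec (V *m B).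
Proof. by rewrite mul_vec_lin. Qed.

Lemma mxvec_ext (M M' : 'M[int]_N) :
  (forall V : W, mxvec V *m M = mxvec V *m M') -> M = M'.
Proof.
move=> h; apply/row_matrixP => i; rewrite !rowE.
by rewrite -[delta_mx 0 i](@vec_mxK _ a.+1 b.+1); exact: h.
Qed.

Lemma lmM A B : lm A * lm B = lm (B * A).
Proof. by apply: mxvec_ext => V; rewrite mulmxA !mul_vec_lm mulmxA. Qed.
Lemma rmM A B : rm A * rm B = rm (A * B).
Proof. by apply: mxvec_ext => V; rewrite mulmxA !mul_vec_rm mulmxA. Qed.
Lemma lm_rm A B : lm A * rm B = rm B * lm A.
Proof.
by apply: mxvec_ext => V; rewrite !mulmxA !(mul_vec_lm, mul_vec_rm) mulmxA.
Qed.
Lemma lm1 : lm 1 = 1.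
Proof. by apply: mxvec_ext => V; rewrite mul_vec_lm mul1mx mulmx1. Qed.
Lemma rm1 : rm 1 = 1.
Proof. by apply: mxvec_ext => V; rewrite mul_vec_rm !mulmx1. Qed.

Lemma mulr_tr n (A B : 'M[int]_n.+1) : A^T * B^T = (B * A)^T.
Proof. by rewrite [RHS]trmx_mul. Qed.

(** Divided powers act on Hom through the comultiplication, the sign being that of the antipode on
    the source. With the transpose on the target side, the operator of order s sends the basis
    vector 0 to the basis vector s with coefficient 1, which survives reduction modulo p. *)
Definition hom_X (s : nat) : 'M[int]_N :=
  \sum_(i < s.+1) lm (mx_up a (s - i))^T * ((-1) ^+ i *: rm (mx_dn b i)).
Definition hom_Y (s : nat) : 'M[int]_N :=
  \sum_(i < s.+1) lm (mx_dn a (s - i))^T * ((-1) ^+ i *: rm (mx_up b i)).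
Definition hom_H : 'M[int]_N := lm (mx_wt a) - rm (mx_wt b).

Lemma hom_X1 : hom_X 1 = lm (mx_up a 1)^T - rm (mx_dn b 1).
Proof.
rewrite /hom_X !big_ord_recl big_ord0 /= addr0 mx_up0 mx_dn0 trmx1 lm1 rm1.
by rewrite expr0 scale1r mulr1 expr1 scaleN1r mul1r.
Qed.

Lemma hom_Y1 : hom_Y 1 = lm (mx_dn a 1)^T - rm (mx_up b 1).
Proof.
rewrite /hom_Y !big_ord_recl big_ord0 /= addr0 mx_up0 mx_dn0 trmx1 lm1 rm1.
by rewrite expr0 scale1r mulr1 expr1 scaleN1r mul1r.
Qed.

Lemma hom_X0 : hom_X 0 = 1.
Proof.
by rewrite /hom_X big_ord1 mx_up0 mx_dn0 trmx1 lm1 rm1 expr0 scale1r mulr1.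
Qed.

Lemma hom_Y0 : hom_Y 0 = 1.
Proof.
by rewrite /hom_Y big_ord1 mx_up0 mx_dn0 trmx1 lm1 rm1 expr0 scale1r mulr1.
Qed.

Lemma hom_XS s : hom_X 1 * hom_X s = hom_X s.+1 *+ s.+1.
Proof.
have := @divided_power_sum _ (fun s => lm (mx_up a s)^T)
  (fun s => (-1) ^+ s *: rm (mx_dn b s)) _ _ _ _ _ s.
rewrite hom_X1 /= expr1 scaleN1r; apply.
- by rewrite mx_up0 trmx1 lm1.
- by rewrite mx_dn0 rm1 expr0 scale1r.
- by move=> i j; rewrite -scalerAr -scalerAl lm_rm.
- by move=> i; rewrite lmM mulr_tr mx_upS !linearMn.
- move=> i; rewrite -scalerAr mulNr rmM mx_dnS linearMn /= scalerN.
  by rewrite exprS mulN1r scaleNr mulNrn scalerMnr.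
Qed.

Lemma hom_YS s : hom_Y 1 * hom_Y s = hom_Y s.+1 *+ s.+1.
Proof.
have := @divided_power_sum _ (fun s => lm (mx_dn a s)^T)
  (fun s => (-1) ^+ s *: rm (mx_up b s)) _ _ _ _ _ s.
rewrite hom_Y1 /= expr1 scaleN1r; apply.
- by rewrite mx_dn0 trmx1 lm1.
- by rewrite mx_up0 rm1 expr0 scale1r.
- by move=> i j; rewrite -scalerAr -scalerAl lm_rm.
- by move=> i; rewrite lmM mulr_tr mx_dnS !linearMn.
- move=> i; rewrite -scalerAr mulNr rmM mx_upS linearMn /= scalerN.
  by rewrite exprS mulN1r scaleNr mulNrn scalerMnr.
Qed.

Lemma hom_bracket (A A' : 'M[int]_a.+1) (B B' : 'M[int]_b.+1) :
  (lm A - rm B) * (lm A' - rm B') - (lm A' - rm B') * (lm A - rm B) =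
  lm (A' * A - A * A') - rm (B' * B - B * B').
Proof.
rewrite !mulrBl !mulrBr !lmM !rmM (lm_rm A B') (lm_rm A' B) !linearB /=.
move: (lm (A' * A)) (lm (A * A')) (rm (B' * B)) (rm (B * B')).
move: (rm B * lm A') (rm B' * lm A) => c1 c2 l1 l2 r1 r2.
by apply/matrixP => i j; rewrite !mxE; ring.
Qed.

Lemma trmx_wt n : (mx_wt n)^T = mx_wt n.
Proof. by apply/matrixP => i j; rewrite !mxE eq_sym; case: eqP => // ->. Qed.

Lemma hom_XY : hom_X 1 * hom_Y 1 - hom_Y 1 * hom_X 1 = hom_H.
Proof.
rewrite hom_X1 hom_Y1 hom_bracket !mulr_tr -linearB /= !mx_up_dn trmx_wt.
by [].
Qed.

Lemma hom_HX : hom_H * hom_X 1 - hom_X 1 * hom_H = hom_X 1 *+ 2.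
Proof.
rewrite hom_X1 hom_bracket -(trmx_wt a) !mulr_tr -linearB /= mx_wt_up.
have -> : mx_dn b 1 * mx_wt b - mx_wt b * mx_dn b 1 = mx_dn b 1 *+ 2.
  by rewrite -opprB mx_wt_dn opprK.
by rewrite mulrnBl !raddfMn.
Qed.

Lemma hom_HY : hom_H * hom_Y 1 - hom_Y 1 * hom_H = - (hom_Y 1 *+ 2).
Proof.
rewrite hom_Y1 hom_bracket -(trmx_wt a) !mulr_tr -linearB /= mx_wt_dn.
have -> : mx_up b 1 * mx_wt b - mx_wt b * mx_up b 1 = - (mx_up b 1 *+ 2).
  by rewrite -opprB mx_wt_up.
by rewrite mulrnBl opprB !raddfN !raddfMn /= opprK addrC.
Qed.
End HomRepresentation.

Lemma sl2_linear_bracket (R : comNzRingType) d (A B D : 'M[R]_d) x1 x2 x3 y1 y2 y3 :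
  A *m B = B *m A + D -> D *m A = A *m D + A *+ 2 -> D *m B = B *m D - B *+ 2 ->
  (x1 *: A + x2 *: B + x3 *: D) *m (y1 *: A + y2 *: B + y3 *: D) -
  (y1 *: A + y2 *: B + y3 *: D) *m (x1 *: A + x2 *: B + x3 *: D) =
  (2%:R * (x3 * y1 - x1 * y3)) *: A + (2%:R * (x2 * y3 - x3 * y2)) *: B +
  (x1 * y2 - x2 * y1) *: D.
Proof.
move=> e1 e2 e3.
rewrite !(mulmxDl, mulmxDr) -!scalemxAl -!scalemxAr !scalerA e1 e2 e3.
move: (B *m A) (A *m D) (B *m D) (A *m A) (B *m B) (D *m D) => m1 m2 m3 m4 m5 m6.
apply/matrixP => i j; rewrite !mxE; ring.
Qed.

(** In characteristic 0 the recurrence for divided powers can be divided by m + 1, so the image of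
    the first power determines all others and they stay integral. *)
Lemma hom_divpow (K : numFieldType) (E : algType K) d (g : E -> 'M[K]_d)
    (Z : E) (F : nat -> 'M[int]_d) m :
  g 1 = 1%:M -> (forall x y, g (x * y) = g x *m g y) ->
  (forall c x, g (c *: x) = c *: g x) ->
  F 0%N = 1 -> (forall s, F 1%N * F s = F s.+1 *+ s.+1) ->
  g Z = map_mx intr (F 1%N) -> g (divpow Z m) = map_mx intr (F m).
Proof.
move=> g1 gM gZ F0 FS hZ; elim: m => [|m IH].
  by rewrite divpow0 g1 F0 map_mx1.
apply: (scalerI (natS_neq0 K m)); rewrite -gZ -mul_divpow gM hZ IH -map_mxM.
by rewrite -[F 1%N *m F m]/(F 1%N * F m) FS raddfMn /= scaler_nat.
Qed.

Section ReductionModP.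
Variables a b : nat.
Local Notation N := (a.+1 * b.+1)%N.
Local Notation C := (Rdefinitions.R)[i].
Local Notation toC := (map_mx (intmul (1 : C))).
Local Notation hX1 := (hom_X a b 1).
Local Notation hY1 := (hom_Y a b 1).
Local Notation hH := (hom_H a b).

Definition sl2_hom (z : sl2) : 'M[C]_N :=
  sl2_mx z 0 1 *: toC hX1 + sl2_mx z 1 0 *: toC hY1 + sl2_mx z 0 0 *: toC hH.

Lemma sl2_trace0 (z : sl2) : sl2_mx z 1 1 = - sl2_mx z 0 0.
Proof.
case: z => z /= /eqP; rewrite /mxtrace !big_ord_recl big_ord0 addr0 => h.
apply/eqP; rewrite -addr_eq0 addrC; apply/eqP; rewrite -[RHS]h.
by congr (z _ _ + z _ _); apply/val_inj.
Qed.

Lemma toC_inj : injective (toC : 'M[int]_N -> 'M[C]_N).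
Proof.
move=> A B /matrixP h; apply/matrixP => i j; have := h i j; rewrite !mxE => /eqP.
by rewrite eqr_int => /eqP.
Qed.

Lemma sl2_homP x y : env_rel x y -> mxeval sl2_hom x = mxeval sl2_hom y.
Proof.
case=> /= [{}x {}y z h|c {}x z h|{}x {}y z h]; rewrite /sl2_hom.
- rewrite h !mxE; apply/matrixP => i j; rewrite !mxE; ring.
- rewrite h !mxE; apply/matrixP => i j; rewrite !mxE; ring.
have e1 : toC hX1 *m toC hY1 = toC hY1 *m toC hX1 + toC hH.
  by rewrite -!map_mxM -map_mxD -hom_XY addrC subrK.
have e2 : toC hH *m toC hX1 = toC hX1 *m toC hH + toC hX1 *+ 2.
  by rewrite -!map_mxM -raddfMn -map_mxD -hom_HX addrC subrK.
have e3 : toC hH *m toC hY1 = toC hY1 *m toC hH - toC hY1 *+ 2.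
  by rewrite -!map_mxM -raddfMn -map_mxB -hom_HY addrC subrK.
rewrite (sl2_linear_bracket _ _ _ _ _ _ e1 e2 e3) h.
rewrite -[(val x *m val y - val y *m val x)]/(sl2_mx x *m sl2_mx y - sl2_mx y *m sl2_mx x).
have ent (u v : 'I_2) : (sl2_mx x *m sl2_mx y - sl2_mx y *m sl2_mx x) u v =
    sl2_mx x u 0 * sl2_mx y 0 v + sl2_mx x u 1 * sl2_mx y 1 v -
    (sl2_mx y u 0 * sl2_mx x 0 v + sl2_mx y u 1 * sl2_mx x 1 v).
  have s2 (F : 'I_2 -> C) : \sum_i F i = F 0 + F 1.
    by rewrite !big_ord_recl big_ord0 addr0; congr (_ + F _); apply/val_inj.
  by rewrite !mxE !s2.
rewrite !ent !sl2_trace0; congr (_ *: _ + _ *: _ + _ *: _); ring.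
Qed.

Definition env_hom : env -> 'M[C]_N := mxrep sl2_hom.

Lemma env_hom_X : env_hom envX = toC hX1.
Proof.
rewrite /env_hom mxrepE; last exact: sl2_homP.
by rewrite /= /sl2_hom /= !mxE /= scale1r !scale0r !addr0.
Qed.

Lemma env_hom_Y : env_hom envY = toC hY1.
Proof.
rewrite /env_hom mxrepE; last exact: sl2_homP.
by rewrite /= /sl2_hom /= !mxE /= scale1r !scale0r addr0 add0r.
Qed.

Lemma env_hom_H : env_hom envH = toC hH.
Proof.
rewrite /env_hom mxrepE; last exact: sl2_homP.
by rewrite /= /sl2_hom /= !mxE /= !subr0 !scale0r !add0r scale1r.
Qed.

Lemma env_hom_divpow (Z : env) (F : nat -> 'M[int]_N) m :
  F 0%N = 1 -> (forall s, F 1%N * F s = F s.+1 *+ s.+1) -> env_hom Z = toC (F 1%N) ->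
  env_hom (divpow Z m : env) = toC (F m).
Proof.
move=> F0 FS hZ; apply: hom_divpow F0 FS hZ.
- by rewrite /env_hom mxrep1 //; exact: sl2_homP.
- by move=> x y; rewrite /env_hom mxrepM //; exact: sl2_homP.
- by move=> c x; exact: (mxrepZ sl2_homP).
Qed.

Lemma UZ_hom x : UZ_set x -> exists M : 'M[int]_N, env_hom x = toC M.
Proof.
move=> hx; apply: (hx (fun x => exists M : 'M[int]_N, env_hom x = toC M)); first split.
- by exists 1; rewrite /env_hom mxrep1 ?map_mx1 //; exact: sl2_homP.
- move=> u v [A hA] [B hB]; exists (A - B).
  by rewrite /env_hom mxrepD ?mxrepN; try exact: sl2_homP; rewrite -!/(env_hom _) hA hB map_mxB.
- move=> u v [A hA] [B hB]; exists (A *m B).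
  by rewrite /env_hom mxrepM; try exact: sl2_homP; rewrite -!/(env_hom _) hA hB map_mxM.
move=> u [m [->|->]].
  exists (hom_X a b m); apply: env_hom_divpow; [exact: hom_X0|exact: hom_XS|exact: env_hom_X].
exists (hom_Y a b m); apply: env_hom_divpow; [exact: hom_Y0|exact: hom_YS|exact: env_hom_Y].
Qed.

Lemma mxvec_wt (i : 'I_a.+1) (j : 'I_b.+1) :
  mxvec (delta_mx i j) *m hH = (a%:Z - 2 * i%:Z - (b%:Z - 2 * j%:Z)) *: mxvec (delta_mx i j).
Proof.
rewrite /hom_H mulmxBr mul_vec_lm mul_vec_rm -linearB -linearZ /=; congr mxvec.
have wtL n (l : 'I_n.+1) (r : nat) (s : 'I_r) : mx_wt n *m delta_mx l s = (n%:Z - 2 * l%:Z) *: delta_mx l s.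
  apply/matrixP => u v; rewrite !mxE (@sum_ord_single _ _ u
    ((n%:Z - 2 * u%:Z) * ((u == l) && (v == s))%:R)) ?ltn_ord.
  - by case: eqP => [->|_]; rewrite ?mulr0.
  - by move=> w /val_inj ->; rewrite !mxE eqxx.
  by move=> w; rewrite (inj_eq val_inj) eq_sym !mxE => /negPf ->; rewrite mul0r.
rewrite wtL -[mx_wt b]trmx_wt -[delta_mx i j *m _]trmxK trmx_mul trmxK trmx_delta wtL.
by rewrite linearZ /= trmx_delta [RHS]scalerBl.
Qed.

Variable k : closedFieldType.
Local Notation tok := (map_mx (intmul (1 : k))).
Local Notation U := (hyper k).

(** The integral matrix is unique by [toC_inj]; hence the choice is compatible with sums and
    products and can be reduced to [k]. *)
Definition UZ_mx (u : UZ) : 'M[int]_N :=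
  sval (cid (UZ_hom (asboolP _ (valP u)))).

Lemma UZ_mxP u : env_hom (val u) = toC (UZ_mx u).
Proof. by rewrite /UZ_mx; case: cid. Qed.

Lemma UZ_homP x y : @hyper_rel k x y ->
  mxeval (fun u => tok (UZ_mx u)) x = mxeval (fun u => tok (UZ_mx u)) y.
Proof.
case=> /= [|u v|u v].
- have -> : UZ_mx 1 = 1%:M.
    by apply: toC_inj; rewrite -UZ_mxP map_mx1 /env_hom mxrep1 //; exact: sl2_homP.
  by rewrite map_mx1.
- rewrite -map_mxD; congr (map_mx _ _); apply: toC_inj.
  by rewrite map_mxD -!UZ_mxP /env_hom -(mxrepD sl2_homP).
- rewrite -map_mxM; congr (map_mx _ _); apply: toC_inj.
  by rewrite map_mxM -!UZ_mxP /env_hom -(mxrepM sl2_homP).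
Qed.

Definition hyper_hom : U -> 'M[k]_N := mxrep (fun u => tok (UZ_mx u)).

Lemma hyper_homM x y : hyper_hom (x * y) = hyper_hom x *m hyper_hom y.
Proof. exact: (mxrepM UZ_homP). Qed.

Lemma hyper_homZ c x : hyper_hom (c *: x) = c *: hyper_hom x.
Proof. exact: (mxrepZ UZ_homP). Qed.

Lemma hyper_hom0 : hyper_hom 0 = 0.
Proof. exact: (mxrep0 UZ_homP). Qed.

Lemma hyper_hom_sum (I : Type) (r : seq I) (P : pred I) (F : I -> U) :
  hyper_hom (\sum_(i <- r | P i) F i) = \sum_(i <- r | P i) hyper_hom (F i).
Proof.
apply: (big_morph _ _ hyper_hom0) => x y; exact: (mxrepD UZ_homP).
Qed.

Lemma hyper_hom_UZ x M : UZ_set x -> env_hom x = toC M ->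
  hyper_hom (to_hyper k x) = tok M.
Proof.
move=> /UZ_sub[u ->]; rewrite UZ_mxP => /toC_inj <-.
by rewrite to_hyperE /hyper_hom /pgen mxrepE //; exact: UZ_homP.
Qed.

Lemma hyper_hom_divX m : hyper_hom (divX k m) = tok (hom_X a b m).
Proof.
apply: hyper_hom_UZ; first exact: UZ_divX.
by apply: env_hom_divpow; [exact: hom_X0|exact: hom_XS|exact: env_hom_X].
Qed.

Lemma hyper_hom_divY m : hyper_hom (divY k m) = tok (hom_Y a b m).
Proof.
apply: hyper_hom_UZ; first exact: UZ_divY.
by apply: env_hom_divpow; [exact: hom_Y0|exact: hom_YS|exact: env_hom_Y].
Qed.

Lemma weight_poly (w : 'rV[int]_N) (z : int) (P : {poly C}) :
  w *m hH = z *: w ->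
  map_mx intr w *m env_hom (horner_alg envH P) = P.[z%:~R] *: map_mx intr w.
Proof.
move=> hw; elim/poly_ind: P => [|P c IH].
  by rewrite rmorph0 /env_hom (mxrep0 sl2_homP) mulmx0 horner0 scale0r.
rewrite rmorphD rmorphM /= horner_algX horner_algC.
rewrite /env_hom (mxrepD sl2_homP) (mxrepM sl2_homP) (mxrepZ sl2_homP) (mxrep1 sl2_homP).
rewrite mulmxDr mulmxA IH -scalemxAl -[mxrep _ envH]/(env_hom envH) env_hom_H.
rewrite -map_mxM hw -scalemxAr mulmx1 hornerMXaddC scalerDl; congr (_ + _).
rewrite -scalerA; congr (_ *: _); apply/matrixP => i j; rewrite !mxE.
by rewrite /= intrM.
Qed.

Lemma weight_hval (w : 'rV[int]_N) (z : int) h f : w *m hH = z *: w -> hval h f ->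
  map_mx intr w *m hyper_hom h = f z *: map_mx intr w.
Proof.
move=> hw [n [c [-> ->]]]; rewrite hyper_hom_sum mulmx_sumr scaler_suml.
apply: eq_bigr => i _; rewrite hyper_homZ -scalemxAr -scalerA; congr (_ *: _).
rewrite binH_binp; have [M hM] := UZ_hom (UZ_binp 0 i).
rewrite (hyper_hom_UZ (UZ_binp 0 i) hM) -map_mxM.
have -> : w *m M = binz z i *: w.
  apply/matrixP => u v; have := weight_poly (binp (C : numFieldType) 0 i) hw.
  rewrite hM horner_binp addr0 -map_mxM => /matrixP /(_ u v).
  by rewrite !mxE /= -intrM => /eqP; rewrite eqr_int => /eqP.
by apply/matrixP => u v; rewrite !mxE /= intrM.
Qed.

Lemma mul_delta_entry (R : comNzRingType) m n p q (A : 'M[R]_(m, n)) (i : 'I_n) (j : 'I_p)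
    (B : 'M[R]_(p, q)) r c : (A *m delta_mx i j *m B) r c = A r i * B j c.
Proof.
rewrite -(mul_delta_mx (0 : 'I_1)) mulmxA -colE -mulmxA -rowE.
by rewrite mxE big_ord1 !mxE.
Qed.

(** The basis vector 0 of the target is killed by [(mx_dn a s)^T] for s > 0, so only the term acting
    purely on the source remains. *)
Lemma hom_Y_vec (m : 'I_b.+1) :
  mxvec (delta_mx 0 0 : 'M[int]_(a.+1, b.+1)) *m hom_Y a b m =
  (-1) ^+ m *: mxvec (delta_mx 0 m).
Proof.
rewrite /hom_Y mulmx_sumr big_ord_recr /= subnn big1 ?add0r => [|i _].
  rewrite mx_dn0 trmx1 lm1 mul1r -scalemxAr mul_vec_rm; congr (_ *: mxvec _).
  apply/matrixP => r c; rewrite -[delta_mx 0 0]mul1mx mul_delta_entry !mxE add0n.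
  rewrite (inj_eq val_inj) [c == m]eq_sym.
  by case: (eqVneq m c) => [->|_]; rewrite ?binn ?mulr1 ?andbT ?mulr0 ?andbF.
rewrite -[_ * _]/(_ *m _) mulmxA mul_vec_lm -scalemxAr mul_vec_rm.
have -> : (mx_dn a (m - i))^T *m delta_mx 0 0 *m mx_up b i = 0.
  apply/matrixP => r c; rewrite mul_delta_entry !mxE ifF ?mul0r //.
  by rewrite /=; have := ltn_ord i; lia.
by rewrite !linear0.
Qed.

(** Precomposition with [mx_dn b i] moves column m to column m - i. An entry in a column c >= m
    therefore sees only the term i = 0; this is the triangularity behind linear independence. *)
Lemma hom_X_vec (m : 'I_b.+1) m' (r : 'I_a.+1) (c : 'I_b.+1) : (m <= c)%N ->
  vec_mx (mxvec (delta_mx 0 m : 'M[int]_(a.+1, b.+1)) *m hom_X a b m') r c =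
  ((m == c) && (r == m' :> nat))%:R.
Proof.
move=> mc; rewrite /hom_X mulmx_sumr big_ord_recl /= linearD /= mxE subn0.
rewrite expr0 scale1r mx_dn0 rm1 mulr1 mul_vec_lm mxvecK linear_sum summxE big1 ?addr0 => [|i _].
  rewrite -[_ *m _]mulmx1 mul_delta_entry !mxE add0n eq_sym.
  by case: (eqVneq (m' : nat) r) => [->|_]; rewrite ?andbF ?mul0r // binn mul1r andbT.
rewrite -[_ * _]/(_ *m _) mulmxA mul_vec_lm -scalemxAr mul_vec_rm linearZ /= mxvecK.
rewrite mxE mul_delta_entry !mxE [X in _ * (_ * X)]ifF ?mulr0 //.
by rewrite /bump /=; lia.
Qed.

End ReductionModP.

(* Apply the sum to the delta matrix at (0, 0) of Hom(V_b, V_a), with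
   a - b = z - 2m, and read off the entry (m', m): a summand of smaller first
   index does not contribute, one of larger first index vanishes by induction. *)
Lemma triangular_indep (k : closedFieldType) (n : nat)
    (h : nat -> nat -> hyper k) (f : nat -> nat -> int -> k) :
  (forall m m', hval (h m m') (f m m')) ->
  \sum_(m < n) \sum_(m' < n) divY k m * h m m' * divX k m' = 0 ->
  forall m m' z, (m < n)%N -> (m' < n)%N -> f m m' z = 0.
Proof.
move=> hf h0 M M' z; move: {2}(n - M)%N (leqnn (n - M)%N) => d.
elim: d M M' z => [|d IH] M M' z dM Mn M'n; first by lia.
(* The summand [n] makes both [a] and [b] at least n, so that every index below n labels a basis
   vector. *)
pose b := (n + absz (z - 2 * M%:Z)%R)%N; pose a := absz (b%:Z + (z - 2 * M%:Z)).
have ha : a%:Z = b%:Z + (z - 2 * M%:Z) by rewrite /a /b; lia.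
have na : (n <= a)%N by rewrite /b in ha *; lia.
have nb : (n <= b)%N by rewrite /b; lia.
pose e00 := mxvec (delta_mx 0 0 : 'M[int]_(a.+1, b.+1)).
pose iM : 'I_b.+1 := inord M; pose iM' : 'I_a.+1 := inord M'.
have := congr1 (fun u => (vec_mx (map_mx intr e00 *m hyper_hom a b u)) iM' iM) h0.
rewrite hyper_hom0 mulmx0 linear0 [RHS]mxE hyper_hom_sum mulmx_sumr linear_sum summxE.
have term (m m' : 'I_n) : vec_mx (map_mx intr e00 *m
     hyper_hom a b (divY k m * h m m' * divX k m')) iM' iM =
   (-1) ^+ m * f m m' (a%:Z - (b%:Z - 2 * m%:Z)) *
   (vec_mx (mxvec (delta_mx 0 (inord m) : 'M[int]_(a.+1, b.+1)) *m hom_X a b m') iM' iM)%:~R.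
  have mb : (m < b.+1)%N by have := ltn_ord m; lia.
  rewrite !hyper_homM hyper_hom_divY hyper_hom_divX !mulmxA -map_mxM.
  have := @hom_Y_vec a b (inord m); rewrite inordK // => ->.
  have hw := @mxvec_wt a b 0 (inord m); rewrite inordK // mulr0 subr0 in hw.
  rewrite [map_mx _ _](_ : _ = (-1) ^+ m *: map_mx intr (mxvec (delta_mx 0 (inord m)))); last first.
    by apply/matrixP => u v; rewrite !mxE /= intrM rmorphXn /= rmorphN1.
  rewrite -!scalemxAl (weight_hval hw (hf m m')) -!scalemxAl -map_mxM scalerA.
  by rewrite linearZ /= -map_vec_mx !mxE.
have Mb : (M < b.+1)%N by lia.
have M'a : (M' < a.+1)%N by lia.
rewrite (bigD1 (Ordinal Mn)) //= hyper_hom_sum mulmx_sumr linear_sum summxE.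
rewrite (bigD1 (Ordinal M'n)) //= (term (Ordinal Mn) (Ordinal M'n)) /=.
rewrite hom_X_vec // eqxx inordK // eqxx mulr1z mulr1.
rewrite !big1 ?addr0.
- have -> : a%:Z - (b%:Z - 2 * M%:Z) = z by lia.
  by move/eqP; rewrite mulf_eq0 signr_eq0 /= => /eqP.
- move=> m mM; rewrite hyper_hom_sum mulmx_sumr linear_sum summxE big1 // => m' _.
  rewrite term; have [mM'|mM'] := ltnP M m.
    by rewrite IH ?mulr0 ?mul0r //; lia.
  have mb : (m < b.+1)%N by have := ltn_ord m; lia.
  rewrite hom_X_vec ?inordK //.
  rewrite -(inj_eq val_inj) /= !inordK // (_ : (m == M :> nat) = false) ?mulr0 //.
  by apply/negbTE; move: mM; rewrite -(inj_eq val_inj).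
move=> m' mM'; rewrite (term (Ordinal Mn) m') /= hom_X_vec // inordK // eqxx /=.
rewrite (_ : (M' == m' :> nat) = false) ?mulr0 // eq_sym.
by apply/negbTE; move: mM'; rewrite -(inj_eq val_inj).
Qed.

(** * The basis of the hyperalgebra and of A_r *)

Section Span.
Variables (k : fieldType) (V : lmodType k).

(** Impredicative form: a linear property is proved on the span by instantiating [S] with it. *)
Definition kspan (E : V -> Prop) (u : V) : Prop :=
  forall S : V -> Prop, S 0 -> (forall x y, S x -> S y -> S (x + y)) ->
    (forall a x, S x -> S (a *: x)) -> (forall x, E x -> S x) -> S u.

Variable E : V -> Prop.

Lemma kspan0 : kspan E 0.
Proof. by move=> S. Qed.
Lemma kspanD x y : kspan E x -> kspan E y -> kspan E (x + y).
Proof. by move=> hx hy S S0 SD SZ SE; apply: (SD); [exact: (hx S) | exact: (hy S)]. Qed.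
Lemma kspanZ a x : kspan E x -> kspan E (a *: x).
Proof. by move=> hx S S0 SD SZ SE; apply: (SZ); exact: (hx S). Qed.
Lemma kspan_gen x : E x -> kspan E x.
Proof. by move=> hx S S0 SD SZ SE; exact: SE. Qed.
Lemma kspan_sum (I : Type) (r : seq I) (P : pred I) (F : I -> V) :
  (forall i, P i -> kspan E (F i)) -> kspan E (\sum_(i <- r | P i) F i).
Proof. by move=> h; elim/big_ind: _ => //; exact: kspanD. Qed.
Lemma kspanB x y : kspan E x -> kspan E y -> kspan E (x - y).
Proof. by move=> hx hy; rewrite -scaleN1r; apply: kspanD => //; exact: kspanZ. Qed.

End Span.

Lemma kspan_linear (k : fieldType) (V V' : lmodType k) (E : V -> Prop) (E' : V' -> Prop)
    (f : V -> V') :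
  linear f -> (forall x, E x -> kspan E' (f x)) ->
  forall x, kspan E x -> kspan E' (f x).
Proof.
move=> lf fE x; have f0 : f 0 = 0.
  by have := lf (-1) 0 0; rewrite scaleN1r oppr0 addr0 scaleN1r addNr.
move=> hx; apply: (hx (fun x => kspan E' (f x))) => //.
- by rewrite f0; exact: kspan0.
- by move=> u v hu hv; have := lf 1 u v; rewrite !scale1r => ->; exact: kspanD.
- by move=> a u hu; have := lf a u 0; rewrite f0 !addr0 => ->; exact: kspanZ.
Qed.

Lemma kspan_eq (k : fieldType) (V V' : lmodType k) (E : V -> Prop) (f g : V -> V') :
  linear f -> linear g -> (forall x, E x -> f x = g x) ->
  forall x, kspan E x -> f x = g x.
Proof.
move=> lf lg fg; have lin0 (h : V -> V') : linear h -> h 0 = 0.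
  by move=> lh; have := lh (-1) 0 0; rewrite scaleN1r oppr0 addr0 scaleN1r addNr.
move=> x hx; apply: (hx (fun x => f x = g x)) => //.
- by rewrite !lin0.
- by move=> u v hu hv; have := lf 1 u v; rewrite !scale1r => ->; rewrite hu hv -{2}(scale1r u) lg scale1r.
- by move=> c u hu; rewrite -[c *: u]addr0 lf lg hu !lin0.
Qed.

Lemma kspan_mono (k : fieldType) (V : lmodType k) (E E' : V -> Prop) x :
  (forall y, E y -> kspan E' y) -> kspan E x -> kspan E' x.
Proof. by move=> h; apply: (@kspan_linear _ _ _ _ _ idfun). Qed.

Section PBW.
Variables (k : closedFieldType) (p : nat).
Hypothesis hchar : p \in [pchar k].
Local Notation U := (hyper k).
Local Notation kb := (kbin k).
Local Notation periodic := (@periodic k p).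
Local Notation Hfun := (@Hfun k).

Definition bas (m n m' : nat) : U := divY k m * binH k 0 n * divX k m'.

Definition lincomb (N : nat) (c : nat -> nat -> nat -> k) (F : nat -> nat -> nat -> U) : U :=
  \sum_(m < N) \sum_(m' < N) \sum_(n < N) c m n m' *: F m n m'.

Definition supported (N : nat) (c : nat -> nat -> nat -> k) : Prop :=
  forall m n m', c m n m' != 0 -> [/\ m < N, n < N & m' < N]%N.

Lemma lincomb_widen N N' c F : (N <= N')%N -> supported N c ->
  lincomb N c F = lincomb N' c F.
Proof.
move=> NN' hc; rewrite /lincomb.
have wid (G : nat -> U) : (forall n, (N <= n)%N -> G n = 0) ->
    \sum_(n < N) G n = \sum_(n < N') G n.
  move=> hG; rewrite (big_ord_widen N' G NN') big_mkcond; apply: eq_bigr => i _.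
  by case: ltnP => // /hG.
have c0 m n m' : ~ [/\ m < N, n < N & m' < N]%N -> c m n m' = 0.
  by move=> h; apply/eqP/negP => /negP /hc.
rewrite (wid (fun m => \sum_(m' < N) \sum_(n < N) c m n m' *: F m n m')).
  apply: eq_bigr => m _.
  rewrite (wid (fun m' => \sum_(n < N) c m n m' *: F m n m')).
    apply: eq_bigr => m' _; rewrite (wid (fun n => c m n m' *: F m n m')) // => n Nn.
    by rewrite c0 ?scale0r // => -[]; lia.
  by move=> m' Nm'; apply: big1 => n _; rewrite c0 ?scale0r // => -[]; lia.
move=> m Nm; apply: big1 => m' _; apply: big1 => n _.
by rewrite c0 ?scale0r // => -[]; lia.
Qed.

Lemma lincombD N c c' F : lincomb N (fun m n m' => c m n m' + c' m n m') F =
  lincomb N c F + lincomb N c' F.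
Proof.
rewrite /lincomb -big_split; apply: eq_bigr => m _; rewrite -big_split.
apply: eq_bigr => m' _; rewrite -big_split; apply: eq_bigr => n _.
by rewrite scalerDl.
Qed.

Lemma lincombZ N a c F : lincomb N (fun m n m' => a * c m n m') F = a *: lincomb N c F.
Proof.
rewrite /lincomb scaler_sumr; apply: eq_bigr => m _; rewrite scaler_sumr.
apply: eq_bigr => m' _; rewrite scaler_sumr; apply: eq_bigr => n _.
by rewrite scalerA.
Qed.

(** For fixed m and m' the inner sum is a torus element. [triangular_indep] makes its function
    vanish at every weight, and the independence of binomials then kills the coefficients. *)
Lemma lincomb_bas0 N c : lincomb N c bas = 0 ->
  forall m n m', (m < N)%N -> (n < N)%N -> (m' < N)%N -> c m n m' = 0.
Proof.
move=> h m n m' mN nN m'N.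
pose h' m m' := \sum_(n < N) c m n m' *: binH k 0 n.
pose f m m' z := \sum_(n < N) c m n m' * kb z n.
have hf u v : hval (h' u v) (f u v) by exists N, (fun n => c u n v).
apply: (@kbin_indep k N (fun n => c m n m')) nN => z; apply: (triangular_indep hf) mN m'N.
rewrite -[RHS]h; apply: eq_bigr => u _; apply: eq_bigr => v _.
rewrite mulr_sumr mulr_suml; apply: eq_bigr => w _.
by rewrite -scalerAr -scalerAl.
Qed.

Lemma lincomb_inj N N' c c' : supported N c -> supported N' c' ->
  lincomb N c bas = lincomb N' c' bas -> forall m n m', c m n m' = c' m n m'.
Proof.
move=> hc hc'.
rewrite (lincomb_widen _ (leq_maxl N N') hc) (lincomb_widen _ (leq_maxr N N') hc').
move/eqP; rewrite -subr_eq0 -scaleN1r -lincombZ -lincombD => /eqP /lincomb_bas0 h m n m'.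
have [[h1 h2 h3]|hn] := pselect [/\ m < maxn N N', n < maxn N N' & m' < maxn N N']%N.
  by have := h _ _ _ h1 h2 h3; rewrite mulN1r => /eqP; rewrite subr_eq0 => /eqP.
have c0 : c m n m' = 0.
  by apply/eqP/negP => /negP /hc [? ? ?]; apply: hn; split; rewrite leq_max; apply/orP; left.
have c'0 : c' m n m' = 0.
  by apply/eqP/negP => /negP /hc' [? ? ?]; apply: hn; split; rewrite leq_max; apply/orP; right.
by rewrite c0 c'0.
Qed.

Lemma delta_lincomb m n m' : exists N c, [/\ supported N c,
  (forall u v w, c u v w != 0 -> [/\ u = m, v = n & w = m']) &
  forall F, F m n m' = lincomb N c F].
Proof.
pose c u v w : k := ([&& u == m, v == n & w == m'])%:R.
have c_neq0 u v w : c u v w != 0 -> [/\ u = m, v = n & w = m'].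
  by rewrite /c; case: and3P => [[/eqP ? /eqP ? /eqP ?]|]; rewrite ?eqxx.
exists (maxn m (maxn n m')).+1, c; split.
- by move=> u v w /c_neq0 [-> -> ->]; split; lia.
- exact: c_neq0.
move=> F.
have hm : (m < (maxn m (maxn n m')).+1)%N by lia.
have hn : (n < (maxn m (maxn n m')).+1)%N by lia.
have hm' : (m' < (maxn m (maxn n m')).+1)%N by lia.
rewrite /lincomb (bigD1 (Ordinal hm)) //= (bigD1 (Ordinal hm')) //= (bigD1 (Ordinal hn)) //=.
rewrite {1}/c !eqxx scale1r !big1 ?addr0 //.
- move=> i; rewrite -(inj_eq val_inj) => /negPf /= ni; apply: big1 => j _; apply: big1 => l _.
  by rewrite /c ni scale0r.
- move=> i; rewrite -(inj_eq val_inj) => /negPf /= ni; apply: big1 => j _.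
  by rewrite /c ni !andbF scale0r.
move=> i; rewrite -(inj_eq val_inj) => /negPf /= ni.
by rewrite /c ni andbF scale0r.
Qed.

Definition pbw (Q : nat -> nat -> nat -> Prop) : U -> Prop :=
  kspan (fun u => exists m n m', Q m n m' /\ u = bas m n m').

Lemma pbw_lincomb Q u : pbw Q u -> exists N c, [/\ supported N c,
  (forall m n m', c m n m' != 0 -> Q m n m') & u = lincomb N c bas].
Proof.
move=> hu; apply: (hu (fun u => exists N c, [/\ supported N c,
  (forall m n m', c m n m' != 0 -> Q m n m') & u = lincomb N c bas])).
- exists 0%N, (fun _ _ _ => 0); split=> [m n m'|m n m'|]; rewrite ?eqxx //.
  by rewrite /lincomb big_ord0.
- move=> x y [N [c [h1 h2 ->]]] [N' [c' [h1' h2' ->]]].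
  exists (maxn N N'), (fun m n m' => c m n m' + c' m n m'); split.
  + move=> m n m'; have [->|/h1[? ? ?]] := eqVneq (c m n m') 0.
      by rewrite add0r => /h1'[? ? ?]; split; rewrite leq_max; apply/orP; right.
    by move=> _; split; rewrite leq_max; apply/orP; left.
  + move=> m n m'; have [->|/h2//] := eqVneq (c m n m') 0.
    by rewrite add0r => /h2'.
  by rewrite lincombD (lincomb_widen _ (leq_maxl N N') h1)
    (lincomb_widen _ (leq_maxr N N') h1').
- move=> a x [N [c [h1 h2 ->]]]; exists N, (fun m n m' => a * c m n m').
  by split=> [m n m'|m n m'|]; rewrite ?mulf_eq0 ?negb_or ?lincombZ //
    => /andP[_]; [exact: h1 | exact: h2].
move=> _ [m [n [m' [hQ ->]]]]; have [N [c [h1 h2 h3]]] := delta_lincomb m n m'.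
by exists N, c; split=> // i j l /h2[-> -> ->].
Qed.

Lemma lincomb_pbw (Q : nat -> nat -> nat -> Prop) N c :
  (forall m n m', c m n m' != 0 -> Q m n m') -> pbw Q (lincomb N c bas).
Proof.
move=> h; apply: kspan_sum => m _; apply: kspan_sum => m' _; apply: kspan_sum => n _.
have [->|/h hQ] := eqVneq (c m n m') 0; first by rewrite scale0r; exact: kspan0.
by apply: kspanZ; apply: kspan_gen; exists m, n, m'.
Qed.

(** Coordinates in the basis are unique, so two coordinate subspaces meet in a coordinate subspace.
    It is used to intersect the two algebras that define A_r. *)
Lemma pbwI Q Q' u : pbw Q u -> pbw Q' u -> pbw (fun m n m' => Q m n m' /\ Q' m n m') u.
Proof.
move=> /pbw_lincomb[N [c [h1 h2 ->]]] /pbw_lincomb[N' [c' [h1' h2' e]]].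
apply: lincomb_pbw => m n m' hc; split; first exact: h2.
by apply: h2'; rewrite -(lincomb_inj h1 h1' e).
Qed.

Lemma pbw_sub (Q Q' : nat -> nat -> nat -> Prop) u :
  (forall m n m', Q m n m' -> Q' m n m') -> pbw Q u -> pbw Q' u.
Proof.
move=> h; apply: kspan_mono => _ [m [n [m' [hQ ->]]]]; apply: kspan_gen.
by exists m, n, m'; split=> //; exact: h.
Qed.

Lemma pbw_Hfun (Q : nat -> nat -> nat -> Prop) r f m m' : periodic r f ->
  (forall n, (n < p ^ r)%N -> Q m n m') -> pbw Q (divY k m * Hfun f * divX k m').
Proof.
move=> /(periodic_hval hchar)[c hc] hQ; rewrite -(Hfun_eq hchar hc).
rewrite mulr_sumr mulr_suml; apply: kspan_sum => n _.
rewrite -scalerAr -scalerAl; apply: kspanZ; apply: kspan_gen.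
by exists m, n, m'; split=> //; exact: hQ.
Qed.

(** Subtracting the period p^r from the upper entry leaves i + j - p^r, which is smaller than i. *)
Lemma bin_carry r i j : (i < p ^ r)%N -> (j < p ^ r)%N -> (p ^ r <= i + j)%N ->
  'C(i + j, i)%:R = 0 :> k.
Proof.
move=> hi hj hij; rewrite -kbin_nat.
have -> : (i + j)%N%:Z = (i + j - p ^ r)%N%:Z + (p ^ r)%N%:Z by lia.
by rewrite kbin_periodic // kbin_nat bin_small //; lia.
Qed.

Lemma periodic_kbin r c n : (n < p ^ r)%N -> periodic r (fun z => kb (z + c) n).
Proof. by move=> nr z; rewrite addrAC kbin_periodic. Qed.

Definition box (r : nat) (m n m' : nat) : Prop := [/\ m < p ^ r, n < p ^ r & m' < p ^ r]%N.

Lemma divX_divX_box r i m' : (i < p ^ r)%N -> (m' < p ^ r)%N ->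
  divX k i * divX k m' = 0 \/ (i + m' < p ^ r)%N.
Proof.
move=> hi hm'; case: (ltnP (i + m') (p ^ r)) => h; [by right | left].
by rewrite divXM (bin_carry hi hm' h) scale0r.
Qed.

Lemma divY_divY_box r i m' : (i < p ^ r)%N -> (m' < p ^ r)%N ->
  divY k i * divY k m' = 0 \/ (i + m' < p ^ r)%N.
Proof.
move=> hi hm'; case: (ltnP (i + m') (p ^ r)) => h; [by right | left].
by rewrite divYM (bin_carry hi hm' h) scale0r.
Qed.

(** Commuting X^(i) to the right creates only binomials of period p^r. The resulting products of two
    powers of X either vanish by a carry or stay below p^r. *)
Lemma divX_pbw r i u : (i < p ^ r)%N -> pbw (box r) u -> pbw (box r) (divX k i * u).
Proof.
move=> hi; apply: (@kspan_linear _ _ _ _ _ (fun u => divX k i * u)).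
  by move=> a x y; rewrite mulrDr scalerAr.
move=> _ [m [n [m' [[hm hn hm'] ->]]]].
rewrite /bas !mulrA (divX_divY hchar) !mulr_suml; apply: kspan_sum => j jm.
have [e|him'] := @divX_divX_box r (i - j) m' ltac:(lia) hm'.
  rewrite (Hfun_binH hchar) -[_ * divX k _ * _]mulrA (divX_Hfun hchar); last exact: loc_const_kbin.
  by rewrite -!mulrA e !mulr0; exact: kspan0.
rewrite (Hfun_binH hchar) -[_ * divX k _ * _]mulrA (divX_Hfun hchar); last exact: loc_const_kbin.
rewrite mulrA -[_ * Hfun _ * Hfun _]mulrA (HfunM hchar); try exact: loc_const_kbin; last first.
  by apply: (@loc_const_shift _ _ (fun z => kb (z + 0) n)); exact: loc_const_kbin.
rewrite -mulrA divXM -scalerAr; apply: kspanZ; apply: (@pbw_Hfun _ r).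
  move=> z; congr (_ * _); first by rewrite periodic_kbin //; have := ltn_ord j; lia.
  by rewrite -[X in kb X _]addrA -[X in _ = kb X _]addrA periodic_kbin.
by move=> n' hn'; split=> //; lia.
Qed.

Lemma divY_pbw r i u : (i < p ^ r)%N -> pbw (box r) u -> pbw (box r) (divY k i * u).
Proof.
move=> hi; apply: (@kspan_linear _ _ _ _ _ (fun u => divY k i * u)).
  by move=> a x y; rewrite mulrDr scalerAr.
move=> _ [m [n [m' [[hm hn hm'] ->]]]].
have [e|him] := divY_divY_box hi hm.
  by rewrite /bas !mulrA e !mul0r; exact: kspan0.
rewrite /bas !mulrA divYM -!scalerAl; apply: kspanZ; apply: kspan_gen.
by exists (i + m)%N, n, m'.
Qed.

Lemma bas000 : bas 0 0 0 = 1.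
Proof. by rewrite /bas divX0 divY0 mulr1 mul1r binH_binp binp0 rmorph1 to_hyper1. Qed.

Lemma expn_p_gt0 r : (0 < p ^ r)%N.
Proof. by rewrite expn_gt0 (p_gt0 hchar). Qed.

Lemma pbw_box1 r : pbw (box r) 1.
Proof.
apply: kspan_gen; exists 0%N, 0%N, 0%N; rewrite bas000; split=> //.
by split; exact: expn_p_gt0.
Qed.

Lemma hyper_trunc_pbw r u : hyper_trunc p r u -> pbw (box r) u.
Proof.
move=> hu; suff: forall v, pbw (box r) v -> pbw (box r) (u * v).
  by move=> /(_ 1 (@pbw_box1 r)); rewrite mulr1.
apply: (hu (fun u => forall v, pbw (box r) v -> pbw (box r) (u * v))); first split; first split.
- by move=> v; rewrite mul1r.
- by move=> x y hx hy v hv; rewrite mulrBl; apply: kspanB; [exact: hx | exact: hy].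
- by move=> x y hx hy v hv; rewrite -mulrA; apply: hx; exact: hy.
- by move=> c x hx v hv; rewrite -scalerAl; apply: kspanZ; exact: hx.
have p1 := prime_gt1 (pcharf_prime hchar).
by move=> x [i [ir [->|->]]] v; [apply: divX_pbw | apply: divY_pbw]; rewrite ltn_exp2l.
Qed.

(** The span is stable under left multiplication by each X^(i) and Y^(i), since any given index and
    basis element fit into a common box. These elements generate [UZ_set], and images of [UZ_set]
    generate the whole algebra. *)
Lemma pbw_all u : pbw (fun _ _ _ => True) u.
Proof.
pose T (_ _ _ : nat) := True.
have p1 := prime_gt1 (pcharf_prime hchar).
have big i m n m' : exists r, (i < p ^ r)%N /\ box r m n m'.
  pose s := (i + m + n + m')%N; exists s.
  by have := ltn_expl s p1; rewrite /box /s => h; split; [lia|split; lia].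
have boxT r x : pbw (box r) x -> pbw T x by exact: pbw_sub.
have XT i x : pbw T x -> pbw T (divX k i * x).
  apply: (@kspan_linear _ _ _ _ _ (fun u => divX k i * u)).
    by move=> a y z; rewrite mulrDr scalerAr.
  move=> _ [m [n [m' [_ ->]]]]; have [r [ir hb]] := big i m n m'.
  by apply: (boxT r); apply: divX_pbw => //; apply: kspan_gen; exists m, n, m'.
have YT i x : pbw T x -> pbw T (divY k i * x).
  apply: (@kspan_linear _ _ _ _ _ (fun u => divY k i * u)).
    by move=> a y z; rewrite mulrDr scalerAr.
  move=> _ [m [n [m' [_ ->]]]]; have [r [ir hb]] := big i m n m'.
  by apply: (boxT r); apply: divY_pbw => //; apply: kspan_gen; exists m, n, m'.
suff: forall v, pbw T v -> pbw T (u * v).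
  by move=> /(_ 1 (boxT 0%N _ (@pbw_box1 0%N))); rewrite mulr1.
have genT (x : UZ) v : pbw T v -> pbw T (to_hyper k (val x) * v).
  have hx : UZ_set (val x) by exact/asboolP/(valP x).
  suff [] : UZ_set (val x) /\ forall v, pbw T v -> pbw T (to_hyper k (val x) * v).
    by move=> _; apply.
  apply: (hx (fun x => UZ_set x /\ forall v, pbw T v -> pbw T (to_hyper k x * v))); first split.
  - by split; [exact: UZ1 | move=> w; rewrite to_hyper1 mul1r].
  - move=> x1 x2 [u1 h1] [u2 h2]; split; first exact: UZB.
    move=> w hw; rewrite to_hyperD ?to_hyperN //; last exact: UZN.
    by rewrite mulrBl; apply: kspanB; [exact: h1 | exact: h2].
  - move=> x1 x2 [u1 h1] [u2 h2]; split; first exact: UZM.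
    by move=> w hw; rewrite to_hyperM // -mulrA; apply: h1; exact: h2.
  move=> y [m [->|->]].
    by split; [exact: UZ_divX | exact: XT].
  by split; [exact: UZ_divY | exact: YT].
elim/pclass_ind: u => t; elim: t => [x||x IH|x IHx y IHy||x IHx y IHy|c x IH] v hv.
- by rewrite -[pclass _ _]/(pgen _ x) -to_hyperE; exact: genT.
- by rewrite -[pclass _ _]/(0 : U) mul0r; exact: kspan0.
- have -> : (pclass (@hyper_rel k) (topp x) : U) = - pclass _ x.
    by rewrite -[RHS]/(popp _) poppE.
  by rewrite mulNr -scaleN1r; apply: kspanZ; exact: IH.
- have -> : (pclass (@hyper_rel k) (tadd x y) : U) = (pclass _ x : U) + (pclass _ y : U).
    by rewrite -[RHS]/(padd _ _) paddE.
  by rewrite mulrDl; apply: kspanD; [exact: IHx | exact: IHy].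
- by rewrite -[pclass _ _]/(1 : U) mul1r.
- have -> : (pclass (@hyper_rel k) (tmul x y) : U) = (pclass _ x : U) * (pclass _ y : U).
    by rewrite -[RHS]/(pmul _ _) pmulE.
  by rewrite -mulrA; apply: IHx; exact: IHy.
have -> : (pclass (@hyper_rel k) (tscale c x) : U) = c *: (pclass _ x : U).
  by rewrite -[RHS]/(pscale _ _) pscaleE.
by rewrite -scalerAl; apply: kspanZ; exact: IH.
Qed.

(** Coefficient families are chosen for all elements at once; their uniqueness makes the resulting
    map linear. It supplies both [Fr'] and the maps [phi]. *)
Lemma linear_extension (F : nat -> nat -> nat -> U) :
  exists f : U -> U, linear f /\ forall m n m', f (bas m n m') = F m n m'.
Proof.
have /choice[co hco] : forall u : U, exists Nc : nat * (nat -> nat -> nat -> k),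
    supported Nc.1 Nc.2 /\ u = lincomb Nc.1 Nc.2 bas.
  by move=> u; have [N [c [h1 _ ->]]] := pbw_lincomb (pbw_all u); exists (N, c).
pose f u := lincomb (co u).1 (co u).2 F.
have fE N c u : supported N c -> u = lincomb N c bas -> f u = lincomb N c F.
  move=> hc eu; have [h1 h2] := hco u.
  have e := lincomb_inj h1 hc (etrans (esym h2) eu).
  have hm : supported (maxn (co u).1 N) (co u).2.
    by move=> m n m' /h1[? ? ?]; split; rewrite leq_max; apply/orP; left.
  rewrite /f (lincomb_widen _ (leq_maxl (co u).1 N) h1) (lincomb_widen _ (leq_maxr (co u).1 N) hc).
  by apply: eq_bigr => m _; apply: eq_bigr => m' _; apply: eq_bigr => n _; rewrite e.
exists f; split.
  move=> a u v; have [hu eu] := hco u; have [hv ev] := hco v.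
  set N := maxn (co u).1 (co v).1.
  have hN : supported N (fun m n m' => a * (co u).2 m n m' + (co v).2 m n m').
    move=> m n m'; have [->|/hu[? ? ?]] := eqVneq ((co u).2 m n m') 0.
      by rewrite mulr0 add0r => /hv[? ? ?]; split; rewrite leq_max; apply/orP; right.
    by move=> _; split; rewrite leq_max; apply/orP; left.
  rewrite (fE N _ _ hN).
    rewrite lincombD lincombZ /f.
    by rewrite (lincomb_widen _ (leq_maxl _ (co v).1) hu) (lincomb_widen _ (leq_maxr (co u).1 _) hv).
  rewrite lincombD lincombZ {1}eu {1}ev.
  by rewrite (lincomb_widen _ (leq_maxl _ (co v).1) hu) (lincomb_widen _ (leq_maxr (co u).1 _) hv).
move=> m n m'; have [N [c [h1 _ h3]]] := delta_lincomb m n m'.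
by rewrite (fE _ _ _ h1 (h3 bas)) -h3.
Qed.

End PBW.

(** * Products in weight zero and the basis of A_r *)

Section WeightZero.
Variables (k : closedFieldType) (p : nat).
Hypothesis hchar : p \in [pchar k].
Local Notation U := (hyper k).
Local Notation kb := (kbin k).
Local Notation loc_const := (@loc_const k p).
Local Notation periodic := (@periodic k p).
Local Notation Hfun := (@Hfun k).

(** Structure constants of (Y^(m) f(H) X^(m)) (Y^(n) g(H) X^(n)): the first binomial comes from
    Y^(m) Y^(n-i), the second from X^(m-i) X^(n). [zfun] collects the torus factors moved between
    them. *)
Definition zcoef (m n i : nat) : k := ('C(m + n - i, m) * 'C(m + n - i, n))%:R.
Definition zfun (m n i : nat) (f g : int -> k) (z : int) : k :=
  f (z - 2 * (n - i)%N%:Z) * kb (z + (2 * i%:Z - m%:Z - n%:Z)) i * g (z - 2 * (m - i)%N%:Z).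

Lemma loc_const_zfun m n i f g : loc_const f -> loc_const g -> loc_const (zfun m n i f g).
Proof.
move=> hf hg; apply: loc_constM; last exact: loc_const_shift.
by apply: loc_constM; [exact: loc_const_shift | exact: loc_const_kbin].
Qed.

(* Stated for general families so that it applies both to the divided powers
   [Y^(m)], [X^(m)] and to [Y^(mp)], [X^(mp)]. *)
Lemma weight0_product (Yf Xf : nat -> U) (T : (int -> k) -> int -> k) (b : U) :
  (forall m n, Yf m * Yf n = 'C(m + n, m)%:R *: Yf (m + n)%N) ->
  (forall m n, Xf m * Xf n = 'C(m + n, m)%:R *: Xf (m + n)%N) ->
  (forall f, loc_const f -> loc_const (T f)) ->
  (forall f g z, T (fun z => f z * g z) z = T f z * T g z) ->
  (forall f n, loc_const f ->
     Hfun (T f) * Yf n = Yf n * Hfun (T (fun z => f (z - 2 * n%:Z)))) ->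
  (forall f n, loc_const f ->
     Xf n * Hfun (T f) = Hfun (T (fun z => f (z - 2 * n%:Z))) * Xf n) ->
  (forall f, loc_const f -> Hfun f * b = b * Hfun f) ->
  (forall n, Xf n * b = b * Xf n) ->
  (forall m n, Xf m * Yf n * b = (\sum_(i < m.+1 | (i <= n)%N) Yf (n - i)%N *
     Hfun (T (fun z => kb (z + (2 * i%:Z - m%:Z - n%:Z)) i)) * Xf (m - i)%N) * b) ->
  forall m n f g, loc_const f -> loc_const g ->
  (Yf m * Hfun (T f) * Xf m) * (Yf n * Hfun (T g) * Xf n) * b =
  (\sum_(i < m.+1 | (i <= n)%N) zcoef m n i *:
    (Yf (m + n - i)%N * Hfun (T (zfun m n i f g)) * Xf (m + n - i)%N)) * b.
Proof.
move=> YM XM Tlc TM HY XH bH bX XY m n f g hf hg.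
transitivity (Yf m * Hfun (T f) * (Xf m * Yf n * b) * Hfun (T g) * Xf n).
  rewrite -[RHS]mulrA -!mulrA bX; do 4 congr (_ * _).
  by rewrite mulrA bH ?mulrA //; exact: Tlc.
rewrite XY mulrA mulr_sumr !mulr_suml; apply: eq_bigr => i /= hin.
have him : (i <= m)%N by have := ltn_ord i.
set B := fun z => kb _ _.
have hB : loc_const B by exact: loc_const_kbin.
have hf' : loc_const (fun z => f (z - 2 * (n - i)%N%:Z)) by exact: loc_const_shift.
have hg' : loc_const (fun z => g (z - 2 * (m - i)%N%:Z)) by exact: loc_const_shift.
transitivity (Yf m * (Hfun (T f) * Yf (n - i)%N) * Hfun (T B) *
   (Xf (m - i)%N * Hfun (T g)) * Xf n * b).
  rewrite -!mulrA bX; do 5 congr (_ * _).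
  by rewrite !mulrA bH //; exact: Tlc.
rewrite HY // XH // !mulrA YM -[_ * Xf (m - i)%N * Xf n]mulrA.
have -> : Hfun (T (zfun m n i f g)) =
   Hfun (T (fun z => f (z - 2 * (n - i)%N%:Z))) * Hfun (T B) *
   Hfun (T (fun z => g (z - 2 * (m - i)%N%:Z))).
  rewrite !(HfunM hchar) //; try exact: Tlc; last by apply: loc_constM; exact: Tlc.
  by apply: eq_Hfun => z; rewrite -!TM.
rewrite [Xf _ * Xf n]XM.
have -> : (m + (n - i) = m + n - i)%N by lia.
have -> : (m - i + n = m + n - i)%N by lia.
have -> : 'C(m + n - i, m - i) = 'C(m + n - i, n).
  by rewrite -[in RHS]bin_sub; [congr ('C(_, _)); lia | lia].
by rewrite -!scalerAl -scalerAr -scalerAl scalerA /zcoef natrM !mulrA.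
Qed.

Lemma zprod m n f g : loc_const f -> loc_const g ->
  (divY k m * Hfun f * divX k m) * (divY k n * Hfun g * divX k n) =
  \sum_(i < m.+1 | (i <= n)%N) zcoef m n i *:
    (divY k (m + n - i) * Hfun (zfun m n i f g) * divX k (m + n - i)).
Proof.
move=> hf hg; have := @weight0_product (divY k) (divX k) id 1 _ _ _ _ _ _ _ _ _ m n f g hf hg.
rewrite !mulr1; apply=> //.
- exact: divYM.
- exact: divXM.
- by move=> {}f {}n {}hf; rewrite (Hfun_divY hchar).
- by move=> {}f {}n {}hf; rewrite (divX_Hfun hchar).
- by move=> *; rewrite mulr1 mul1r.
- by move=> *; rewrite mulr1 mul1r.
by move=> {}m {}n; rewrite !mulr1 (divX_divY hchar).
Qed.

Definition diag (m n m' : nat) : Prop := m = m'.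
Definition zbox (r m n m' : nat) : Prop := [/\ m = m', m < p ^ r & n < p ^ r]%N.

Lemma bas_Hfun m n m' : bas k m n m' = divY k m * Hfun (fun z => kb (z + 0) n) * divX k m'.
Proof. by rewrite /bas (Hfun_binH hchar). Qed.

Lemma pbw_diag_Hfun m f : loc_const f -> pbw diag (divY k m * Hfun f * divX k m).
Proof. by move=> [r hr]; apply: (pbw_Hfun hchar hr). Qed.

Lemma pbw_diagMl m f (u : U) : loc_const f -> pbw diag u ->
  pbw diag (divY k m * Hfun f * divX k m * u).
Proof.
move=> hf; apply: (@kspan_linear _ _ _ _ _ (fun u => _ * u)).
  by move=> a x y; rewrite mulrDr scalerAr.
move=> _ [n [l [_ [<- ->]]]].
rewrite bas_Hfun zprod //; last exact: loc_const_kbin.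
apply: kspan_sum => i _; apply: kspanZ; apply: pbw_diag_Hfun.
by apply: loc_const_zfun => //; exact: loc_const_kbin.
Qed.

Lemma pbw_diagM (u v : U) : pbw diag u -> pbw diag v -> pbw diag (u * v).
Proof.
move=> hu hv; move: u hu; apply: (@kspan_linear _ _ _ _ _ (fun u => u * v)).
  by move=> a x y; rewrite mulrDl scalerAl.
move=> _ [n [l [_ [<- ->]]]]; rewrite bas_Hfun; apply: pbw_diagMl => //.
exact: loc_const_kbin.
Qed.

Lemma pbw_diag1 : pbw diag (1 : U).
Proof. by apply: kspan_gen; exists 0%N, 0%N, 0%N; rewrite (bas000 k). Qed.

Lemma hyperA_diag (u : U) : hyperA p u -> pbw diag u.
Proof.
apply; first split; first split.
- exact: pbw_diag1.
- by move=> x y; exact: kspanB.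
- exact: pbw_diagM.
- by move=> c x; exact: kspanZ.
move=> x [i [->|->]].
  by apply: kspan_gen; exists 0%N, (p ^ i)%N, 0%N; rewrite /bas divX0 divY0 mulr1 mul1r.
rewrite -[divY _ _]mulr1; have <- : Hfun (fun=> 1) = 1 by rewrite (Hfun_cst hchar) scale1r.
by apply: pbw_diag_Hfun; exact: loc_const_cst.
Qed.

(** Modulo p this binomial is the leading base-p digit of m, by Lucas. *)
Lemma bin_top_neq0 i m : (p ^ i <= m < p ^ i.+1)%N -> 'C(m, p ^ i)%:R != 0 :> k.
Proof.
elim: i m => [|i IH] m.
  rewrite expn0 expn1 bin1 => /andP[m0 mp]; rewrite -(dvdn_pcharf hchar).
  by apply/negP => /dvdn_leq; lia.
rewrite -kbin_nat [X in kb _ X]expnSr (lucas_mulp hchar) => /andP[h1 h2].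
rewrite divz_nat kbin_nat; apply: IH.
by rewrite leq_divRL ?ltn_divLR ?(p_gt0 hchar) // -!expnSr h1.
Qed.

Lemma top_power m : (0 < m)%N -> exists i, (p ^ i <= m < p ^ i.+1)%N.
Proof.
move=> m0; exists (trunc_log p m).
by apply: trunc_log_bounds => //; exact: prime_gt1 (pcharf_prime hchar).
Qed.

Lemma kbin_mul1 z n : kb z 1 * kb z n = n.+1%:R * kb z n.+1 + n%:R * kb z n.
Proof.
have h : z * binz z n = n.+1%:Z * binz z n.+1 + n%:Z * binz z n.
  have := congr1 (fun P => P.[(z%:~R : rat)]) (binp_succ (rat : numFieldType) 0 n).
  rewrite hornerZ hornerM !horner_binp addr0 hornerD hornerX.
  have -> : ((0 - n%:Z)%:~R : {poly rat}).[z%:~R] = (- n%:Z)%:~R.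
    by rewrite sub0r -[in LHS](rmorph_int (@polyC rat)) hornerC.
  rewrite -intrD pmulrn -!intrM => /eqP; rewrite eqr_int => /eqP ->; ring.
have -> : kb z 1 = z%:~R.
  rewrite /kbin; congr _%:~R; case: z {h} => n' /=; first by rewrite bin1.
  by rewrite expr1 addn1 bin1 mulN1r NegzE.
by rewrite /kbin -intrM h intrD !intrM -!pmulrn.
Qed.

(** Lucas reduces the identity to i = 0, where it reads z binom(z, n-1) = n binom(z, n) + (n - 1)
    binom(z, n-1). It isolates binom(z, n) with a coefficient that is nonzero by [bin_top_neq0]. *)
Lemma kbin_top i n z : (p ^ i <= n < p ^ i.+1)%N ->
  kb z (p ^ i) * kb z (n - p ^ i) =
  'C(n, p ^ i)%:R * kb z n + ('C(n, p ^ i)%:R - 1) * kb z (n - p ^ i).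
Proof.
elim: i n z => [|i IH] n z.
  case: n => // n _; rewrite expn0 subn1 /= kbin_mul1 bin1.
  by rewrite -natr1 addrK.
move=> /andP[h1 h2].
have p0 := p_gt0 hchar.
have e : (n - p ^ i.+1 = (n %/ p - p ^ i) * p + n %% p)%N.
  have h : (p ^ i.+1 <= n %/ p * p)%N by rewrite expnSr leq_mul2r leq_divRL // -expnSr h1 orbT.
  by rewrite mulnBl -expnSr; have := divn_eq n p; lia.
have nm : (n %% p < p)%N by rewrite ltn_mod.
rewrite e (lucas_split hchar _ _ nm) [X in kb _ X]expnSr (lucas_mulp hchar).
rewrite -[in RHS](kbin_nat k n) [X in kb n X]expnSr (lucas_mulp hchar) divz_nat kbin_nat.
rewrite (lucas hchar z n) mulrA IH; first ring.
by rewrite leq_divRL ?ltn_divLR // -!expnSr h1.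
Qed.

Section Subalgebra.
Variable S : set U.
Hypothesis S_alg : subalgebra S.

Lemma algM x y : S x -> S y -> S (x * y).
Proof. by case: S_alg => -[_ _ h] _; exact: h. Qed.
Lemma algB x y : S x -> S y -> S (x - y).
Proof. by case: S_alg => -[_ h _] _; exact: h. Qed.
Lemma algZ (c : k) x : S x -> S (c *: x).
Proof. by case: S_alg => _; exact. Qed.
Lemma alg1 : S 1.
Proof. by case: S_alg => -[]. Qed.
Lemma alg0 : S 0.
Proof. by rewrite -(subrr 1); apply: algB; exact: alg1. Qed.
Lemma algD x y : S x -> S y -> S (x + y).
Proof.
move=> hx hy; rewrite -[y]opprK; apply: algB => //.
by rewrite -scaleN1r; exact: algZ.
Qed.
Lemma alg_sum (I : Type) (s : seq I) (P : pred I) (F : I -> U) :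
  (forall i, P i -> S (F i)) -> S (\sum_(i <- s | P i) F i).
Proof. by move=> h; elim/big_ind: _ => //; [exact: alg0 | exact: algD]. Qed.
Lemma alg_unscale (c : k) x : c != 0 -> S (c *: x) -> S x.
Proof. by move=> c0 /(algZ c^-1); rewrite scalerA mulVf // scale1r. Qed.
Lemma alg_kspan (E : U -> Prop) x : (forall y, E y -> S y) -> kspan E x -> S x.
Proof.
by move=> h hx; apply: hx => //; [exact: alg0 | exact: algD | exact: algZ].
Qed.

(** Strip the leading digit: F(p^i) F(m - p^i) is F(m) times the nonzero number ['C(m, p ^ i)]. *)
Lemma alg_divided (F : nat -> U) N : F 0%N = 1 ->
  (forall m n, F m * F n = 'C(m + n, m)%:R *: F (m + n)%N) ->
  (forall i, (p ^ i < N)%N -> S (F (p ^ i)%N)) -> forall m, (m < N)%N -> S (F m).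
Proof.
move=> F0 FM Fp; elim/ltn_ind => -[|m] IH mN; first by rewrite F0; exact: alg1.
have [i hi] := top_power (ltn0Sn m); have /andP[hi1 hi2] := hi.
apply: (alg_unscale (bin_top_neq0 hi)); rewrite -{2}(subnKC hi1) -{1}(subnKC hi1) -FM.
apply: algM; first by apply: Fp; lia.
by have := expn_p_gt0 hchar i; move=> ?; apply: IH; lia.
Qed.

Lemma alg_Hfun r f : (forall n, (n < p ^ r)%N -> S (binH k 0 n)) -> periodic r f ->
  S (Hfun f).
Proof.
move=> h /(periodic_hval hchar)[c hc]; rewrite -(Hfun_eq hchar hc).
by apply: alg_sum => i _; apply: algZ; exact: h.
Qed.

Lemma alg_loc_const f : (forall n, S (binH k 0 n)) -> loc_const f -> S (Hfun f).
Proof. by move=> h [r hr]; exact: alg_Hfun hr. Qed.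

End Subalgebra.

Lemma hyperA_alg : subalgebra (hyperA p : set U).
Proof. by split; [exact: subalg_genP | move=> c x hx S hS hE; case: (hS) => _; apply; exact: hx]. Qed.

Lemma hyper_trunc_alg r : subalgebra (hyper_trunc p r : set U).
Proof. by split; [exact: subalg_genP | move=> c x hx S hS hE; case: (hS) => _; apply; exact: hx]. Qed.

Lemma hyperA_binH n : hyperA p (binH k 0 n).
Proof.
elim/ltn_ind: n => -[|n] IH.
  by rewrite binH_binp binp0 rmorph1 to_hyper1; exact: alg1 hyperA_alg.
have [i hi] := top_power (ltn0Sn n); have /andP[hi1 hi2] := hi.
apply: (alg_unscale hyperA_alg (bin_top_neq0 hi)).
have hI : hyperA p (binH k 0 (n.+1 - p ^ i)).
  by have := expn_p_gt0 hchar i; move=> ?; apply: IH; lia.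
have e : 'C(n.+1, p ^ i)%:R *: binH k 0 n.+1 = binH k 0 (p ^ i) * binH k 0 (n.+1 - p ^ i) -
    ('C(n.+1, p ^ i)%:R - 1) *: binH k 0 (n.+1 - p ^ i).
  apply/eqP; rewrite -subr_eq0 opprB addrA -scaleN1r; apply/eqP.
  have H c m := hval_binH k c m.
  apply: hval_eq0 (hvalD (hvalD (hvalZ _ (H _ _)) (hvalZ _ (H _ _)))
     (hvalZ (-1) (hvalM (H _ _) (H _ _)))) _ => z.
  by rewrite !addr0 kbin_top // mulN1r subrr.
rewrite e; apply: (algB hyperA_alg); last exact: (algZ hyperA_alg).
apply: (algM hyperA_alg) => //.
by move=> S hS; apply; exists i; left.
Qed.

(** With p^i the leading power of n + 1, the product of the terms of index p^i and n + 1 - p^i has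
    leading coefficient ['C(n.+1, p ^ i)] squared, which is nonzero; its other terms have smaller
    index and lie in the algebra by induction. *)
Lemma hyperA_YX m : hyperA p (divY k m * divX k m).
Proof.
elim/ltn_ind: m => -[|n] IH.
  by rewrite divX0 divY0 mulr1; exact: alg1 hyperA_alg.
have [i hi] := top_power (ltn0Sn n); have /andP[hi1 hi2] := hi.
have hI q : (q < n.+1)%N -> forall f, loc_const f -> hyperA p (divY k q * Hfun f * divX k q).
  move=> qn f hf; rewrite -mulrA (Hfun_divX hchar) // mulrA; apply: (algM hyperA_alg); first exact: IH.
  apply: (alg_loc_const hyperA_alg); [exact: hyperA_binH | exact: loc_const_shift].
have h1 : Hfun (fun=> 1) = 1 :> U by rewrite (Hfun_cst hchar) scale1r.
have lc1 : loc_const (fun=> 1) by exact: loc_const_cst.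
have := zprod (p ^ i) (n.+1 - p ^ i) lc1 lc1.
rewrite !h1 !mulr1 (bigD1 ord0) //= => e.
have pi0 := expn_p_gt0 hchar i.
have hp : hyperA p (divY k (p ^ i) * divX k (p ^ i)) by move=> S hS; apply; exists i; right.
have hl : hyperA p (zcoef (p ^ i) (n.+1 - p ^ i) 0 *:
    (divY k n.+1 * Hfun (zfun (p ^ i) (n.+1 - p ^ i) 0 (fun=> 1) (fun=> 1)) * divX k n.+1)).
  move: e; rewrite subnKC // subn0 => /eqP; rewrite -subr_eq => /eqP <-.
  apply: (algB hyperA_alg); first by apply: (algM hyperA_alg) => //; apply: IH; lia.
  apply: (alg_sum hyperA_alg) => j /andP[hj1 hj2]; apply: (algZ hyperA_alg); apply: hI.
    have : (0 < j)%N by rewrite lt0n; move: hj2; rewrite -(inj_eq val_inj).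
    lia.
  exact: loc_const_zfun.
have z0 : zcoef (p ^ i) (n.+1 - p ^ i) 0 != 0.
  rewrite /zcoef subnKC // subn0 bin_sub // natrM mulf_neq0 //; exact: bin_top_neq0.
move: (alg_unscale hyperA_alg z0 hl).
rewrite (_ : Hfun _ = 1) ?mulr1 // -h1; apply: eq_Hfun => z.
by rewrite /zfun kbin0 !mulr1.
Qed.

Lemma binH_expansion c m : exists a : nat -> k, binH k c m = \sum_(j < m.+1) a j *: binH k 0 j.
Proof.
have [n|z e] := newton_expansion (size_binp ((Rdefinitions.R)[i]%C : numFieldType) c m).
  by exists (binz (n%:Z + c) m); rewrite -horner_binp.
exists (fun j => (z j)%:~R); rewrite binH_binp e rmorph_sum /= to_hyper_sum => [|j _].
  apply: eq_bigr => j _; rewrite -mul_polyC rmorphM /= horner_algC mulr_algl.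
  by rewrite to_hyper_int ?binH_binp //; exact: UZ_binp.
rewrite -mul_polyC rmorphM /= horner_algC mulr_algl; apply: UZ_int.
exact: UZ_binp.
Qed.

Lemma hyper_trunc_divX r m : (m < p ^ r)%N -> hyper_trunc p r (divX k m).
Proof.
apply: (alg_divided (hyper_trunc_alg r) (divX0 k) (divXM k)) => i.
rewrite ltn_exp2l ?prime_gt1 ?(pcharf_prime hchar) // => ir.
by move=> S hS; apply; exists i; split=> //; left.
Qed.

Lemma hyper_trunc_divY r m : (m < p ^ r)%N -> hyper_trunc p r (divY k m).
Proof.
apply: (alg_divided (hyper_trunc_alg r) (divY0 k) (divYM k)) => i.
rewrite ltn_exp2l ?prime_gt1 ?(pcharf_prime hchar) // => ir.
by move=> S hS; apply; exists i; split=> //; right.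
Qed.

(** As over the integers, binom(H, n) is the last term in the expansion of X^(n) Y^(n), and the
    other terms involve smaller indices. *)
Lemma hyper_trunc_binH r n : (n < p ^ r)%N -> hyper_trunc p r (binH k 0 n).
Proof.
elim/ltn_ind: n => n IH nr.
have A := hyper_trunc_alg r.
have := divX_divY hchar n n; rewrite (bigD1 ord_max) //= subnn divX0 divY0 mulr1 mul1r.
have -> : 2 * n%:Z - n%:Z - n%:Z = 0 by lia.
rewrite -(Hfun_binH hchar) => /eqP; rewrite -subr_eq => /eqP <-.
apply: (algB A); first by apply: (algM A); [exact: hyper_trunc_divX | exact: hyper_trunc_divY].
apply: (alg_sum A) => i /andP[_]; rewrite -(inj_eq val_inj) /= => hi.
have im : (i < n)%N by have := ltn_ord i; lia.
apply: (algM A); last by apply: hyper_trunc_divX; lia.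
apply: (algM A); first by apply: hyper_trunc_divY; lia.
rewrite -(Hfun_binH hchar); have [a ->] := binH_expansion (2 * i%:Z - n%:Z - n%:Z) i.
by apply: (alg_sum A) => j _; apply: (algZ A); apply: IH; have := ltn_ord j; lia.
Qed.

(** The first algebra confines the support to m = m', the second to indices below p^r, and [pbwI]
    combines the two. Conversely each such basis element lies in both. *)
Lemma ArP r (u : U) : Ar_set p r u <-> pbw (zbox r) u.
Proof.
split.
  move=> [/hyperA_diag h1 /(hyper_trunc_pbw hchar) h2].
  have := pbwI hchar h1 h2; apply: pbw_sub => m n m' [mm' []].
  by rewrite /zbox.
move=> hu; split.
  apply: (alg_kspan hyperA_alg _ hu) => _ [m [n [_ [[<- hm hn] ->]]]].
  rewrite bas_Hfun -mulrA (Hfun_divX hchar); last exact: loc_const_kbin.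
  rewrite mulrA; apply: (algM hyperA_alg); first exact: hyperA_YX.
  apply: (alg_loc_const hyperA_alg); first exact: hyperA_binH.
  by apply: (@loc_const_shift _ _ (fun z => kb (z + 0) n)); exact: loc_const_kbin.
apply: (alg_kspan (hyper_trunc_alg r) _ hu) => _ [m [n [_ [[<- hm hn] ->]]]].
apply: (algM (hyper_trunc_alg r)); last exact: hyper_trunc_divX.
by apply: (algM (hyper_trunc_alg r)); [exact: hyper_trunc_divY | exact: hyper_trunc_binH].
Qed.

End WeightZero.

(** Positive indices are counted downwards from the next multiple of p, because Y^(np-K) with K =
    (i+1)p - s then splits off Y^(s). *)
Lemma sum_blocks (V : zmodType) (F : nat -> V) (p M : nat) :
  \sum_(K < (M * p).+1) F K = F 0%N + \sum_(i < M) \sum_(s < p) F (i.+1 * p - s)%N.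
Proof.
elim: M => [|M IH]; first by rewrite mul0n big_ord1 big_ord0 addr0.
rewrite [X in _ + X]big_ord_recr /= addrA -IH -(big_mkord xpredT F) -(big_mkord xpredT F).
rewrite (@big_cat_nat _ _ _ (M * p).+1) //=; last by rewrite mulSn; lia.
congr (_ + _); rewrite -{1}[(M * p).+1]add0n big_addn.
have -> : ((M.+1 * p).+1 - (M * p).+1 = p)%N by rewrite mulSn; lia.
rewrite big_mkord (reindex_inj rev_ord_inj) /=; apply: eq_bigr => s _; congr F.
by rewrite mulSn; have := ltn_ord s; lia.
Qed.

Lemma sum_guard (V : zmodType) (F : nat -> V) (m n : nat) :
  \sum_(i < m.+1 | (i <= n)%N) F i = \sum_(i < (minn m n).+1) F i.
Proof.
have h : ((minn m n).+1 <= m.+1)%N by rewrite ltnS geq_minl.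
rewrite [RHS](big_ord_widen m.+1 F h); apply: eq_bigl => i.
by rewrite ltnS leq_min (leq_ord i).
Qed.

Lemma linear_comb (k : fieldType) (V V' : lmodType k) (f : V -> V') n
    (c : 'I_n -> k) (v : 'I_n -> V) : linear f ->
  f (\sum_i c i *: v i) = \sum_i c i *: f (v i).
Proof.
move=> lf; have f0 : f 0 = 0.
  by have := lf (-1) 0 0; rewrite scaleN1r oppr0 addr0 scaleN1r addNr.
apply: (big_rec2 (fun x y => f x = y)) => // i y x _ <-.
exact: lf.
Qed.

(** * Lifts of the Frobenius *)

Section FrobeniusLift.
Variables (k : closedFieldType) (p : nat).
Hypothesis hchar : p \in [pchar k].
Local Notation U := (hyper k).
Local Notation kb := (kbin k).
Local Notation loc_const := (@loc_const k p).
Local Notation periodic := (@periodic k p).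
Local Notation Hfun := (@Hfun k).
Let p0 : (0 < p)%N. Proof. exact: p_gt0 hchar. Qed.

(* For [d = 0] this is Fr'; for [d = 1] the torus part is shifted by [p]. *)
Definition phi (d : int) : U -> U :=
  sval (cid (linear_extension hchar (fun m n m' =>
    divY k (m * p) * Hfun (fun z => kb ((z %/ p)%Z + d) n) * divX k (m' * p)))).

Lemma phi_linear d : linear (phi d).
Proof. by rewrite /phi; case: cid => f []. Qed.

Lemma phi_bas d m n m' : phi d (bas k m n m') =
  divY k (m * p) * Hfun (fun z => kb ((z %/ p)%Z + d) n) * divX k (m' * p).
Proof. by rewrite /phi; case: cid => f []. Qed.

Lemma loc_const_kbin0 n : loc_const (kb^~ n).
Proof. by have [r hr] := loc_const_kbin hchar 0 n; exists r => z; have := hr z; rewrite !addr0. Qed.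

Lemma phi_Hfun d m m' f : loc_const f -> phi d (divY k m * Hfun f * divX k m') =
  divY k (m * p) * Hfun (fun z => f ((z %/ p)%Z + d)) * divX k (m' * p).
Proof.
move=> [r /(periodic_expansion hchar)[c hc]].
have -> : Hfun f = \sum_(i < p ^ r) c i *: binH k 0 i.
  by symmetry; apply: (Hfun_eq hchar); exists (p ^ r)%N, c.
rewrite mulr_sumr mulr_suml.
rewrite (eq_bigr (fun i : 'I_(p ^ r) => c i *: bas k m i m')); last first.
  by move=> i _; rewrite -scalerAr -scalerAl.
rewrite (linear_comb _ _ (@phi_linear d)).
have -> : Hfun (fun z => f ((z %/ p)%Z + d)) =
    \sum_(i < p ^ r) c i *: Hfun (fun z => kb ((z %/ p)%Z + d) i).
  symmetry; apply: (Hfun_eq hchar).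
  apply: (@hval_eq _ _ (fun z => \sum_(i < p ^ r) c i * kb ((z %/ p)%Z + d) i)).
    apply: hval_sum => i _; apply: hvalZ; apply: (HfunP hchar).
    exact: loc_const_divp (loc_const_kbin0 i).
  by move=> z; rewrite hc.
rewrite mulr_sumr mulr_suml; apply: eq_bigr => i _.
by rewrite phi_bas -scalerAr -scalerAl.
Qed.

Lemma linear_ext (V : lmodType k) (f g : U -> V) : linear f -> linear g ->
  (forall m n m', f (bas k m n m') = g (bas k m n m')) -> f =1 g.
Proof.
move=> lf lg h u; apply: (kspan_eq lf lg _ (pbw_all hchar u)).
by move=> _ [m [n [m' [_ ->]]]].
Qed.

(** [linear_extension] shows that the choice in [Fr'] is inhabited, and values on the basis
    determine a linear map. The two agree on it since binom(z, np) = binom(floor(z/p), n) in [k]. *)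
Lemma Fr'_phi : @Fr' k p =1 phi 0.
Proof.
have [g hg] := linear_extension hchar (fun m n m' =>
  divY k (m * p) * binH k 0 (n * p) * divX k (m' * p)).
have [lf hf] : is_Fr' p (@Fr' k p) by rewrite /Fr'; case: xgetP => [f _ //|/(_ g hg)].
apply: linear_ext => //; first exact: phi_linear.
move=> m n m'; rewrite phi_bas [LHS]hf (Hfun_binH hchar).
by congr (_ * _ * _); apply: eq_Hfun => z; rewrite !addr0 (lucas_mulp hchar).
Qed.

(** Commutation with the torus part and with X^(mp), Y^(mp), hence with everything in the image of
    [phi]. The elements B of a single label will have this property. *)
Definition central1 (b : U) : Prop :=
  [/\ forall m, divX k (m * p) * b = b * divX k (m * p),
      forall m, divY k (m * p) * b = b * divY k (m * p) &
      forall f, loc_const f -> Hfun f * b = b * Hfun f].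

Lemma central1_cst (a : k) : central1 a%:A.
Proof. by split=> [m|m|f _]; rewrite mulr_algr mulr_algl. Qed.

Lemma central1D b c : central1 b -> central1 c -> central1 (b + c).
Proof.
move=> [b1 b2 b3] [c1 c2 c3].
by split=> [m|m|f hf]; rewrite mulrDr mulrDl ?b1 ?b2 ?b3 ?c1 ?c2 ?c3.
Qed.

Lemma central1M b c : central1 b -> central1 c -> central1 (b * c).
Proof.
move=> [b1 b2 b3] [c1 c2 c3].
by split=> [m|m|f hf]; rewrite mulrA ?b1 ?b2 ?b3 // -!mulrA ?c1 ?c2 ?c3.
Qed.

Lemma central1Z (a : k) b : central1 b -> central1 (a *: b).
Proof. by move=> hb; rewrite -mulr_algl; apply: central1M => //; exact: central1_cst. Qed.

Lemma central1_residue f : periodic 1 f -> central1 (Hfun f).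
Proof.
move=> hf; have lf : loc_const f by exists 1%N.
have sh c z : f (z + p%:Z * c) = f z.
  by have := periodic_mul z c hf; rewrite expn1.
split=> [m|m|g hg]; last by rewrite (Hfun_comm hchar).
  rewrite (divX_Hfun hchar) //; congr (_ * _); apply: eq_Hfun => z.
  by rewrite -[RHS](sh (- (2 * m%:Z))) PoszM; congr f; ring.
rewrite (divY_Hfun hchar) //; congr (_ * _); apply: eq_Hfun => z.
by rewrite -[RHS](sh (2 * m%:Z)) PoszM; congr f; ring.
Qed.

Lemma natr_mulp m : (m * p)%:R = 0 :> k.
Proof. by rewrite natrM (pcharf0 hchar) mulr0. Qed.

Definition casYX : U := hY k * hX k.

Lemma Hfun_kbin0 c : Hfun (fun z => kb (z + c) 0) = 1.
Proof.
by rewrite -[RHS]scale1r -(Hfun_cst hchar); apply: eq_Hfun => z; rewrite kbin0.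
Qed.

Lemma divX_hY s : divX k s.+1 * hY k =
  hY k * divX k s.+1 + Hfun (fun z => kb (z + (- s%:Z)) 1) * divX k s.
Proof.
rewrite -divY1 (divX_divY hchar) (sum_guard (fun i => divY k (1 - i) *
  Hfun (fun z => kb (z + (2 * i%:Z - s.+1%:Z - 1%:Z)) i) * divX k (s.+1 - i)) s.+1 1).
rewrite (_ : (minn s.+1 1).+1 = 2%N) ?big_ord_recl ?big_ord0 /=; last by rewrite minnSS minn0.
rewrite /bump /= addn0 subnn !subn0 subn1 /= divY0 mul1r addr0 Hfun_kbin0 mulr1.
by congr (_ + _ * _); apply: eq_Hfun => z; congr kbin; lia.
Qed.

Lemma hX_divY s : hX k * divY k s.+1 =
  divY k s.+1 * hX k + divY k s * Hfun (fun z => kb (z + (- s%:Z)) 1).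
Proof.
rewrite -divX1 (divX_divY hchar) (sum_guard (fun i => divY k (s.+1 - i) *
  Hfun (fun z => kb (z + (2 * i%:Z - 1%:Z - s.+1%:Z)) i) * divX k (1 - i)) 1 s.+1).
rewrite (_ : (minn 1 s.+1).+1 = 2%N) ?big_ord_recl ?big_ord0 /=; last by rewrite minnSS min0n.
rewrite /bump /= addn0 subnn !subn0 subn1 /= divX0 mulr1 addr0 Hfun_kbin0 mulr1.
by congr (_ + _ * _); apply: eq_Hfun => z; congr kbin; lia.
Qed.

Lemma divX_hX s : divX k s * hX k = s.+1%:R *: divX k s.+1.
Proof. by rewrite -divX1 divXM addn1 binSn. Qed.
Lemma hX_divX s : hX k * divX k s = s.+1%:R *: divX k s.+1.
Proof. by rewrite -divX1 divXM add1n bin1. Qed.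
Lemma divY_hY s : divY k s * hY k = s.+1%:R *: divY k s.+1.
Proof. by rewrite -divY1 divYM addn1 binSn. Qed.
Lemma hY_divY s : hY k * divY k s = s.+1%:R *: divY k s.+1.
Proof. by rewrite -divY1 divYM add1n bin1. Qed.

Lemma YX_divX s : casYX * divX k s =
  divX k s * casYX - s%:R *: (divX k s * Hfun (fun z => kb (z + (s%:Z + 1)) 1)).
Proof.
case: s => [|s]; first by rewrite divX0 mulr1 mul1r scale0r subr0.
rewrite /casYX mulrA divX_hY mulrDl -!mulrA hX_divX !divX_hX.
rewrite -!scalerAr addrAC -[LHS]addr0 -addrA; congr (_ + _).
rewrite (divX_Hfun hchar); last exact: loc_const_kbin.
apply/esym/eqP; rewrite addrC subr_eq0; apply/eqP; congr (_ *: (_ * _)).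
by apply: eq_Hfun => z; congr kbin; lia.
Qed.

Lemma YX_divY s : divY k s * casYX = casYX * divY k s -
  s%:R *: (Hfun (fun z => kb (z + (s%:Z + 1)) 1) * divY k s).
Proof.
case: s => [|s]; first by rewrite divY0 mulr1 mul1r scale0r subr0.
rewrite /casYX -mulrA hX_divY mulrDr !mulrA !hY_divY divY_hY.
rewrite -!scalerAl addrAC -[LHS]addr0 -addrA; congr (_ + _).
rewrite (divY_Hfun hchar); last exact: loc_const_kbin.
apply/esym/eqP; rewrite addrC subr_eq0; apply/eqP; congr (_ *: (_ * _)).
by apply: eq_Hfun => z; congr kbin; lia.
Qed.

(** The commutators of YX with X^(s) and with Y^(s) carry a factor s, which is zero in [k] for s =
    mp. *)
Lemma central1_YX : central1 casYX.
Proof.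
split=> [m|m|f hf].
- by rewrite YX_divX natr_mulp scale0r subr0.
- by rewrite YX_divY natr_mulp scale0r subr0.
rewrite /casYX -divX1 -divY1 mulrA (Hfun_divY hchar) // -!mulrA; congr (_ * _).
rewrite (divX_Hfun hchar) //.
Qed.

(** On a fixed residue class of weights H is a scalar, so this recursion turns Y^(s) X^(s) into a
    product of linear factors in YX. *)
Lemma YX_step s : divY k s * divX k s *
    (casYX - s%:R *: Hfun (fun z => kb (z + (s%:Z + 1)) 1)) =
  (s.+1%:R * s.+1%:R) *: (divY k s.+1 * divX k s.+1).
Proof.
rewrite mulrBr -scalerAr -!mulrA scalerAr -mulrBr -YX_divX /casYX.
by rewrite !mulrA divY_hY -!mulrA hX_divX -scalerAl -scalerAr scalerA.
Qed.

Lemma XY_step s : divX k s * divY k s *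
    (casYX + s.+1%:R *: Hfun (fun z => kb (z + (- s%:Z)) 1)) =
  (s.+1%:R * s.+1%:R) *: (divX k s.+1 * divY k s.+1).
Proof.
have : hX k * hY k * divY k s = divY k s * casYX +
    s.+1%:R *: (divY k s * Hfun (fun z => kb (z + (- s%:Z)) 1)).
  by rewrite -mulrA hY_divY -scalerAr hX_divY scalerDr /casYX [in RHS]mulrA divY_hY scalerAl.
rewrite scalerAr -mulrDr => e.
rewrite -mulrA -e !mulrA divX_hX -!mulrA hY_divY -scalerAl -!scalerAr scalerA.
by [].
Qed.

Lemma natS_lt_neq0 s : (s < p)%N -> (0 < s)%N -> s%:R != 0 :> k.
Proof.
by move=> sp s0; rewrite -(dvdn_pcharf hchar); apply/negP => /dvdn_leq; lia.
Qed.

Lemma central1_YXs s : (s < p)%N -> central1 (divY k s * divX k s).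
Proof.
elim: s => [|s IH] sp.
  by rewrite divX0 divY0 mulr1 -[1]scale1r; exact: central1_cst.
have n0 := natS_lt_neq0 sp (ltn0Sn s).
have -> : divY k s.+1 * divX k s.+1 = (s.+1%:R * s.+1%:R)^-1 *:
    (divY k s * divX k s * (casYX - s%:R *: Hfun (fun z => kb (z + (s%:Z + 1)) 1))).
  by rewrite YX_step scalerA mulVf ?scale1r // mulf_neq0.
apply: central1Z; apply: central1M; first by apply: IH; lia.
apply: central1D; first exact: central1_YX.
rewrite -scaleN1r; do 2 apply: central1Z; apply: central1_residue.
by apply: periodic_kbin => //; rewrite expn1 prime_gt1 ?(pcharf_prime hchar).
Qed.

Definition ind (a : nat) (z : int) : k := (`|(z %% p)%Z|%N == a)%:R.
Definition muH (a : nat) : U := Hfun (ind a).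

Lemma ind_periodic a : periodic 1 (ind a).
Proof. by move=> z; rewrite /ind expn1 modzDr. Qed.

Lemma loc_const_ind a : loc_const (ind a).
Proof. by exists 1%N; exact: ind_periodic. Qed.

Lemma mu_muH a : (a < p)%N -> mu_ k p a = muH a.
Proof.
move=> ap; rewrite /mu_ (Hfun_binH hchar); apply: eq_Hfun => z.
rewrite (lucas hchar) divn_small ?prednK // modn_small ?prednK // kbin0 mul1r /ind.
have pz := pz_neq0 hchar; have P0 : (0 < p%:Z)%R by [].
set y := (z + _)%R; have ey : y = z - a%:Z - 1 by rewrite /y; lia.
have [r rp er] : exists2 r : nat, (r < p)%N & (z %% p)%Z = r%:Z.
  exists `|(z %% p)%Z|%N; last by rewrite gez0_abs ?modz_ge0.
  by have := ltz_pmod z P0; have := modz_ge0 z pz; lia.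
have ez := divz_eq z p; rewrite er in ez *.
rewrite /= -[`|_|%N]/(absz _).
have [ra|ra|ra] := ltngtP r a.
- have -> : (y %% p)%Z = (r + p - a - 1)%N%:Z.
    have -> : y = ((z %/ p)%Z - 1) * p%:Z + (r + p - a - 1)%N%:Z by rewrite ey {1}ez; lia.
    by rewrite modzMDl modz_small //; lia.
  by rewrite /= bin_small //; lia.
- have -> : (y %% p)%Z = (r - a - 1)%N%:Z.
    have -> : y = (z %/ p)%Z * p%:Z + (r - a - 1)%N%:Z by rewrite ey {1}ez; lia.
    by rewrite modzMDl modz_small //; lia.
  by rewrite /= bin_small //; lia.
have -> : (y %% p)%Z = (p.-1)%:Z.
  have -> : y = ((z %/ p)%Z - 1) * p%:Z + (p.-1)%:Z by rewrite ey {1}ez ra; lia.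
  by rewrite modzMDl modz_small //; lia.
by rewrite /= binn.
Qed.

Lemma central1_muH a : central1 (muH a).
Proof. exact/central1_residue/ind_periodic. Qed.

Lemma Hfun_muH a f g : loc_const f -> loc_const g ->
  (forall z, `|(z %% p)%Z|%N = a -> f z = g z) -> Hfun f * muH a = Hfun g * muH a.
Proof.
move=> hf hg h; rewrite !(HfunM hchar) //; try exact: loc_const_ind.
apply: eq_Hfun => z; rewrite /ind; case: eqP => [/h ->//|_]; by rewrite !mulr0.
Qed.

Lemma muH_idem a : muH a * muH a = muH a.
Proof.
rewrite (HfunM hchar); try exact: loc_const_ind.
by apply: eq_Hfun => z; rewrite /ind; case: eqP; rewrite ?mulr1 ?mulr0.
Qed.

End FrobeniusLift.

Section FrobeniusProduct.
Variables (k : closedFieldType) (p : nat).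
Hypothesis hchar : p \in [pchar k].
Local Notation U := (hyper k).
Local Notation kb := (kbin k).
Local Notation loc_const := (@loc_const k p).
Local Notation Hfun := (@Hfun k).
Local Notation central1 := (@central1 k p).
Let p0 : (0 < p)%N. Proof. exact: p_gt0 hchar. Qed.

(* The part of X^(p) Y^(p) - Y^(p) X^(p) - binom(H, p) lying in U_1, on weights
   congruent to [a] modulo [p]. *)
Definition YXdefect (a : nat) : U :=
  \sum_(s < p.-1) 'C(a, p - s.+1)%:R *: (divY k s.+1 * divX k s.+1).

Lemma bin_mulp (m n : nat) : 'C((m + n) * p, m * p)%:R = 'C(m + n, m)%:R :> k.
Proof. by rewrite -kbin_nat (lucas_mulp hchar) divz_nat mulnK // kbin_nat. Qed.

Lemma bin_mulp_add (m s : nat) : (s < p)%N -> 'C(m * p + s, s)%:R = 1 :> k.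
Proof.
move=> sp; rewrite -kbin_nat -{2}[s]add0n -{1}[0%N](mul0n p) (lucas_split hchar) //.
by rewrite kbin0 mul1r modz_nat /= modnMDl modn_small // binn.
Qed.

Lemma divY_split m s : (s < p)%N -> divY k (m * p + s) = divY k (m * p) * divY k s.
Proof.
move=> sp; rewrite divYM.
have -> : 'C(m * p + s, m * p) = 'C(m * p + s, s) by rewrite -[RHS]bin_sub ?leq_addl // addnK.
by rewrite bin_mulp_add // scale1r.
Qed.

Lemma divX_split m s : (s < p)%N -> divX k (m * p + s) = divX k s * divX k (m * p).
Proof. by move=> sp; rewrite divXM [(s + _)%N]addnC bin_mulp_add // scale1r. Qed.

Lemma divp_shift z (c : int) : ((z + p%:Z * c) %/ p)%Z = (z %/ p)%Z + c.
Proof. by rewrite addrC mulrC divzMDl ?(pz_neq0 hchar) // addrC. Qed.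

Lemma modp_shift z (c : int) : ((z + p%:Z * c) %% p)%Z = (z %% p)%Z.
Proof. by rewrite addrC mulrC modzMDl. Qed.

Section Block.
Variables (a : nat) (d : bool) (b : U).
Hypothesis a_lt : (a < p)%N.
Hypothesis b_central : central1 b.
Hypothesis b_mu : muH k p a * b = b.
Hypothesis b_defect : YXdefect a * b = d%:R *: b.

Let T (f : int -> k) (z : int) := f ((z %/ p)%Z + d%:Z).

Lemma loc_const_T f : loc_const f -> loc_const (T f).
Proof. exact: loc_const_divp. Qed.

Lemma Hfun_residue_b t : (t < p)%N ->
  Hfun (fun z => 'C(`|(z %% p)%Z|%N, t)%:R) * b = 'C(a, t)%:R *: b.
Proof.
move=> tp; rewrite -{1}b_mu mulrA.
have lr : loc_const (fun z => 'C(`|(z %% p)%Z|%N, t)%:R).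
  by exists 1%N => z; rewrite expn1 modzDr.
rewrite (@Hfun_muH _ _ hchar a _ (fun=> 'C(a, t)%:R) lr) => [||z ->//].
  by rewrite (Hfun_cst hchar) -mulrA b_mu mulr_algl.
exact: loc_const_cst.
Qed.

(* Group the summands Y^(np-K) _ X^(mp-K) by [i = ceil (K / p)]: the ones with
   [K] not divisible by [p] recombine into the defect. *)
Lemma divXp_divYp m n : divX k (m * p) * divY k (n * p) * b =
  (\sum_(i < m.+1 | (i <= n)%N) divY k ((n - i) * p) *
     Hfun (T (fun z => kb (z + (2 * i%:Z - m%:Z - n%:Z)) i)) * divX k ((m - i) * p)) * b.
Proof.
rewrite (divX_divY hchar).
pose F K := divY k (n * p - K) *
  Hfun (fun z => kb (z + (2 * K%:Z - (m * p)%N%:Z - (n * p)%N%:Z)) K) * divX k (m * p - K).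
pose c (i : nat) : int := 2 * i%:Z - m%:Z - n%:Z.
pose G i := divY k ((n - i) * p) * Hfun (T (fun z => kb (z + c i) i)) * divX k ((m - i) * p).
rewrite (sum_guard F) (sum_guard G) -minnMl sum_blocks.
have F0 : F 0%N = divY k (n * p) * divX k (m * p).
  by rewrite /F !subn0 (Hfun_kbin0 hchar) mulr1.
have G0 : G 0%N = divY k (n * p) * divX k (m * p).
  rewrite /G !subn0 [Hfun _](_ : _ = 1) ?mulr1 // -(Hfun_kbin0 hchar 0).
  by apply: eq_Hfun => z; rewrite /T !kbin0.
rewrite [in RHS]big_ord_recl G0 F0 !mulrDl; congr (_ + _).
rewrite !mulr_suml; apply: eq_bigr => i _; rewrite lift0.
have hi : (i < minn m n)%N by [].
have im : (i < m)%N by lia.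
have i_n : (i < n)%N by lia.
pose y := divY k ((n - i.+1) * p); pose x := divX k ((m - i.+1) * p).
(* For s < p the powers of order (n-i-1)p + s and (m-i-1)p + s factor without a coefficient, and
   Y^(s) X^(s) can be collected on the right next to [b]. *)
have key s : (s < p)%N -> F (i.+1 * p - s)%N * b = y *
    Hfun (fun z => kb (z + p%:Z * c i.+1) (i.+1 * p - s)) * x *
    (divY k s * divX k s * b).
  move=> sp; have ip : (s <= i.+1 * p)%N by rewrite mulSn; lia.
  have e1 : (n * p - (i.+1 * p - s) = (n - i.+1) * p + s)%N.
    have : (i.+1 * p <= n * p)%N by rewrite leq_mul2r i_n orbT.
    by rewrite mulnBl; lia.
  have e2 : (m * p - (i.+1 * p - s) = (m - i.+1) * p + s)%N.
    have : (i.+1 * p <= m * p)%N by rewrite leq_mul2r im orbT.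
    by rewrite mulnBl; lia.
  rewrite /F e1 e2 divY_split // divX_split // -/x -/y.
  have [c1 _ _] := central1_YXs hchar sp.
  have -> : y * Hfun (fun z => kb (z + p%:Z * c i.+1) (i.+1 * p - s)) * x *
      (divY k s * divX k s * b) =
      y * (Hfun (fun z => kb (z + p%:Z * c i.+1) (i.+1 * p - s)) * divY k s) *
      (divX k s * x) * b.
    by rewrite -!mulrA; do 2 congr (_ * _); rewrite [divY k s * (divX k s * b)]mulrA mulrA c1 -!mulrA.
  rewrite (Hfun_divY hchar); last exact: loc_const_kbin.
  rewrite !mulrA; do 4 congr (_ * _); apply: eq_Hfun => z; congr kbin.
  have -> : (i.+1 * p - s)%N%:Z = i.+1%:Z * p%:Z - s%:Z by lia.
  rewrite /c !PoszM; ring.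
(* For d = 1 Pascal's rule splits the shifted binomial of degree i + 1: the first summand is the
   term K = (i+1)p, and the second is what the remaining terms of the block must supply. *)
have Ymul : T (fun z => kb (z + c i.+1) i.+1) =1
    fun z => kb (z + p%:Z * c i.+1) (i.+1 * p) + d%:R * kb (z + p%:Z * c i.+1) (i * p).
  move=> z; rewrite /T !(lucas_mulp hchar) divp_shift; case: (d) => /=.
    by rewrite mul1r -kbin_pascal; congr kbin; ring.
  by rewrite mul0r !addr0.
have -> : G i.+1 = y * Hfun (T (fun z => kb (z + c i.+1) i.+1)) * x by [].
rewrite (eq_Hfun Ymul).
rewrite -(HfunD hchar); try exact: loc_const_kbin; last first.
  by apply: loc_constM; [exact: loc_const_cst | exact: loc_const_kbin].
rewrite -(HfunZ hchar); last exact: loc_const_kbin.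
rewrite mulrDr mulrDl mulrDl.
rewrite -(big_mkord xpredT (fun s => F (i.+1 * p - s)%N)) big_ltn // big_add1 big_mkord.
rewrite [LHS]mulrDl mulr_suml key // subn0 divX0 divY0 !mul1r; congr (_ + _).
(* Lucas factors the binomial of degree ip + (p - s) into one in floor(z/p), common to the block,
   and ['C(a, p - s)]; the latter are the coefficients of the defect. *)
transitivity (y * Hfun (fun z => kb (z + p%:Z * c i.+1) (i * p)) * x * (YXdefect a * b)).
  rewrite /YXdefect mulr_suml mulr_sumr; apply: eq_bigr => s _.
  rewrite key; last by have := ltn_ord s; lia.
  have sp : (s.+1 < p)%N by have := ltn_ord s; lia.
  have -> : (i.+1 * p - s.+1 = i * p + (p - s.+1))%N by rewrite mulSn; lia.
  have tp : (p - s.+1 < p)%N by lia.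
  have lr : loc_const (fun z => 'C(`|(z %% p)%Z|%N, p - s.+1)%:R).
    by exists 1%N => z; rewrite expn1 modzDr.
  have -> : Hfun (fun z => kb (z + p%:Z * c i.+1) (i * p + (p - s.+1))) =
     Hfun (fun z => kb (z + p%:Z * c i.+1) (i * p)) *
     Hfun (fun z => 'C(`|(z %% p)%Z|%N, p - s.+1)%:R).
    rewrite (HfunM hchar) //; last exact: loc_const_kbin.
    by apply: eq_Hfun => z; rewrite (lucas_split hchar) // (lucas_mulp hchar) modp_shift.
  have [r1 _ r3] : central1 (Hfun (fun z => 'C(`|(z %% p)%Z|%N, p - s.+1)%:R)).
    by apply: (central1_residue hchar) => z; rewrite expn1 modzDr.
  have [_ _ q3] := central1_YXs hchar sp.
  rewrite -!mulrA; do 2 congr (_ * _); rewrite mulrA -r1 -mulrA; congr (_ * _).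
  rewrite -scalerAl scalerAr -Hfun_residue_b // !mulrA -[_ * divY k _ * _]mulrA.
  by rewrite q3.
by rewrite b_defect -scalerAr scalerAl -!scalerAr -!scalerAl.
Qed.

Lemma divp_subM z n : ((z - 2 * (n * p)%N%:Z) %/ p)%Z = (z %/ p)%Z - 2 * n%:Z.
Proof. by rewrite -divp_shift PoszM; congr divz; ring. Qed.

(** Both products expand by [weight0_product], once with Y^(n), X^(n) and once with Y^(np), X^(np).
    The hypotheses on [b] make the commutation formula for the second family hold after right
    multiplication by [b]. *)
Lemma phi_mul u v : pbw diag u -> pbw diag v ->
  phi hchar d%:Z u * phi hchar d%:Z v * b = phi hchar d%:Z (u * v) * b.
Proof.
have lp := phi_linear hchar d%:Z.
have lpD x y : phi hchar d%:Z (x + y) = phi hchar d%:Z x + phi hchar d%:Z y.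
  by have := lp 1 x y; rewrite !scale1r.
have lp0 : phi hchar d%:Z 0 = 0.
  by have := lp (-1) 0 0; rewrite scaleN1r oppr0 addr0 scaleN1r addNr.
have lpZ e x : phi hchar d%:Z (e *: x) = e *: phi hchar d%:Z x.
  by have := lp e x 0; rewrite lp0 !addr0.
move=> hu hv; apply: (hu (fun u => phi hchar d%:Z u * phi hchar d%:Z v * b =
  phi hchar d%:Z (u * v) * b)).
- by rewrite mul0r lp0 !mul0r.
- by move=> x y hx hy; rewrite lpD !mulrDl hx hy lpD mulrDl.
- by move=> e x hx; rewrite lpZ -!scalerAl hx lpZ -scalerAl.
move=> _ [m [f [_ [<- ->]]]]; set u' := bas _ _ _ _.
apply: (hv (fun v => phi hchar d%:Z u' * phi hchar d%:Z v * b =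
  phi hchar d%:Z (u' * v) * b)).
- by rewrite mulr0 lp0 mulr0 !mul0r.
- by move=> x y hx hy; rewrite lpD mulrDr mulrDl hx hy mulrDr lpD mulrDl.
- by move=> e x hx; rewrite lpZ -scalerAr -scalerAl hx -scalerAr lpZ -scalerAl.
move=> _ [n [g [_ [<- ->]]]]; rewrite /u' !(bas_Hfun hchar) {u'}.
rewrite (zprod hchar); try exact: loc_const_kbin.
have [b1 b2 b3] := b_central.
rewrite !(phi_Hfun hchar); try exact: loc_const_kbin.
have := @weight0_product k p hchar (fun n => divY k (n * p)) (fun n => divX k (n * p)) T b
  _ _ _ _ _ _ b3 b1 divXp_divYp m n (fun z => kb (z + 0) f) (fun z => kb (z + 0) g)
  (loc_const_kbin hchar _ _) (loc_const_kbin hchar _ _).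
rewrite /T => ->.
- rewrite (big_morph _ lpD lp0); congr (_ * _); apply: eq_bigr => i _.
  rewrite lpZ (phi_Hfun hchar) //.
  by apply: loc_const_zfun => //; exact: loc_const_kbin.
- by move=> i j; rewrite divYM -mulnDl bin_mulp.
- by move=> i j; rewrite divXM -mulnDl bin_mulp.
- exact: loc_const_T.
- by [].
- move=> h i lh; rewrite (Hfun_divY hchar); last exact: loc_const_T.
  by congr (_ * _); apply: eq_Hfun => z; rewrite divp_subM; congr h; ring.
move=> h i lh; rewrite (divX_Hfun hchar); last exact: loc_const_T.
by congr (_ * _); apply: eq_Hfun => z; rewrite divp_subM; congr h; ring.
Qed.

End Block.
End FrobeniusProduct.

(** * Polynomials in YX on one residue class of weights *)

Section PrimeFieldEmbedding.
Variables (k : closedFieldType) (p : nat).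
Hypothesis hchar : p \in [pchar k].

(** The characteristic enters as an argument so that the ring morphism structure, which depends on
    it, can be attached to a constant. *)
Definition Fp_emb of p \in [pchar k] : 'F_p -> k := @Fp_to_k k p.
Local Notation emb := (Fp_emb hchar).

Let p_pr : prime p. Proof. exact: pcharf_prime hchar. Qed.

Lemma natr_modp n : (n %% p)%:R = n%:R :> k.
Proof. by rewrite [in RHS](divn_eq n p) natrD natr_mulp // add0r. Qed.

Lemma Fp_emb_nat n : emb n%:R = n%:R.
Proof. by rewrite /Fp_emb /Fp_to_k val_Fp_nat // natr_modp. Qed.

Lemma Fp_natr (c : 'F_p) : c = (c : nat)%:R.
Proof. by rewrite natr_Zp. Qed.

Lemma Fp_emb_zmod : zmod_morphism emb.
Proof.
move=> x y; apply: (addIr (emb y)); rewrite subrK.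
have embD u v : emb (u + v) = emb u + emb v.
  by rewrite [u]Fp_natr [v]Fp_natr -natrD !Fp_emb_nat natrD.
by rewrite -embD subrK.
Qed.

Lemma Fp_emb_monoid : monoid_morphism emb.
Proof.
split; first by rewrite -[1]/(1%:R) Fp_emb_nat.
by move=> u v; rewrite [u]Fp_natr [v]Fp_natr -natrM !Fp_emb_nat natrM.
Qed.

HB.instance Definition _ := GRing.isZmodMorphism.Build 'F_p k emb Fp_emb_zmod.
HB.instance Definition _ := GRing.isMonoidMorphism.Build 'F_p k emb Fp_emb_monoid.

End PrimeFieldEmbedding.

Section CasimirPolynomials.
Variables (k : closedFieldType) (p : nat).
Hypothesis hchar : p \in [pchar k].
Local Notation U := (hyper k).
Local Notation kb := (kbin k).
Local Notation loc_const := (@loc_const k p).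
Local Notation Hfun := (@Hfun k).
Local Notation central1 := (@central1 k p).
Local Notation emb := (Fp_emb hchar).
Local Notation y := (casYX k).
Local Notation muH := (muH k p).
Let p_pr : prime p. Proof. exact: pcharf_prime hchar. Qed.
Let p0 : (0 < p)%N. Proof. exact: prime_gt0. Qed.

Definition ev (q : {poly 'F_p}) : U := horner_alg y (map_poly emb q).

Lemma evD q r : ev (q + r) = ev q + ev r.
Proof. by rewrite /ev !rmorphD. Qed.
Lemma evB q r : ev (q - r) = ev q - ev r.
Proof. by rewrite /ev !rmorphB. Qed.
Lemma evM q r : ev (q * r) = ev q * ev r.
Proof. by rewrite /ev !rmorphM. Qed.
Lemma evX : ev 'X = y.
Proof. by rewrite /ev map_polyX horner_algX. Qed.
Lemma evC c : ev c%:P = (emb c)%:A.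
Proof. by rewrite /ev map_polyC horner_algC. Qed.
Lemma evZ c q : ev (c *: q) = emb c *: ev q.
Proof. by rewrite -mul_polyC evM evC mulr_algl. Qed.
Lemma ev1 : ev 1 = 1.
Proof. by rewrite /ev !rmorph1. Qed.
Lemma ev0 : ev 0 = 0.
Proof. by rewrite /ev !rmorph0. Qed.

Lemma central1_ev q : central1 (ev q).
Proof.
elim/poly_ind: q => [|q c IH].
  by rewrite ev0 -(scale0r 1); exact: central1_cst.
rewrite evD evM evX evC; apply: central1D; last exact: central1_cst.
by apply: central1M => //; exact: central1_YX.
Qed.

Lemma muH_ev a q : muH a * ev q = ev q * muH a.
Proof. by case: (central1_ev q) => _ _; apply; exact: loc_const_ind. Qed.

(** The polynomials in YX by which Y^m X^m and, for [xiP], X^m Y^m act on weights congruent to a: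
    the factors are those of [YX_step] and [XY_step] with H replaced by a. *)
Definition piP (a m : nat) : {poly 'F_p} :=
  \prod_(t < m) ('X - (t%:R * (a%:R + t%:R + 1))%:P).
Definition xiP (a m : nat) : {poly 'F_p} :=
  \prod_(t < m) ('X + (t.+1%:R * (a%:R - t%:R))%:P).

Lemma piPS a m : piP a m.+1 = piP a m * ('X - (m%:R * (a%:R + m%:R + 1))%:P).
Proof. by rewrite /piP big_ord_recr. Qed.

Lemma kbin1 z : kb z 1 = z%:~R.
Proof.
rewrite /kbin; congr _%:~R; case: z => n /=; first by rewrite bin1.
by rewrite expr1 addn1 bin1 mulN1r NegzE.
Qed.

Lemma intr_modp (z : int) : z%:~R = `|(z %% p)%Z|%N%:R :> k.
Proof.
rewrite {1}(divz_eq z p) intrD intrM -[(p%:Z)%:~R]pmulrn (pcharf0 hchar) mulr0 add0r.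
by rewrite pmulrn gez0_abs // modz_ge0 // (pz_neq0 hchar).
Qed.

Lemma Hfun_lin_muH a c : Hfun (fun z => kb (z + c) 1) * muH a = (a%:R + c%:~R) *: muH a.
Proof.
rewrite (@Hfun_muH _ _ hchar a _ (fun=> a%:R + c%:~R)).
- by rewrite (Hfun_cst hchar) mulr_algl.
- exact: loc_const_kbin.
- exact: loc_const_cst.
by move=> z za; rewrite kbin1 intrD (intr_modp z) za.
Qed.

Lemma YX_piP a m : (m`!%:R * m`!%:R) *: (divY k m * divX k m) * muH a = ev (piP a m) * muH a.
Proof.
elim: m => [|m IH].
  by rewrite divX0 divY0 /piP big_ord0 ev1 !mulr1 fact0 scale1r.
have -> : (m.+1`!%:R * m.+1`!%:R : k) = (m`!%:R * m`!%:R) * (m.+1%:R * m.+1%:R).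
  by rewrite factS natrM; ring.
rewrite -scalerA -(YX_step hchar) -scalerAl -[_ * _ * muH a]mulrA mulrBl -scalerAl Hfun_lin_muH.
rewrite scalerAl.
have -> : y * muH a - m%:R *: ((a%:R + (m%:Z + 1)%:~R) *: muH a) =
    muH a * ev ('X - (m%:R * (a%:R + m%:R + 1))%:P).
  rewrite evB evX evC mulrBr mulr_algr -evX muH_ev; congr (_ - _).
  rewrite scalerA intrD mulr1z -pmulrn; congr (_ *: _).
  by rewrite rmorphM !rmorphD rmorph1 !rmorph_nat addrA.
by rewrite mulrA IH -mulrA muH_ev mulrA -evM -piPS.
Qed.

Lemma XY_xiP a m : (m`!%:R * m`!%:R) *: (divX k m * divY k m) * muH a = ev (xiP a m) * muH a.
Proof.
elim: m => [|m IH].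
  by rewrite divX0 divY0 /xiP big_ord0 ev1 !mulr1 fact0 scale1r.
have -> : (m.+1`!%:R * m.+1`!%:R : k) = (m`!%:R * m`!%:R) * (m.+1%:R * m.+1%:R).
  by rewrite factS natrM; ring.
rewrite -scalerA -(XY_step hchar) -scalerAl -[_ * _ * muH a]mulrA mulrDl -scalerAl Hfun_lin_muH.
rewrite scalerAl.
have -> : y * muH a + m.+1%:R *: ((a%:R + (- m%:Z)%:~R) *: muH a) =
    muH a * ev ('X + (m.+1%:R * (a%:R - m%:R))%:P).
  rewrite evD evX evC mulrDr mulr_algr -evX muH_ev; congr (_ + _).
  by rewrite scalerA intrN -pmulrn rmorphM rmorphB !rmorph_nat.
by rewrite mulrA IH -mulrA muH_ev mulrA -evM /xiP big_ord_recr.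
Qed.

Lemma fact_lt_neq0 m : (m < p)%N -> m`!%:R != 0 :> k.
Proof.
elim: m => [|m IH] mp; first by rewrite fact0 oner_neq0.
rewrite factS natrM mulf_neq0 //; last by apply: IH; lia.
exact: (natS_lt_neq0 hchar).
Qed.

Lemma factp_eq0 : p`!%:R = 0 :> k.
Proof. by apply/eqP; rewrite -(dvdn_pcharf hchar); apply: dvdn_fact; rewrite p0 leqnn. Qed.

(** Y^p X^p is a multiple of p!, hence zero, so [piP a p] is the polynomial in YX that kills the
    idempotent of residue a. *)
Lemma ev_piP_eq0 a q : piP a p %| q -> ev q * muH a = 0.
Proof.
case/dvdpP => r ->; rewrite evM -mulrA -YX_piP factp_eq0 mul0r scale0r mul0r mulr0.
by [].
Qed.

Lemma ev_congr a q r : piP a p %| q - r -> ev q * muH a = ev r * muH a.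
Proof. by move=> /ev_piP_eq0; rewrite evB mulrBl => /eqP; rewrite subr_eq0 => /eqP. Qed.

Lemma piP_dvd a m n : (m <= n)%N -> piP a m %| piP a n.
Proof.
move=> mn; rewrite /piP -(big_mkord xpredT (fun t => 'X - (t%:R * (a%:R + t%:R + 1))%:P)).
rewrite -(big_mkord xpredT (fun t => 'X - (t%:R * (a%:R + t%:R + 1))%:P)).
by rewrite (big_cat_nat (leq0n m) mn) /= dvdp_mulr.
Qed.

Lemma xiP_dvd a m n : (m <= n)%N -> xiP a m %| xiP a n.
Proof.
move=> mn; rewrite /xiP -(big_mkord xpredT (fun t => 'X + (t.+1%:R * (a%:R - t%:R))%:P)).
rewrite -(big_mkord xpredT (fun t => 'X + (t.+1%:R * (a%:R - t%:R))%:P)).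
by rewrite (big_cat_nat (leq0n m) mn) /= dvdp_mulr.
Qed.

Lemma Fp_p0 : p%:R = 0 :> 'F_p.
Proof. by apply/val_inj; rewrite /= val_Fp_nat // modnn. Qed.

(** Reversing t to p - 1 - t in the last a factors turns the root t(a + t + 1) into -(t + 1)(a -
    t). *)
Lemma piP_xiP a : (a < p)%N -> piP a p = piP a (p - a) * xiP a a.
Proof.
move=> ap; pose g t : {poly 'F_p} := 'X - (t%:R * (a%:R + t%:R + 1))%:P.
rewrite {1 2}/piP -(big_mkord xpredT g) -(big_mkord xpredT g).
rewrite (@big_cat_nat _ _ _ (p - a)) //=; last by lia.
congr (_ * _); rewrite -{1}[(p - a)%N]add0n big_addn.
have -> : (p - (p - a) = a)%N by lia.
rewrite big_mkord /xiP (reindex_inj rev_ord_inj) /=; apply: eq_bigr => t _.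
rewrite /g; have ta := ltn_ord t; congr (_ + _).
rewrite -polyCN; congr (_%:P).
have -> : (a - t.+1 + (p - a) = p - t.+1)%N by lia.
rewrite natrB; last by lia.
rewrite Fp_p0 -[t.+1]addn1 natrD; ring.
Qed.

Lemma YX_muH a s : (s < p)%N -> divY k s * divX k s * muH a =
  (s`!%:R * s`!%:R)^-1 *: (ev (piP a s) * muH a).
Proof.
move=> sp; have n0 := fact_lt_neq0 sp.
by rewrite -YX_piP -scalerAl scalerA mulVf ?scale1r // mulf_neq0.
Qed.

Lemma XY_muH a s : (s < p)%N -> divX k s * divY k s * muH a =
  (s`!%:R * s`!%:R)^-1 *: (ev (xiP a s) * muH a).
Proof.
move=> sp; have n0 := fact_lt_neq0 sp.
by rewrite -XY_xiP -scalerAl scalerA mulVf ?scale1r // mulf_neq0.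
Qed.

(** The binomial vanishes unless s + 1 >= p - a. In that case Y^(s+1) X^(s+1) contains
    [piP a (p - a)], which together with [xiP a a] is the killing polynomial. *)
Lemma YXdefect_eq0 a f : (a < p)%N -> xiP a a %| f ->
  YXdefect k p a * (ev f * muH a) = 0.
Proof.
move=> ap hf; rewrite /YXdefect mulr_suml big1 // => s _.
have sp : (s.+1 < p)%N by have := ltn_ord s; lia.
have [h|h] := leqP (p - s.+1) a; last by rewrite bin_small // scale0r mul0r.
rewrite -muH_ev -scalerAl mulrA YX_muH // -!scalerAl -mulrA muH_ev mulrA -evM.
rewrite ev_piP_eq0 ?scaler0 // piP_xiP //; apply: dvdp_mul => //.
by apply: piP_dvd; lia.
Qed.

(** The mirror image of [YXdefect], taken from the expansion of Y^(p) X^(p); there -z occurs, whose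
    residue is p - a for 0 < a < p. *)
Definition XYdefect (a : nat) : U :=
  \sum_(s < p.-1) 'C(p - a, p - s.+1)%:R *: (divX k s.+1 * divY k s.+1).

Lemma XYdefect_eq0 a f : (a < p)%N -> piP a (p - a) %| f ->
  XYdefect a * (ev f * muH a) = 0.
Proof.
move=> ap hf; rewrite /XYdefect mulr_suml big1 // => s _.
have sp : (s.+1 < p)%N by have := ltn_ord s; lia.
have [h|h] := leqP (p - s.+1) (p - a); last by rewrite bin_small // scale0r mul0r.
rewrite -muH_ev -scalerAl mulrA XY_muH // -!scalerAl -mulrA muH_ev mulrA -evM.
rewrite ev_piP_eq0 ?scaler0 // piP_xiP // mulrC; apply: dvdp_mul => //.
by apply: xiP_dvd; lia.
Qed.

Lemma loc_const_kbinN c m : loc_const (fun z => kb (- z + c) m).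
Proof. by apply: (loc_const_opp (f := fun z => kb (z + c) m)); exact: loc_const_kbin. Qed.

Lemma sum_ends (V : zmodType) (F : nat -> V) :
  \sum_(i < p.+1) F i = F 0%N + \sum_(s < p.-1) F (p - s.+1)%N + F p.
Proof.
rewrite -(big_mkord xpredT F) big_nat_recr //= big_ltn // big_add1; congr (_ + _ + _).
rewrite big_mkord (reindex_inj rev_ord_inj) /=; apply: eq_bigr => s _; congr F.
by have := ltn_ord s; lia.
Qed.

Lemma central1_XYs s : (s < p)%N -> central1 (divX k s * divY k s).
Proof.
elim: s => [|s IH] sp.
  by rewrite divX0 divY0 mulr1 -[1]scale1r; exact: central1_cst.
have n0 := natS_lt_neq0 hchar sp (ltn0Sn s).
have -> : divX k s.+1 * divY k s.+1 = (s.+1%:R * s.+1%:R)^-1 *: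
    (divX k s * divY k s * (casYX k + s.+1%:R *: Hfun (fun z => kb (z + (- s%:Z)) 1))).
  by rewrite (XY_step hchar) scalerA mulVf ?scale1r // mulf_neq0.
apply: central1Z; apply: central1M; first by apply: IH; lia.
apply: central1D; first exact: central1_YX.
apply: central1Z; apply: (central1_residue hchar).
by apply: periodic_kbin => //; rewrite expn1 prime_gt1.
Qed.

(* Compare the expansion of X^(p) Y^(p) with that of Y^(p) X^(p): on weights
   congruent to [a], the extreme terms binom(H, p) and binom(-H, p) add up to -1. *)
Lemma defect_sum a : (0 < a < p)%N ->
  (YXdefect k p a + XYdefect a) * muH a = muH a.
Proof.
move=> /andP[a0 ap].
have e1 : divX k p * divY k p * muH a = divY k p * divX k p * muH a +
    YXdefect k p a * muH a + Hfun (kb^~ p) * muH a.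
  pose F i := divY k (p - i) *
    Hfun (fun z => kb (z + (2 * i%:Z - p%:Z - p%:Z)) i) * divX k (p - i).
  rewrite (divX_divY hchar) (sum_guard F) minnn (sum_ends F) /F.
  rewrite !subn0 (Hfun_kbin0 hchar) mulr1 subnn divX0 divY0 mul1r mulr1 !mulrDl.
  congr (_ + _ + _ * _); last by apply: eq_Hfun => z; congr kbin; lia.
  rewrite /YXdefect !mulr_suml; apply: eq_bigr => s _.
  have sp : (s.+1 < p)%N by have := ltn_ord s; lia.
  have -> : (p - (p - s.+1) = s.+1)%N by lia.
  rewrite (divY_Hfun hchar); last exact: loc_const_kbin.
  have [_ _ c3] := central1_YXs hchar sp.
  rewrite -(mulrA (Hfun _)) c3; last by apply: (@loc_const_shift _ _ (fun z => kb (z + _) _)); exact: loc_const_kbin.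
  rewrite -mulrA (@Hfun_muH _ _ hchar a _ (fun=> 'C(a, p - s.+1)%:R)).
  - by rewrite (Hfun_cst hchar) mulr_algl -scalerAr scalerAl.
  - by apply: (@loc_const_shift _ _ (fun z => kb (z + _) _)); exact: loc_const_kbin.
  - exact: loc_const_cst.
  move=> z za; have -> : z + 2 * s.+1%:Z + (2 * (p - s.+1)%N%:Z - p%:Z - p%:Z) = z by lia.
  rewrite (lucas hchar) divn_small; last by lia.
  by rewrite kbin0 mul1r za modn_small //; lia.
have e2 : divY k p * divX k p * muH a = divX k p * divY k p * muH a +
    XYdefect a * muH a + Hfun (fun z => kb (- z) p) * muH a.
  pose F i := divX k (p - i) *
    Hfun (fun z => kb (- z + (2 * i%:Z - p%:Z - p%:Z)) i) * divY k (p - i).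
  rewrite (divY_divX hchar) (sum_guard F) minnn (sum_ends F) /F.
  have h1 : Hfun (fun z => kb (- z + (2 * 0%:Z - p%:Z - p%:Z)) 0) = 1.
    by rewrite -(Hfun_kbin0 hchar 0); apply: eq_Hfun => z; rewrite !kbin0.
  rewrite !subn0 h1 mulr1 subnn divX0 divY0 mul1r mulr1 !mulrDl.
  congr (_ + _ + _ * _); last by apply: eq_Hfun => z; congr kbin; lia.
  rewrite /XYdefect !mulr_suml; apply: eq_bigr => s _.
  have sp : (s.+1 < p)%N by have := ltn_ord s; lia.
  have -> : (p - (p - s.+1) = s.+1)%N by lia.
  rewrite (divX_Hfun hchar); last exact: loc_const_kbinN.
  have [_ _ c3] := central1_XYs sp.
  have ls : loc_const (fun z => kb (- (z - 2 * s.+1%:Z) +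
      (2 * (p - s.+1)%N%:Z - p%:Z - p%:Z)) (p - s.+1)).
    by apply: (@loc_const_shift _ _ (fun z => kb (- z + _) _)); exact: loc_const_kbinN.
  rewrite -(mulrA (Hfun _)) c3 // -mulrA (@Hfun_muH _ _ hchar a _ (fun=> 'C(p - a, p - s.+1)%:R)) //.
  - by rewrite (Hfun_cst hchar) mulr_algl -scalerAr scalerAl.
  - exact: loc_const_cst.
  move=> z za; have -> : - (z - 2 * s.+1%:Z) + (2 * (p - s.+1)%N%:Z - p%:Z - p%:Z) = - z by lia.
  rewrite (lucas hchar) divn_small; last by lia.
  rewrite kbin0 mul1r [((p - s.+1) %% p)%N]modn_small; last by lia.
  congr ('C(_, _)%:R); have pz := pz_neq0 hchar.
  have := modz_ge0 z pz; have zd := divz_eq z p => zm.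
  have -> : - z = (- (z %/ p)%Z - 1) * p%:Z + (p - a)%N%:Z.
    by have : (z %% p)%Z = a%:Z; [lia | move=> e; rewrite {1}zd e; lia].
  by rewrite modzMDl modz_small //; lia.
(* binom(z, p) is floor(z/p) modulo p, and floor(-z/p) = -floor(z/p) - 1 because z, being congruent
   to a with 0 < a < p, is not divisible by p. *)
have e3 : Hfun (kb^~ p) * muH a + Hfun (fun z => kb (- z) p) * muH a = - muH a.
  have l1 : loc_const (kb^~ p) by exact: loc_const_kbin0.
  have l2 : loc_const (fun z => kb (- z) p) by exact: loc_const_opp l1.
  rewrite -mulrDl (HfunD hchar) // (@Hfun_muH _ _ hchar a _ (fun=> -1)).
  - by rewrite (Hfun_cst hchar) scaleN1r mulN1r.
  - exact: loc_constD.
  - exact: loc_const_cst.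
  move=> z za; have kbp w : kb w p = kb (w %/ p)%Z 1 by rewrite -{1}[p]mul1n (lucas_mulp hchar).
  rewrite !kbp !kbin1 -intrD.
  have pz := pz_neq0 hchar.
  have := modz_ge0 z pz; have zd := divz_eq z p => zm.
  have -> : (- z %/ p)%Z = - (z %/ p)%Z - 1.
    have -> : - z = (- (z %/ p)%Z - 1) * p%:Z + (p - a)%N%:Z.
      by have : (z %% p)%Z = a%:Z; [lia | move=> e; rewrite {1}zd e; lia].
    rewrite divzMDl // (_ : ((p - a)%N %/ p)%Z = 0) ?addr0 //.
    by rewrite divz_nat divn_small //; lia.
  by rewrite addrA subrr sub0r mulrN1z.
rewrite mulrDl -[in RHS](opprK (muH a)) -e3.
move: e1; rewrite e2 -!addrA -[LHS]addr0 => /addrI /esym/eqP.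
rewrite (addrC _ (Hfun (kb^~ p) * muH a)) !addrA => /eqP e.
apply/eqP; rewrite -subr_eq0 opprK (addrC (Hfun _ * _)) -addrA.
by rewrite (addrC (YXdefect k p a * _)) !addrA e.
Qed.

(** The two defects add up to the identity by [defect_sum], and divisibility by [piP a (p - a)]
    kills the mirror one. *)
Lemma YXdefect_id a f : (0 < a < p)%N -> piP a (p - a) %| f ->
  YXdefect k p a * (ev f * muH a) = ev f * muH a.
Proof.
move=> ha hf; rewrite -[RHS]muH_ev -[in RHS](defect_sum ha) -mulrA mulrDl muH_ev.
by rewrite XYdefect_eq0 ?addr0 //; case/andP: ha.
Qed.

Lemma monic_piP a m : piP a m \is monic.
Proof. by rewrite /piP monic_prod_XsubC. Qed.

Lemma size_piP a m : size (piP a m) = m.+1.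
Proof. by rewrite /piP size_prod_XsubC /index_enum -enumT size_enum_ord. Qed.

(** The quotients of [piP a (s + i)] by [piP a s] are monic of degree i, so they form a triangular
    basis. The last coefficient is kept because it later gives B^(tau) <> 0. *)
Lemma piP_expansion a s n (g : {poly 'F_p}) : (size g <= n)%N -> exists c : nat -> 'F_p,
  piP a s * g = \sum_(i < n) c i *: piP a (s + i) /\ c n.-1 = g`_n.-1.
Proof.
elim: n g => [|n IH] g sg.
  exists (fun=> 0); rewrite big_ord0.
  by move: sg; rewrite leqn0 size_poly_eq0 => /eqP ->; rewrite mulr0 coef0.
have [q eq_q] : exists q, piP a (s + n) = piP a s * q.
  by have /dvdpP[q e] := piP_dvd a (leq_addr n s); exists q; rewrite e mulrC.
have mq : q \is monic by have := monic_piP a (s + n); rewrite eq_q monicMl ?monic_piP.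
have sq : size q = n.+1.
  have := size_piP a (s + n).
  rewrite eq_q size_monicM ?monic_piP ?monic_neq0 // size_piP; lia.
have qn : q`_n = 1 by move/monicP: mq; rewrite lead_coefE sq.
have [|c [ec cn]] := IH (g - g`_n *: q).
  apply/leq_sizeP => i; rewrite leq_eqVlt => /predU1P[<-|ni].
    by rewrite coefB coefZ qn mulr1 subrr.
  by rewrite coefB coefZ (nth_default 0 (leq_trans sg ni)) (@nth_default _ 0 q) ?mulr0 ?subrr ?sq.
exists (fun i => if i == n then g`_n else c i); rewrite /= eqxx; split=> //.
rewrite big_ord_recr /= eqxx (eq_bigr (fun i : 'I_n => c i *: piP a (s + i))) => [|i _].
  by rewrite -ec eq_q mulrBr scalerAr subrK.
by rewrite ltn_eqF.
Qed.

Lemma hYX_muH a m : (hY k ^+ m * hX k ^+ m) * muH a = ev (piP a m) * muH a.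
Proof.
by rewrite -YX_piP hY_exp hX_exp -scalerAl -scalerAr scalerA.
Qed.

End CasimirPolynomials.

Lemma divX_comm (k : closedFieldType) m n : divX k m * divX k n = divX k n * divX k m.
Proof. by rewrite !divXM [(n + m)%N]addnC -(bin_sub (leq_addr n m)) addKn. Qed.

Lemma divY_comm (k : closedFieldType) m n : divY k m * divY k n = divY k n * divY k m.
Proof. by rewrite !divYM [(n + m)%N]addnC -(bin_sub (leq_addr n m)) addKn. Qed.

Section Labels.
Variables (k : closedFieldType) (p : nat).
Hypothesis hchar : p \in [pchar k].
Local Notation U := (hyper k).
Local Notation kb := (kbin k).
Local Notation loc_const := (@loc_const k p).
Local Notation Hfun := (@Hfun k).
Local Notation central1 := (@central1 k p).
Local Notation emb := (Fp_emb hchar).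
Local Notation muH := (muH k p).
Local Notation ev := (ev hchar).
Local Notation ind := (ind k p).
Local Notation phi := (phi hchar).
Let p_pr : prime p. Proof. exact: pcharf_prime hchar. Qed.
Let p0 : (0 < p)%N. Proof. exact: prime_gt0. Qed.

(** Gives the uniqueness of the coefficients c_m in the definition of the maps Z. *)
Lemma muH_coef_eq0 a (c : nat -> k) : (a < p)%N ->
  muH a * \sum_(m < p) c m *: (hY k ^+ m * hX k ^+ m) = 0 ->
  forall m, (m < p)%N -> c m = 0.
Proof.
move=> ap h0 m mp.
pose f (m m' : nat) (z : int) : k :=
  (m == m')%:R * (c m * (m`!%:R * m`!%:R)) * ind a (z - 2 * m%:Z).
pose h (m m' : nat) : U := ((m == m')%:R * (c m * (m`!%:R * m`!%:R))) *:
  Hfun (fun z => ind a (z - 2 * m%:Z)).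
have lf i : loc_const (fun z => ind a (z - 2 * i%:Z)).
  by apply: loc_const_shift; exact: loc_const_ind.
have hf i j : hval (h i j) (f i j) by apply: hval_eq; first exact/hvalZ/(HfunP hchar)/lf.
(* Moving the idempotent past Y^(m) shifts its argument by -2m, so the weight a + 2m is one at which
   it takes the value 1. *)
have := @triangular_indep _ p h f hf _ m m (a%:Z + 2 * m%:Z) mp mp.
rewrite /f eqxx mul1r addrK /ind modz_small ?eqxx ?mulr1; last by lia.
move=> h1; have/eqP : c m * (m`!%:R * m`!%:R) = 0.
  apply: h1; rewrite -[RHS]h0 mulr_sumr; apply: eq_bigr => i _.
  rewrite (bigD1 i) //= big1 => [|j ji].
    rewrite /h eqxx mul1r addr0 -[divY k i * _]scalerAr -scalerAl -[in RHS]scalerAr -scalerA.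
    have -> : hY k ^+ i * hX k ^+ i = (i`!%:R * i`!%:R) *: (divY k i * divX k i).
      by rewrite hY_exp hX_exp -scalerAl -scalerAr scalerA.
    rewrite -[in RHS]scalerAr; congr (_ *: (_ *: _)).
    by rewrite mulrA (Hfun_divY hchar) //; exact: loc_const_ind.
  by rewrite /h eq_sym (_ : (nat_of_ord j == i) = false) ?mul0r ?scale0r ?mulr0 ?mul0r //; apply/negbTE.
rewrite !mulf_eq0 orbb; case/orP => /eqP // /eqP.
by rewrite (negbTE (fact_lt_neq0 hchar mp)).
Qed.

Lemma muH_hYX a m : (m < p)%N ->
  muH a * (hY k ^+ m * hX k ^+ m) = (hY k ^+ m * hX k ^+ m) * muH a.
Proof.
move=> mp; rewrite hY_exp hX_exp -!scalerAl -!scalerAr -!scalerAl.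
by have [_ _ ->] := central1_YXs hchar mp; last exact: loc_const_ind.
Qed.

Lemma central1_hYX m : (m < p)%N -> central1 (hY k ^+ m * hX k ^+ m).
Proof.
by move=> mp; rewrite hY_exp hX_exp -scalerAl -scalerAr; do 2 apply: central1Z; exact: central1_YXs.
Qed.

(** Identifies the choice in [B_coef]: two expansions have the same image in [k] by [muH_coef_eq0],
    and the prime field embeds. *)
Lemma B_coefP e (x : label) (c : nat -> 'F_p) : (x.1 < p)%N ->
  B1 k p e x = muH x.1 * \sum_(m < p) emb (c m) *: (hY k ^+ m * hX k ^+ m) ->
  forall m : 'I_p, B_coef k p e x m = c m.
Proof.
move=> ap hB.
have hc : [set c : {ffun 'I_p -> 'F_p} |
    B1 k p e x = mu_ k p x.1%:Z * \sum_(m < p) Fp_to_k k (c m) *: (hY k ^+ m * hX k ^+ m)]%classic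
    [ffun i : 'I_p => c i].
  rewrite /= hB (mu_muH hchar) //; congr (_ * _); apply: eq_bigr => i _.
  by rewrite ffunE.
rewrite /B_coef; case: xgetP => [c' _ /= hc'|/(_ _ hc)//] m.
move: hc'; rewrite hB (mu_muH hchar) // => /eqP; rewrite -subr_eq0 -mulrBr -sumrB => /eqP hc'.
pose d i := emb (c i) - emb (oapp c' 0 (insub i)).
have dE (i : 'I_p) : d i = emb (c i) - emb (c' i) by rewrite /d valK.
apply/eqP; rewrite eq_sym -subr_eq0 -(fmorph_eq0 emb) rmorphB -dE; apply/eqP.
apply: (muH_coef_eq0 ap) => //; rewrite -[RHS]hc'; congr (_ * _).
by apply: eq_bigr => i _; rewrite dE scalerBl.
Qed.

Section Block.
Variables (a : nat) (d : bool) (x : label) (f : bool -> {poly 'F_p}).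
Hypothesis ap : (a < p)%N.
Hypothesis ax : x.1 = a.
Hypothesis B1E : forall e, B1 k p e x = ev (f e) * muH a.
Hypothesis size_f : forall e, (size (f e) <= p)%N.

Lemma B1_expansion e s : piP p a s %| f e -> exists c : nat -> 'F_p,
  [/\ B1 k p e x = muH a * \sum_(m < p) emb (c m) *: (hY k ^+ m * hX k ^+ m),
      (forall m, (m < s)%N -> c m = 0) & c p.-1 = (f e)`_p.-1].
Proof.
case/dvdpP => g eg.
have sP : piP p a s != 0 by rewrite monic_neq0 ?monic_piP.
have [g0|g0] := eqVneq g 0.
  exists (fun=> 0); split=> //; last by rewrite eg g0 mul0r coef0.
  rewrite B1E eg g0 mul0r ev0 mul0r big1 ?mulr0 // => m _.
  by rewrite rmorph0 scale0r.
have sf : size (f e) = (s + size g)%N.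
  by rewrite eg size_Mmonic ?monic_piP // size_piP addnS /= addnC.
have sg : (size g <= p - s)%N by have := size_f e; lia.
have sp : (s < p)%N.
  by rewrite -size_poly_gt0 in g0; have := size_f e; lia.
have [c [ec cl]] := piP_expansion hchar a s sg.
exists (fun m => if (m < s)%N then 0 else c (m - s)%N); split.
- pose F m := (if (m < s)%N then 0 else c (m - s)%N) *: piP p a m.
  have ef : f e = \sum_(m < p) F m.
    rewrite eg mulrC ec -(big_mkord xpredT F) (@big_cat_nat _ _ _ s) //=; last exact: ltnW.
    have -> : \sum_(0 <= m < s) F m = 0.
      by rewrite big_nat big1 // => m /andP[_ ms]; rewrite /F ms scale0r.
    rewrite add0r -[RHS]/(\sum_(0 + s <= i < p) F i) big_addn big_mkord; apply: eq_bigr => m _.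
    by rewrite /F addnC ltnNge leq_addl /= addnK.
  rewrite B1E ef /ev !raddf_sum /= mulr_suml mulr_sumr; apply: eq_bigr => m _.
  rewrite -[horner_alg _ _]/(ev _) evZ -scalerAl -hYX_muH -scalerAr; congr (_ *: _).
  by rewrite muH_hYX.
- by move=> m ->.
have -> : (p.-1 < s)%N = false by lia.
have -> : (p.-1 - s = (p - s).-1)%N by lia.
rewrite cl eg; have [sg'|sg'] := eqVneq (size g) (p - s)%N.
  have -> : p.-1 = (size (g * piP p a s)).-1 by rewrite -eg sf sg'; lia.
  by rewrite -sg' -!lead_coefE lead_coef_Mmonic ?monic_piP.
have sg2 : (size g < p - s)%N by rewrite ltn_neqAle sg'.
rewrite (@nth_default _ 0 g); last by rewrite -ltnS prednK // subn_gt0.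
rewrite nth_default // -eg sf -ltnS prednK //.
by rewrite -[X in (_ < X)%N](subnKC (ltnW sp)) ltn_add2l.
Qed.

Hypothesis typeE : typeA p x || typeC p x = d.
Hypothesis fd : forall e, if d then (0 < a)%N /\ piP p a (p - a) %| f e else xiP p a a %| f e.
Hypothesis shiftP : d -> [/\ shift p x <= p - a, p <= a + 2 * shift p x & a + 2 * shift p x < 2 * p]%N.

Lemma central1_B1 e : central1 (B1 k p e x).
Proof.
by rewrite B1E; apply: central1M; [exact: central1_ev|exact: central1_muH].
Qed.

Lemma muH_B1 e : muH a * B1 k p e x = B1 k p e x.
Proof. by rewrite B1E mulrA muH_ev -mulrA muH_idem. Qed.

Lemma defect_B1 e : YXdefect k p a * B1 k p e x = d%:R *: B1 k p e x.
Proof.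
rewrite B1E; have := fd e; case: (d) => [[a0 h]|h]; last by rewrite YXdefect_eq0 // scale0r.
by rewrite YXdefect_id ?scale1r // a0.
Qed.

Lemma phi_mulB e u v : @pbw k diag u -> @pbw k diag v ->
  phi d%:Z u * phi d%:Z v * B1 k p e x = phi d%:Z (u * v) * B1 k p e x.
Proof. exact: (phi_mul hchar ap (central1_B1 e) (muH_B1 e) (defect_B1 e)). Qed.

(** In types (A) and (C), moving Y^s to the right past the torus part of Fr'(z) shifts the weight by
    2s. As p <= a + 2s < 2p, this raises floor(z/p) by exactly 1 on the residue a, whence d = 1. The
    bound s <= p - a makes c_m vanish for m < s. *)
Lemma Zmap_phi e z : @pbw k diag z -> Zmap p e z x = phi d%:Z z * B1 k p e x.
Proof.
move=> hz; rewrite /Zmap typeE (Fr'_phi hchar) ax (mu_muH hchar) //.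
have := fd e; have := shiftP; case: (d) => [/(_ isT)[s1 s2 s3] [a0 hf]|_ _] //.
set s := shift p x in s1 s2 s3 *.
have [c [hB hc _]] := B1_expansion (dvdp_trans (piP_dvd p a s1) hf).
have sp : (s < p)%N by lia.
have Bc : B1 k p e x = muH a * \sum_(m < p | (s <= m)%N) emb (c m) *: (hY k ^+ m * hX k ^+ m).
  rewrite hB [in LHS](bigID (fun m : 'I_p => (s <= m)%N)) /= [X in _ + X]big1 ?addr0 // => m.
  by rewrite -ltnNge => /hc ->; rewrite rmorph0 scale0r.
have -> : muH a * (\sum_(m < p | (s <= m)%N) Fp_to_k k (B_coef k p e x m) *:
    (hY k ^+ m * hX k ^+ (m - s) * phi 0 z * hX k ^+ s)) =
    muH a * (\sum_(m < p | (s <= m)%N) emb (c m) *: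
    (hY k ^+ m * hX k ^+ (m - s) * phi 0 z * hX k ^+ s)).
  congr (_ * _); apply: eq_bigr => m _; rewrite (@B_coefP _ _ c) ?ax //.
rewrite {}Bc; move: z hz.
apply: kspan_eq.
- move=> t u v; rewrite scalerAr -mulrDr; congr (_ * _).
  rewrite scaler_sumr -big_split /=; apply: eq_bigr => m _.
  rewrite phi_linear mulrDr mulrDl scalerDr; congr (_ + _).
  by rewrite -scalerAr -scalerAl !scalerA mulrC.
- by move=> t u v; rewrite phi_linear mulrDl scalerAl.
move=> _ [l [n [_ [<- ->]]]]; rewrite !phi_bas.
pose h d0 := Hfun (fun z => kb ((z %/ p)%Z + d0) n).
rewrite -/(h 0) -/(h d%:Z) mulr_sumr [in RHS]mulr_sumr [in RHS]mulr_sumr.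
apply: eq_bigr => m sm; rewrite -!scalerAr; congr (_ *: _).
have lh d0 : loc_const (fun z => kb ((z %/ p)%Z + d0) n).
  by apply: (loc_const_divp hchar d0 (f := kb^~ n)); exact: loc_const_kbin0.
(* The middle factor Y^t X^t commutes with the Frobenius image, so it can be placed between Y^s and
   X^s, where it rebuilds Y^m X^m. *)
pose t := (m - s)%N; have mE : nat_of_ord m = (s + t)%N by rewrite /t subnKC.
have tp : (t < p)%N by have := ltn_ord m; lia.
have [_ cT2 cT3] := central1_hYX tp; have [cW1 _ _] := central1_hYX (ltn_ord m).
have [cm1 cm2 cm3] := central1_muH hchar a.
set T := hY k ^+ t * hX k ^+ t in cT2 cT3.
set W := hY k ^+ m * hX k ^+ m in cW1 *.
have WE : hY k ^+ s * T * hX k ^+ s = W.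
  by rewrite /T /W mE exprD addnC exprD !mulrA.
have -> : hY k ^+ m * hX k ^+ (m - s) = hY k ^+ s * T by rewrite {1}mE exprD -mulrA.
clearbody T W.
set Y := divY k (l * p); set X := divX k (l * p).
have -> : hY k ^+ s * T * (Y * h 0 * X) * hX k ^+ s = hY k ^+ s * Y * h 0 * T * (X * hX k ^+ s).
  rewrite !mulrA; congr (_ * _ * _); rewrite -!mulrA; congr (_ * _).
  by rewrite cT3 // !mulrA -cT2.
rewrite hX_exp -[X * _]scalerAr.
have -> : X * divX k s = divX k s * X by exact: divX_comm.
have -> : hY k ^+ s * Y = Y * hY k ^+ s.
  by rewrite hY_exp -scalerAl -scalerAr divY_comm.
rewrite scalerAl -hX_exp -[Y * _ * h 0]mulrA.
have -> : hY k ^+ s * h 0 = Hfun (fun z => kb (((z + 2 * s%:Z) %/ p)%Z + 0) n) * hY k ^+ s.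
  by rewrite hY_exp -scalerAl -scalerAr (divY_Hfun hchar).
set h' := Hfun _.
have -> : muH a * (Y * (h' * hY k ^+ s) * T * (hX k ^+ s * X)) = Y * (muH a * h') * W * X.
  by rewrite -WE !mulrA cm2.
have lh' : loc_const (fun z => kb (((z + 2 * s%:Z) %/ p)%Z + 0) n).
  by apply: (@loc_const_shift _ _ (fun z => kb ((z %/ p)%Z + 0) n)).
rewrite -[_ * W * X]mulrA -cW1 -cm3 // (@Hfun_muH _ _ hchar a _ _ lh' (lh true)) => [|z za].
  by rewrite -!mulrA; do 2 congr (_ * _); rewrite !mulrA cm1.
congr kbin; have pz := pz_neq0 hchar; rewrite addr0.
rewrite [in LHS](divz_eq z p) -addrA divzMDl //; congr (_ + _).
have -> : (z %% p)%Z = a%:Z by have := modz_ge0 z pz; lia.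
have -> : a%:Z + 2 * s%:Z = 1 * p%:Z + (a + 2 * s - p)%N%:Z by lia.
by rewrite divzMDl // divz_nat divn_small ?addr0 //; lia.
Qed.

End Block.
End Labels.

Lemma dvdp_XsubC_sqr (F : fieldType) (G : {poly F}) v :
  G.[v] = 0 -> G^`().[v] = 0 -> ('X - v%:P) ^+ 2 %| G.
Proof.
move=> /eqP; rewrite -/(root G v) -dvdp_XsubCl => /dvdpP[H ->].
rewrite derivM derivXsubC mulr1 hornerD hornerM hornerXsubC subrr mulr0 add0r.
move=> /eqP; rewrite -/(root H v) -dvdp_XsubCl => /dvdpP[K ->].
by rewrite expr2 -mulrA dvdp_mulIr.
Qed.

(** * The polynomials attached to a label *)

Section OddPrime.
Variable p : nat.
Hypothesis p_pr : prime p.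
Hypothesis p_odd : p != 2%N.
Local Notation F := 'F_p.
Local Notation psi := (psi p).
Let h := p.-1./2.

Let odd_p : odd p. Proof. by case: (even_prime p_pr) => // e; move: p_odd; rewrite e. Qed.
Let p_gt2 : (2 < p)%N. Proof. by have := prime_gt1 p_pr; move: p_odd; lia. Qed.
Let pE : p = (h.*2).+1.
Proof. by rewrite /h; have := odd_p; have := p_gt2; lia. Qed.

Lemma Fp_pchar : p \in [pchar F].
Proof. exact: pchar_Fp. Qed.

Let two_neq0 : 2%:R != 0 :> F.
Proof.
rewrite -(dvdn_pcharf Fp_pchar) gtnNdvd //.
Qed.

Let h2 : h%:R *+ 2 = -1 :> F.
Proof.
apply/eqP; rewrite -subr_eq0 opprK -mulrnA muln2 natr1 -pE; apply/eqP.
exact: pcharf0 Fp_pchar.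
Qed.

Lemma fermat (i : F) : i != 0 -> (i ^+ 2) ^+ h = 1.
Proof.
move=> i0; apply: (mulfI i0); rewrite -exprM mul2n -exprS -pE mulr1.
by have := expf_card i; rewrite card_Fp.
Qed.

(* Substituting [z ^ 2] for [x] turns [psi] into [(z ^ p - z) ^ 2]. *)
Lemma psiE : psi = 'X * ('X^h - 1) ^+ 2.
Proof.
apply/eqP; rewrite -subr_eq0 -(@comp_poly_eq0 _ _ ('X ^+ 2)) ?size_polyXn // comp_polyB.
rewrite subr_eq0 !comp_polyM comp_polyB comp_Xn_poly comp_polyX -[1]/(1%:P) comp_polyC.
have -> : psi \Po 'X^2 = ('X^p - 'X) ^+ 2.
  have := finField_genPoly F; rewrite card_Fp // => ->; rewrite /psi rmorph_prod /= [RHS]expr2.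
  rewrite [X in _ = _ * X](reindex_inj oppr_inj) -big_split /=; apply: eq_bigr => i _.
  rewrite comp_polyB comp_polyX comp_polyC; rewrite !polyCN polyCM; ring.
rewrite -exprM mul2n; have -> : 'X^p = 'X * 'X^(h.*2) :> {poly F} by rewrite -exprS -pE.
apply/eqP; ring.
Qed.

Lemma prod_sqr_neq0 : \prod_(i : F | i != 0) ('X - (i ^+ 2)%:P) = ('X^h - 1) ^+ 2 :> {poly F}.
Proof.
have X0 : 'X != 0 :> {poly F} by rewrite -size_poly_eq0 size_polyX.
apply: (mulfI X0); rewrite -psiE /psi [RHS](bigD1 0) //=.
by rewrite expr0n /= subr0.
Qed.

Section NonzeroLabel.
Variable j : F.
Hypothesis j0 : j != 0.
Let v := j ^+ 2.

Let v0 : v != 0. Proof. exact: expf_neq0. Qed.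

Let Q : {poly F} := ('X^h - 1) %/ ('X - v%:P).

Let QE : 'X^h - 1 = ('X - v%:P) * Q.
Proof.
rewrite mulrC divpK // dvdp_XsubCl rootE !hornerE (fermat j0).
by rewrite subrr.
Qed.

(** With X^h - 1 = (X - v) Q, evaluating this identity and its derivative at v yields Q(v) and
    Q'(v). *)
Let XR : 'X * ('X^h - 1)^`() = h%:R *: 'X^h :> {poly F}.
Proof.
rewrite derivB derivXn -polyC1 derivC subr0 mulrnAr scaler_nat -exprS.
by rewrite prednK // /h; move: p_gt2; lia.
Qed.

Let Qv : v * Q.[v] = h%:R.
Proof.
have := congr1 (fun q => q.[v]) XR; rewrite QE derivM derivXsubC mul1r.
by rewrite !hornerE subrr mul0r addr0 (fermat j0) mulr1.
Qed.

Let Q'v : v ^+ 2 * Q^`().[v] *+ 2 = h%:R * (h%:R - 1).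
Proof.
have := congr1 (fun q => (q^`()).[v]) XR; rewrite derivM derivX mul1r derivZ.
have -> : ('X^h : {poly F})^`() = ('X^h - 1)^`() by rewrite derivB -polyC1 derivC subr0.
have -> : ('X^h - 1 : {poly F})^`() = Q + ('X - v%:P) * Q^`().
  by rewrite QE derivM derivXsubC mul1r.
rewrite derivD derivM derivXsubC mul1r !hornerE subrr !mul0r !addr0 => e.
have e' : v * (Q^`().[v] *+ 2) = (h%:R - 1) * Q.[v].
  by rewrite mulrBl mul1r -e /= addr0; ring.
by rewrite -mulrnAr expr2 -mulrA e' mulrCA Qv mulrC.
Qed.

Let psiQ : psi = 'X * ('X - v%:P) ^+ 2 * Q ^+ 2.
Proof. by rewrite psiE QE; ring. Qed.

Lemma psi_eps1E : psi_eps true j = 'X * ('X - v%:P) * Q ^+ 2.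
Proof.
rewrite /psi_eps psiQ (_ : _ * _ * _ = 'X * ('X - v%:P) * Q ^+ 2 * ('X - v%:P)); last by ring.
by rewrite mulpK // polyXsubC_eq0.
Qed.

Lemma neqN : j != - j.
Proof.
apply: contra_neq j0 => e; have : j * 2%:R = 0 by rewrite mulr_natr mulr2n {2}e subrr.
by move/eqP; rewrite mulf_eq0 (negbTE two_neq0) orbF => /eqP.
Qed.

Lemma prod_sqr_neqj : \prod_(i : F | [&& i != 0, i != j & i != - j]) ('X - (i ^+ 2)%:P) = Q ^+ 2.
Proof.
have X0 : ('X - v%:P) ^+ 2 != 0 by rewrite expf_neq0 // polyXsubC_eq0.
apply: (mulfI X0); rewrite -exprMn -QE -prod_sqr_neq0.
rewrite [RHS](bigD1 j) //= [X in _ = _ * X](bigD1 (- j)) /=; last by rewrite oppr_eq0 j0 eq_sym neqN.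
rewrite sqrrN mulrA -expr2; congr (_ * _); apply: eq_bigl => i.
by rewrite andbA.
Qed.

Lemma psi_eps0E : psi_eps false j = 2%:R *: 'X * ('X + v%:P) * Q ^+ 2.
Proof. by rewrite /psi_eps (negbTE j0) prod_sqr_neqj. Qed.

(** This makes psi^(0) the Chinese remainder idempotent of the factor (X - v)^2 of psi. At v its
    value is (2h)^2 = 1, and v times its derivative is 2(2h + 1)h^2 = 0, since 2h = -1 in the prime
    field. *)
Lemma dvd_psi_eps0 : ('X - v%:P) ^+ 2 %| psi_eps false j - 1.
Proof.
have hq : (2%:R * h%:R : F) = -1 by rewrite mulr_natl h2.
have hq1 : (2%:R * h%:R + 1 : F) = 0 by rewrite hq addNr.
rewrite psi_eps0E; move: Q Qv Q'v; move: v v0 => u u0 q qu q'u; apply: dvdp_XsubC_sqr.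
  rewrite !hornerE /=.
  transitivity ((2%:R * (u * q.[u])) ^+ 2 - 1); first by ring.
  by rewrite qu hq; ring.
apply: (mulfI u0); rewrite mulr0 derivB -polyC1 derivC subr0 expr2 !derivM derivD derivZ derivX derivC addr0.
rewrite !hornerE /=.
transitivity (2%:R * (2%:R * h%:R + 1) * h%:R ^+ 2 : F); last by rewrite hq1 mulr0 mul0r.
transitivity (6%:R * (u * q.[u]) ^+ 2 + 4%:R * (u * q.[u]) * (u ^+ 2 * q^`().[u] *+ 2)); first by ring.
by rewrite qu q'u; ring.
Qed.

Lemma psi_dvd_idem : psi %| psi_eps false j * psi_eps false j - psi_eps false j.
Proof.
rewrite -[X in _ - X]mulr1 -mulrBr {1}psi_eps0E psiQ.
rewrite (_ : 'X * _ * _ = ('X * Q ^+ 2) * ('X - v%:P) ^+ 2); last by ring.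
apply: dvdp_mul dvd_psi_eps0.
by rewrite -scalerAl -scalerAl dvdpZr // mulrAC dvdp_mulIl.
Qed.

Lemma psi_dvd_01 : psi %| psi_eps false j * psi_eps true j - psi_eps true j.
Proof.
rewrite -[X in _ - X]mul1r -mulrBl psi_eps1E psiQ.
rewrite (_ : 'X * _ * _ = ('X - v%:P) * ('X * ('X - v%:P) * Q ^+ 2)); last by ring.
apply: dvdp_mul => //; apply: dvdp_trans dvd_psi_eps0.
by rewrite expr2 dvdp_mulIl.
Qed.

Lemma psi_dvd_11 : psi %| psi_eps true j * psi_eps true j.
Proof.
rewrite psi_eps1E psiQ (_ : _ * _ * _ * _ = ('X * ('X - v%:P) ^+ 2 * Q ^+ 2) * ('X * Q ^+ 2)).
  by rewrite dvdp_mulIl.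
by ring.
Qed.

Lemma psi_dvd_X1 : psi %| 'X * psi_eps true j - v *: psi_eps true j.
Proof.
rewrite -mul_polyC -mulrBl psi_eps1E psiQ.
rewrite (_ : ('X - _) * _ = 'X * ('X - v%:P) ^+ 2 * Q ^+ 2) //; by ring.
Qed.

(** Up to the factor X Q^2, the constant 4v comes from 2(X - v)(X + v) - 4v(X - v) = 2(X - v)^2. *)
Lemma psi_dvd_X0 : psi %| 'X * psi_eps false j - v *: psi_eps false j - (4%:R * v) *: psi_eps true j.
Proof.
rewrite psi_eps0E psi_eps1E psiQ; move: Q; move: v => u q; rewrite -!mul_polyC polyCM.
rewrite (_ : _ - _ - _ = 2%:R%:P * ('X * ('X - u%:P) ^+ 2 * q ^+ 2)).
  by rewrite dvdp_mull.
by rewrite !polyC_natr; ring.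
Qed.

Lemma dvd_psi_eps e : 'X * Q ^+ 2 %| psi_eps e j.
Proof.
case: e; first by rewrite psi_eps1E mulrAC dvdp_mulIl.
by rewrite psi_eps0E -scalerAl -scalerAl dvdpZr // mulrAC dvdp_mulIl.
Qed.

End NonzeroLabel.

Section ZeroLabel.

Lemma psi_eps_zero e : psi_eps e 0 = ('X^h - 1) ^+ 2 :> {poly F}.
Proof.
rewrite /psi_eps eqxx expr0n /= subr0 prod_sqr_neq0; case: e => //.
have X0 : 'X != 0 :> {poly F} by rewrite -size_poly_eq0 size_polyX.
by rewrite psiE mulrC mulpK.
Qed.

Lemma psi_dvd_idem0 : psi %| ('X^h - 1) ^+ 2 * ('X^h - 1) ^+ 2 - ('X^h - 1) ^+ 2.
Proof.
rewrite -[X in _ - X]mulr1 -mulrBr psiE mulrC; apply: dvdp_mul => //.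
suff : root (('X^h - 1) ^+ 2 - 1 : {poly F}) 0 by rewrite -dvdp_XsubCl subr0.
rewrite rootE !hornerE expr0n; have -> : (h == 0)%N = false by move: pE p_gt2; lia.
by rewrite sub0r sqrrN expr1n subrr.
Qed.

End ZeroLabel.

(** A common divisor for both values of [e], large enough to decide the types by comparing roots. *)
Lemma prod_dvd_psi_eps e j :
  \prod_(i : F | (i != j) && (i != - j)) ('X - (i ^+ 2)%:P) %| psi_eps e j.
Proof.
have [->|j0] := eqVneq j 0.
  rewrite psi_eps_zero -prod_sqr_neq0 (eq_bigl (fun i : F => i != 0)) // => i.
  by rewrite oppr0 andbb.
apply: dvdp_trans (dvd_psi_eps j0 e); rewrite -prod_sqr_neqj // (bigD1 0) /=.
  rewrite expr0n /= subr0; apply: dvdp_mul => //.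
  by rewrite (eq_bigl (fun i : F => [&& i != 0, i != j & i != - j])) // => i; rewrite andbC.
by rewrite !(eq_sym 0) oppr_eq0 j0.
Qed.

Lemma size_psi : size psi = p.+1.
Proof. by rewrite /psi size_prod_XsubC /index_enum -enumT -cardE card_Fp. Qed.

Lemma monic_psi : psi \is monic.
Proof. exact: monic_prod_XsubC. Qed.

Lemma psi_eps1_mul (j : F) : psi_eps true j * ('X - (j ^+ 2)%:P) = psi.
Proof.
rewrite /psi_eps divpK // dvdp_XsubCl /root /psi (bigD1 j) //= hornerM hornerXsubC.
by rewrite subrr mul0r.
Qed.

Lemma monic_psi_eps1 (j : F) : psi_eps true j \is monic.
Proof. by have := monic_psi; rewrite -(psi_eps1_mul j) monicMr ?monicXsubC. Qed.

Lemma size_psi_eps1 (j : F) : size (psi_eps true j) = p.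
Proof.
have := size_psi; rewrite -(psi_eps1_mul j) size_Mmonic ?monicXsubC ?monic_neq0 ?monic_psi_eps1 //.
by rewrite size_XsubC addn2 => -[].
Qed.

Lemma size_psi_eps e (j : F) : (size (psi_eps e j) <= p)%N.
Proof.
have [->|j0] := eqVneq j 0; first by rewrite psi_eps_zero -(psi_eps_zero true) size_psi_eps1.
case: e; first by rewrite size_psi_eps1.
have sA := size_psi_eps1 j; have A0 := monic_neq0 (monic_psi_eps1 j).
move: sA A0; rewrite psi_eps1E // psi_eps0E //.
move: (_ %/ _) => q.
have -> : 'X * ('X - (j ^+ 2)%:P) * q ^+ 2 = ('X * q ^+ 2) * ('X - (j ^+ 2)%:P) by ring.
have -> : 2%:R *: 'X * ('X + (j ^+ 2)%:P) * q ^+ 2 = 2%:R *: (('X * q ^+ 2) * ('X + (j ^+ 2)%:P)).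
  by rewrite -!scalerAl; congr (_ *: _); ring.
move: ('X * q ^+ 2) (j ^+ 2) => A c.
move=> sA; rewrite mulf_eq0 negb_or => /andP[A0 _].
apply: leq_trans (size_scale_leq _ _) _; move: sA.
rewrite size_Mmonic ?monicXsubC //.
rewrite size_XsubC => sA.
rewrite size_Mmonic ?monicXaddC //.
rewrite size_XaddC.
by rewrite sA.
Qed.

Definition sqP (b : F) (m n : nat) : {poly F} :=
  \prod_(m <= t < n) ('X - ((b + t%:R) ^+ 2)%:P).

Lemma sqP_uniq (b : F) m n : (n <= p)%N -> uniq [seq b + t%:R | t <- index_iota m n].
Proof.
move=> np; rewrite map_inj_in_uniq ?iota_uniq // => x y.
rewrite !mem_index_iota => /andP[_ xn] /andP[_ yn] /addrI/(congr1 val) /=.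
by rewrite !val_Fp_nat // !modn_small //; lia.
Qed.

Lemma sqP_dvd (b : F) m n (P : pred F) : (n <= p)%N ->
  (forall t, (m <= t < n)%N -> P (b + t%:R)) ->
  sqP b m n %| \prod_(i | P i) ('X - (i ^+ 2)%:P).
Proof.
move=> np hP; have u := sqP_uniq b m np.
rewrite /sqP -(big_map (fun t => b + t%:R) xpredT (fun i => 'X - (i ^+ 2)%:P)) big_uniq //=.
rewrite [X in _ %| X](bigID (mem [seq b + t%:R | t <- index_iota m n])) /=.
rewrite [X in _ %| X * _](eq_bigl (mem [seq b + t%:R | t <- index_iota m n])) ?dvdp_mulIl //.
move=> i; rewrite /= andb_idl // => /mapP[t]; rewrite mem_index_iota => ht ->.
exact: hP.
Qed.

Lemma sqP_full (b : F) : sqP b 0 p = psi.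
Proof.
have u := sqP_uniq b 0 (leqnn p).
rewrite /sqP -(big_map (fun t => b + t%:R) xpredT (fun i => 'X - (i ^+ 2)%:P)) big_uniq //=.
rewrite /psi; apply: eq_bigl => i; apply/mapP.
exists (nat_of_ord (i - b)); last by rewrite natr_Zp addrC subrK.
by rewrite mem_index_iota /= -[X in (_ < X)%N](Fp_cast p_pr) ltn_mod.
Qed.

(** Completing the square: t(a + t + 1) = (b + t)^2 - b^2 for 2b = a + 1. This is the origin of the
    shift by ((a + 1)/2)^2 in the definition of B. *)
Lemma sqP_piP a (b : F) m : 2%:R * b = a%:R + 1 -> sqP b 0 m \Po ('X + (b ^+ 2)%:P) = piP p a m.
Proof.
move=> hb; rewrite /sqP big_mkord rmorph_prod /piP; apply: eq_bigr => t _ /=.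
rewrite comp_polyB comp_polyX comp_polyC -addrA -polyCB; congr (_ + _).
rewrite -polyCN; congr (_%:P).
have -> : a%:R + t%:R + 1 = 2%:R * b + t%:R :> F by rewrite hb; ring.
by ring.
Qed.

End OddPrime.

Section LabelPolynomials.
Variables (k : closedFieldType) (p : nat).
Hypothesis hchar : p \in [pchar k].
Local Notation F := 'F_p.
Local Notation emb := (Fp_emb hchar).
Local Notation muH := (muH k p).
Local Notation ev := (ev hchar).
Let p_pr : prime p. Proof. exact: pcharf_prime hchar. Qed.
Let p0 : (0 < p)%N. Proof. exact: prime_gt0. Qed.

(** All that later arguments need from a label, uniformly in p: the polynomials f_e in YX with their
    relations modulo the killing polynomial, and the divisibility dictated by the type. The
    constants [c] and [c'] describe multiplication by YX; [block_top] serves nonvanishing. *)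
Record is_block (x : label) (f : bool -> {poly F}) (c c' : F) : Prop := IsBlock {
  block_lt : (x.1 < p)%N;
  block_B1 : forall e, B1 k p e x = ev (f e) * muH x.1;
  block_size : forall e, (size (f e) <= p)%N;
  block_top : (f (~~ forced0 p x))`_p.-1 = 1;
  block_defect : forall e, if typeA p x || typeC p x
    then (0 < x.1)%N /\ piP p x.1 (p - x.1) %| f e else xiP p x.1 x.1 %| f e;
  block_shift : typeA p x || typeC p x -> [/\ shift p x <= p - x.1,
    p <= x.1 + 2 * shift p x & x.1 + 2 * shift p x < 2 * p]%N;
  block_00 : piP p x.1 p %| f false * f false - f false;
  block_01 : ~~ forced0 p x -> piP p x.1 p %| f false * f true - f true;
  block_11 : ~~ forced0 p x -> piP p x.1 p %| f true * f true;
  block_X0 : piP p x.1 p %| 'X * f false - c *: f false - c' *: f true;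
  block_c' : forced0 p x -> c' = 0;
  block_X1 : ~~ forced0 p x -> piP p x.1 p %| 'X * f true - c *: f true }.

Lemma Fp_to_kE c : Fp_to_k k c = emb c. Proof. by []. Qed.

Lemma eval_Fp_muH a (q : {poly F}) c :
  eval_Fp q (muH a * hY k * hX k + emb c *: 1) * muH a = ev (q \Po ('X + c%:P)) * muH a.
Proof.
set u := _ + _ *: 1.
have uM : u * muH a = muH a * ev ('X + c%:P).
  rewrite /u evD evX evC mulrDl mulrDr mulr_algl mulr_algr; congr (_ + _).
  rewrite -[muH a * _ * _]mulrA -[hY k * hX k]/(casYX k) -(evX hchar).
  by rewrite -mulrA -muH_ev mulrA muH_idem.
elim/poly_ind: q => [|q b IH].
  by rewrite /eval_Fp map_poly0 rmorph0 comp_poly0 ev0.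
rewrite comp_poly_MXaddC evD evM evC mulrDl.
have -> : eval_Fp (q * 'X + b%:P) u = eval_Fp q u * u + (emb b)%:A.
  rewrite /eval_Fp -[@Fp_to_k k p]/(emb : F -> k) !rmorphD !rmorphM /= map_polyX map_polyC /=.
  by rewrite horner_algX horner_algC.
by rewrite mulrDl -mulrA uM mulrA IH -mulrA muH_ev mulrA.
Qed.

Section Odd.
Hypothesis p_odd : p != 2%N.
Variables (a s : nat).
Hypothesis ap : (a < p)%N.
Hypothesis sp : (s <= p.-1./2)%N.
Let x : label := (a, s%:R).
Let j : F := s%:R.
Let b : F := (a%:R + 1) / 2%:R.
Let odd_p : odd p. Proof. by case: (even_prime p_pr) => // e; move: p_odd; rewrite e. Qed.
Let p_gt2 : (2 < p)%N. Proof. by have := prime_gt1 p_pr; move: p_odd; lia. Qed.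
Let f e : {poly F} := psi_eps e j \Po ('X + (b ^+ 2)%:P).

Let hb : 2%:R * b = a%:R + 1.
Proof.
rewrite /b mulrCA divff ?mulr1 // -(dvdn_pcharf (Fp_pchar p_pr)) gtnNdvd //.
Qed.

Lemma typeA_odd : typeA p x = [&& ~~ odd a, (p + 1 <= 2 * s + a)%N & (2 * s < p)%N].
Proof.
rewrite /typeA /= p_odd /=; congr [&& _, _ & _].
  by rewrite -(Num.Theory.ler_nat rat) [(p + 1)%:R]natrD [(2 * s + a)%:R]natrD natrM; apply/idP/idP => ?; lra.
by rewrite -[(2 * s < _)%N]/((2 * s).+1 <= _)%N -[(2 * s).+1]addn1 -(Num.Theory.ler_nat rat) [(2 * s + 1)%:R]natrD natrM; apply/idP/idP => ?; lra.
Qed.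

Lemma typeC_odd : typeC p x = odd a && (2 * s < a)%N.
Proof.
rewrite /typeC /= (negbTE p_odd); congr (_ && _).
have -> : (0 <= s%:R :> rat) by exact: Num.Theory.ler0n.
by rewrite /= -[(2 * s < _)%N]/((2 * s).+1 <= _)%N -[(2 * s).+1]addn1 -(Num.Theory.ler_nat rat) [(2 * s + 1)%:R]natrD natrM; apply/idP/idP => ?; lra.
Qed.

Lemma forced0_odd : forced0 p x = (j == 0).
Proof.
rewrite /forced0 (negbTE p_odd) /= Num.Theory.pnatr_eq0 -(dvdn_pcharf (Fp_pchar p_pr)).
have [->|s0] := posnP s; first by rewrite dvdn0.
by rewrite gtnNdvd // (leq_trans (n := p.-1./2.+1)) // ltn_half_double; lia.
Qed.

Lemma B1_odd e : B1 k p e x = ev (f e) * muH a.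
Proof.
by rewrite /B1 /x (negbTE p_odd) (mu_muH hchar) // Fp_to_kE eval_Fp_muH ratr_nat.
Qed.

Lemma comp_dvd (q r : {poly F}) : q %| r ->
  (q \Po ('X + (b ^+ 2)%:P)) %| (r \Po ('X + (b ^+ 2)%:P)).
Proof. by case/dvdpP => t ->; rewrite comp_polyM dvdp_mull. Qed.

Lemma psi_comp : psi p \Po ('X + (b ^+ 2)%:P) = piP p a p.
Proof. by rewrite -(sqP_full p_pr p_odd b) (sqP_piP p hb). Qed.

Lemma sqP_xiP : sqP b (p - a) p \Po ('X + (b ^+ 2)%:P) = xiP p a a.
Proof.
have n0 : piP p a (p - a) != 0 by rewrite monic_neq0 ?monic_piP.
apply: (mulfI n0); rewrite -(piP_xiP hchar) // -(sqP_piP p hb) -(sqP_piP (p - a) hb) -comp_polyM.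
by rewrite /sqP -big_cat_nat //= leq_subr.
Qed.

(** After doubling, the hypothesis says that b + t is neither -j nor j for t in the range; p - s
    replaces -s to stay within natural numbers. *)
Lemma dvd_f e m n : (n <= p)%N ->
  (forall t, (m <= t < n)%N -> ~~ (p %| a + 1 + 2 * t + 2 * s)%N /\
                             ~~ (p %| a + 1 + 2 * t + 2 * (p - s))%N) ->
  sqP b m n \Po ('X + (b ^+ 2)%:P) %| f e.
Proof.
move=> np h; apply: comp_dvd; apply: dvdp_trans (prod_dvd_psi_eps p_pr p_odd e j).
apply: sqP_dvd => // t /h[h1 h2]; have char2 := Fp_pchar p_pr.
have sp' : (s <= p)%N by lia.
have e0 : 2%:R * (b + t%:R + j) = (a + 1 + 2 * t + 2 * s)%:R :> F.
  by rewrite !mulrDr hb /j (natrD _ (_ + 2 * t)) (natrD _ (a + 1)) (natrD _ a) !natrM.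
have e1 : 2%:R * (b + t%:R - j) = (a + 1 + 2 * t + 2 * (p - s))%:R :> F.
  by rewrite mulrBr mulrDr hb /j (natrD _ (_ + 2 * t)) (natrD _ (a + 1)) (natrD _ a) !natrM natrB // (pcharf0 char2) sub0r mulrN.
apply/andP; split; apply/eqP => et.
  by move: h2; rewrite (dvdn_pcharf char2) -e1 et subrr mulr0 eqxx.
by move: h1; rewrite (dvdn_pcharf char2) -e0 et addNr mulr0 eqxx.
Qed.

(** The only multiple of p strictly inside the interval is (m + 1)p, whose parity is that of m + 1
    because p is odd. *)
Lemma ndvd_parity N m : (m * p < N < m.+2 * p)%N -> odd N != odd m.+1 -> ~~ (p %| N)%N.
Proof.
move=> h; apply: contraNN => /dvdnP[q e]; move: h; rewrite e !ltn_mul2r p0 /= => h.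
have -> : q = m.+1 by lia.
by rewrite oddM odd_p andbT.
Qed.

Lemma block_odd : exists c c', is_block x f c c'.
Proof.
have typeE : typeA p x || typeC p x = if odd a then (2 * s < a)%N else (p + 1 <= 2 * s + a)%N.
  rewrite typeA_odd typeC_odd; case: (odd a); rewrite ?andbF //= orbF andbC.
  by case: leqP => //= h; lia.
(* The argument of psi is YX + b^2, so the eigenvalue j^2 of the argument becomes j^2 - b^2 for YX;
   4j^2 is the constant of [psi_dvd_X0]. *)
exists (j ^+ 2 - b ^+ 2), (if j == 0 then 0 else 4%:R * j ^+ 2).
have fE e : f e = psi_eps e j \Po ('X + (b ^+ 2)%:P) by [].
have compX (q : {poly F}) : 'X * (q \Po ('X + (b ^+ 2)%:P)) - (j ^+ 2 - b ^+ 2) *: (q \Po ('X + (b ^+ 2)%:P)) =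
   ('X * q - j ^+ 2 *: q) \Po ('X + (b ^+ 2)%:P).
  rewrite comp_polyB comp_polyM comp_polyX comp_polyZ mulrDl scalerBl mul_polyC opprB addrA.
  by rewrite addrAC.
split=> //=.
- exact: B1_odd.
- by move=> e; rewrite size_comp_poly2 ?size_XaddC // size_psi_eps.
- rewrite forced0_odd; have -> : f (j != 0) = f true.
    by rewrite /f; case: eqVneq => // ->; rewrite !psi_eps_zero.
  have s1 : size (f true) = p by rewrite size_comp_poly2 ?size_XaddC // size_psi_eps1.
  have : lead_coef (f true) = 1.
    rewrite lead_coef_comp ?size_XaddC // lead_coefXaddC expr1n mulr1.
    by apply/monicP; exact: monic_psi_eps1.
  by rewrite lead_coefE s1.
(* In each type a + 1 + 2t + 2s and a + 1 + 2t + 2(p - s) stay, over the relevant range of t,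
   strictly between two multiples of p at distance 2p, and their parity excludes the multiple in the
   middle. *)
- move=> e; rewrite typeE; have sp2 : (2 * s < p)%N by lia.
  case: (boolP (odd a)) => oa; case: ifP => hs.
  + split; first by lia.
    rewrite -(sqP_piP (p - a) hb); apply: dvd_f => [|t ht]; first exact: leq_subr.
    split; [apply: (ndvd_parity (m := 0))|apply: (ndvd_parity (m := 2))];
      rewrite ?oddD ?oddM ?oa //=; lia.
  + rewrite -sqP_xiP; apply: dvd_f => // t ht.
    by split; apply: (ndvd_parity (m := 2)); rewrite ?oddD ?oddM ?oa //=; lia.
  + split; first by lia.
    rewrite -(sqP_piP (p - a) hb); apply: dvd_f => [|t ht]; first exact: leq_subr.
    by split; apply: (ndvd_parity (m := 1)); rewrite ?oddD ?oddM ?(negbTE oa) //=; lia.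
  rewrite -sqP_xiP; apply: dvd_f => // t ht.
  split; [apply: (ndvd_parity (m := 1))|apply: (ndvd_parity (m := 3))];
    rewrite ?oddD ?oddM ?(negbTE oa) //=; lia.
- rewrite typeE /shift (negbTE p_odd) /=; case: (boolP (odd a)) => oa hs; split; lia.
- rewrite -psi_comp !fE -comp_polyM -comp_polyB; apply: comp_dvd.
  have [->|j0] := eqVneq j 0; last exact: psi_dvd_idem.
  by rewrite psi_eps_zero //; exact: psi_dvd_idem0.
- rewrite forced0_odd => j0; rewrite -psi_comp !fE -comp_polyM -comp_polyB; apply: comp_dvd.
  exact: psi_dvd_01.
- rewrite forced0_odd => j0; rewrite -psi_comp !fE -comp_polyM; apply: comp_dvd.
  exact: psi_dvd_11.
- rewrite !fE compX -comp_polyZ -comp_polyB -psi_comp; apply: comp_dvd.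
  have [->|j0] := eqVneq j 0; last exact: psi_dvd_X0.
  by rewrite !(psi_eps_zero p_pr p_odd) expr0n !scale0r !subr0 -psiE.
- by rewrite forced0_odd => ->.
rewrite forced0_odd => j0; rewrite fE compX -psi_comp; apply: comp_dvd.
exact: psi_dvd_X1.
Qed.

End Odd.
End LabelPolynomials.

Lemma piP_two a : piP 2 a 2 = 'X * ('X - a%:R%:P).
Proof.
rewrite /piP !big_ord_recl big_ord0 mulr1 mul0r subr0 mul1r.
have two : 2%:R = 0 :> 'F_2 by exact: val_inj.
by rewrite -addrA [_ + 1](_ : _ = 0) ?addr0 // -[RHS]two.
Qed.

(** The killing polynomial is X^2 for a = 0 and X(X - 1) for a = 1: the former gives the pair 1 and
    X with X nilpotent, the latter the two idempotents X and X + 1. *)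
Lemma block_two (k : closedFieldType) (hchar : 2%N \in [pchar k]) (x : label) : in_P 2%N x ->
  exists f c c', is_block hchar x f c c'.
Proof.
have opp2 : -1 = 1 :> 'F_2 by exact: val_inj.
have two : 2%:R = 0 :> 'F_2 by exact: val_inj.
have ev1' a : ev hchar ('X + 1) * muH k 2 a = muH k 2 a * hY k * hX k + muH k 2 a.
  by rewrite evD ev1 mulrDl mul1r -muH_ev evX mulrA.
have XX : 'X * 'X - 'X = 'X * ('X - 1) :> {poly 'F_2} by ring.
rewrite /in_P eqxx !inE => /or3P[]/eqP ->.
- exists (fun e => if e then 'X else 1), 0, 1; split=> //=.
  + case; first by rewrite evX /B1 /= (mu_muH hchar) // -(evX hchar) -muH_ev evX mulrA.
    by rewrite /B1 /= (mu_muH hchar) // ev1 mul1r.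
  + by case; rewrite ?size_polyX ?size_poly1.
  + by rewrite coefX.
  + by case; rewrite /xiP big_ord0 dvd1p.
  + by rewrite mulr1 subrr dvdp0.
  + by rewrite mul1r subrr dvdp0.
  + by rewrite piP_two subr0.
  + by rewrite scale0r scale1r subr0 mulr1 subrr dvdp0.
  + by rewrite piP_two subr0 scale0r subr0.
- exists (fun=> 'X), 1, 0; split=> //=.
  + by move=> e; rewrite /B1 /= (mu_muH hchar) // -muH_ev evX mulrA.
  + by rewrite size_polyX.
  + by rewrite coefX.
  + by move=> _; rewrite /piP big_ord1 mul0r subr0.
  + by rewrite piP_two XX.
  + by rewrite piP_two scale1r scale0r subr0 XX.
exists (fun=> 'X + 1), 0, 0; split=> //=.
- by move=> e; rewrite /B1 /= (mu_muH hchar) // ev1'.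
- by move=> _; rewrite -polyC1 size_XaddC.
- by rewrite coefD coefX coef1 addr0.
- by move=> _; rewrite /xiP big_ord1 mul1r subr0.
- rewrite piP_two -polyCN opp2 polyC1.
  by have -> : ('X + 1) * ('X + 1) - ('X + 1) = 'X * ('X + 1) :> {poly 'F_2} by ring.
by rewrite piP_two !scale0r !subr0 -polyCN opp2.
Qed.

Lemma label_block (k : closedFieldType) (p : nat) (hchar : p \in [pchar k]) (x : label) :
  in_P p x -> exists f c c', is_block hchar x f c c'.
Proof.
have [p2|p2] := eqVneq p 2%N; first by subst p; exact: block_two.
rewrite /in_P (negbTE p2); case: x => a j /= [ap [s sp ->]].
have [c [c' h]] := block_odd hchar p2 ap sp.
by eexists; exists c, c'; exact: h.
Qed.

Lemma sum_divmod (V : zmodType) (F : nat -> V) N p :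
  \sum_(M < N * p) F M = \sum_(m < N) \sum_(i < p) F (m * p + i)%N.
Proof.
elim: N => [|N IH]; first by rewrite !big_ord0.
rewrite big_ord_recr /= -IH -(big_mkord xpredT F) (@big_cat_nat _ _ _ (N * p)) //=.
  rewrite big_mkord mulSn; congr (_ + _).
  rewrite -[LHS]/(\sum_(0 + N * p <= i < p + N * p) F i) big_addn addnK big_mkord.
  by apply: eq_bigr => i _; rewrite addnC.
by rewrite leq_mul2r leqnSn orbT.
Qed.

(** * Products of the elements B *)

Section OneLabel.
Variables (k : closedFieldType) (p : nat).
Hypothesis hchar : p \in [pchar k].
Local Notation U := (hyper k).
Local Notation kb := (kbin k).
Local Notation loc_const := (@loc_const k p).
Local Notation periodic := (@periodic k p).
Local Notation Hfun := (@Hfun k).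
Local Notation central1 := (@central1 k p).
Local Notation emb := (Fp_emb hchar).
Local Notation muH := (muH k p).
Local Notation ev := (ev hchar).
Local Notation ind := (ind k p).
Local Notation phi := (phi hchar).
Local Notation pbw := (@pbw k).
Local Notation zbox := (zbox p).
Let p_pr : prime p. Proof. exact: pcharf_prime hchar. Qed.
Let p0 : (0 < p)%N. Proof. exact: prime_gt0. Qed.

Lemma loc_const_phi (d : int) n : loc_const (fun z => kb ((z %/ p)%Z + d) n).
Proof. by apply: (loc_const_divp hchar d (f := kb^~ n)); exact: loc_const_kbin0. Qed.

Lemma phi_central1 d v b : pbw diag v -> central1 b -> phi d v * b = b * phi d v.
Proof.
move=> + [b1 b2 b3]; move: v; apply: kspan_eq.
- by move=> t u v; rewrite phi_linear mulrDl scalerAl.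
- by move=> t u v; rewrite phi_linear mulrDr scalerAr.
move=> _ [m [n [_ [<- ->]]]]; rewrite phi_bas.
by rewrite -mulrA b1 mulrA -[_ * _ * b]mulrA b3 ?[RHS]mulrA ?mulrA -?b2; [|exact: loc_const_phi].
Qed.

Lemma phi1 d : phi d 1 = 1.
Proof.
rewrite -(bas000 k) phi_bas divX0 divY0 mul1r mulr1 bas000.
rewrite -(Hfun_kbin0 hchar 0); apply: eq_Hfun => z; by rewrite !kbin0.
Qed.

Lemma phi_sum d (I : Type) (s : seq I) (P : pred I) (F : I -> U) :
  phi d (\sum_(i <- s | P i) F i) = \sum_(i <- s | P i) phi d (F i).
Proof.
have lp := phi_linear hchar d.
apply: (big_morph (phi d)) => [u v|]; first by have := lp 1 u v; rewrite !scale1r.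
by have := lp (-1) 0 0; rewrite scaleN1r oppr0 addr0 scaleN1r addNr.
Qed.

Lemma phi_zbox d r v : pbw (zbox r) v -> pbw (zbox r.+1) (phi d v).
Proof.
move: v; apply: kspan_linear => [|_ [m [n [_ [[<- mr nr] ->]]]]]; first exact: phi_linear.
rewrite phi_bas; apply: (@pbw_Hfun _ _ hchar _ r.+1) => [z|n' n'r].
  have -> : (z + (p ^ r.+1)%N%:Z = z + p%:Z * (p ^ r)%N%:Z)%R by rewrite expnS PoszM.
  by rewrite (divp_shift hchar) addrAC (kbin_periodic hchar).
by split=> //; rewrite expnSr ltn_mul2r p0.
Qed.

Lemma pbw_diagE b : pbw diag b -> exists N (g : nat -> int -> k),
  (forall m, loc_const (g m)) /\ b = \sum_(m < N) divY k m * Hfun (g m) * divX k m.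
Proof.
move=> hb; have [N [c [_ hc ->]]] := pbw_lincomb hchar hb; exists N, (fun m z => \sum_(n < N) c m n m * kb z n).
have hv m : hval (\sum_(n < N) c m n m *: binH k 0 n) (fun z => \sum_(n < N) c m n m * kb z n).
  by exists N, (fun n => c m n m).
split=> [m|]; first exact: hval_loc_const (hv m).
apply: eq_bigr => m _; rewrite -(Hfun_eq hchar (hv m)) mulr_sumr mulr_suml.
rewrite (bigD1 m) //= [X in _ + X]big1 ?addr0 => [|m' m'm].
  by apply: eq_bigr => n _; rewrite -scalerAr -scalerAl.
apply: big1 => n _; have [->|/hc e] := eqVneq (c m n m') 0; first by rewrite scale0r.
by move: m'm; rewrite -val_eqE /= -e eqxx.
Qed.

Section Block.
Variables (x : label) (f : bool -> {poly 'F_p}) (c c' : 'F_p).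
Hypothesis hx : is_block hchar x f c c'.
Local Notation B e := (B1 k p e x).
Local Notation a := x.1.
Local Notation d := (typeA p x || typeC p x).

Lemma block_central e : central1 (B e).
Proof. exact: (central1_B1 (block_B1 hx)). Qed.

Lemma block_muH e : muH a * B e = B e.
Proof. exact: (muH_B1 (block_B1 hx)). Qed.

Lemma block_phi_mul e u v : pbw diag u -> pbw diag v ->
  phi d%:Z u * phi d%:Z v * B e = phi d%:Z (u * v) * B e.
Proof. exact: (phi_mulB (block_lt hx) (block_B1 hx) (block_defect hx)). Qed.

Lemma block_Zmap e z : pbw diag z -> Zmap p e z x = phi d%:Z z * B e.
Proof.
exact: (Zmap_phi (block_lt hx) erefl (block_B1 hx) (block_size hx) erefl (block_defect hx)
  (block_shift hx)).
Qed.

Lemma block_evM q q' : ev q * muH a * (ev q' * muH a) = ev (q * q') * muH a.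
Proof. by rewrite mulrA -[_ * muH a * _]mulrA muH_ev mulrA -evM -mulrA muH_idem. Qed.

Lemma block_mul e e' : (forced0 p x -> ~~ e && ~~ e') ->
  B e * B e' = if e && e' then 0 else B (e || e').
Proof.
rewrite !(block_B1 hx) block_evM.
have := block_00 hx; have := block_01 hx; have := block_11 hx.
case: (forced0 p x) => /= [_ _ h00 /(_ isT)|/(_ isT) h11 /(_ isT) h01 h00 _].
  by case: e e' => -[] //= _; exact: ev_congr.
case: e e' => -[] /=; try exact: ev_congr; first exact: ev_piP_eq0.
by rewrite mulrC; exact: ev_congr.
Qed.

(** YX acts triangularly on the pair B^(0), B^(1), and by a scalar when only one of them is
    available or when e = 1. *)
Lemma block_evB1 q e : (forced0 p x -> ~~ e) ->
  exists al be, ev q * B e = al *: B e + be *: B true /\ (e || forced0 p x -> be = 0).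
Proof.
move=> he; elim/poly_ind: q => [|q b [al [be [IH hbe]]]].
  by exists 0, 0; rewrite ev0 mul0r !scale0r addr0.
have X0 : ev 'X * B false = emb c *: B false + emb c' *: B true.
  rewrite !(block_B1 hx) mulrA -evM !scalerAl -!evZ -mulrDl -evD.
  by apply: ev_congr; have := block_X0 hx; rewrite opprD addrA.
have X1 : ~~ forced0 p x -> ev 'X * B true = emb c *: B true.
  move=> nf; rewrite !(block_B1 hx) mulrA -evM !scalerAl -!evZ.
  exact: ev_congr (block_X1 hx nf).
rewrite evD mulrC evM evC mulrDl -mulrA IH mulrDr -!scalerAr mulr_algl.
case: e he IH hbe => /= [he _ /(_ isT) ->|_ _ hbe].
  have nf : ~~ forced0 p x by apply/negP => /he.
  exists (al * emb c + emb b), 0; rewrite X1 // !scale0r !addr0 scalerA scalerDl; split=> //.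
rewrite X0; move: hbe; case: (boolP (forced0 p x)) => nf /= => [/(_ isT) ->|_].
  have -> : emb c' = 0 by rewrite (block_c' hx nf) rmorph0.
  exists (al * emb c + emb b), 0; rewrite !scale0r !addr0 scalerA scalerDl; split=> //.
exists (al * emb c + emb b), (al * emb c' + be * emb c); split=> //.
rewrite X1 // scalerDr !scalerA !scalerDl -!addrA; congr (_ + _).
by rewrite addrA addrC.
Qed.

(** Write M = mp + i. The factor Y^(i) X^(i) acts on the residue a as a polynomial in YX; once the
    residue is fixed, the rest depends on the weight through floor(z/p) only, so it agrees there
    with a value of [phi]. *)
Lemma block_act r M N : (M < p ^ r.+1)%N -> (N < p ^ r.+1)%N ->
  exists z q, pbw (zbox r) z /\ forall e u, pbw diag u ->
    bas k M N M * (phi d%:Z u * B e) = phi d%:Z (z * u) * (ev q * B e).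
Proof.
move=> Mr Nr; set m := (M %/ p)%N; set i := (M %% p)%N.
have ME : M = (m * p + i)%N by exact: divn_eq.
have ip : (i < p)%N by rewrite ltn_mod.
(* The weight with residue a and floor quotient z - d is p(z - d) + a; the summand 2i comes from
   moving the torus part past Y^(i). *)
pose g (z : int) : k := kb (p%:Z * (z - d%:Z) + (a + 2 * i)%N%:Z) N.
have gr : periodic r g.
  move=> z; rewrite /g (_ : _ + _ = p%:Z * (z - d%:Z) + (a + 2 * i)%N%:Z + (p ^ r.+1)%N%:Z).
    by rewrite (kbin_periodic hchar).
  by rewrite expnS PoszM; ring.
have mr : (m < p ^ r)%N by rewrite ltn_divLR // -expnSr.
have zr : pbw (zbox r) (divY k m * Hfun g * divX k m) by apply: (pbw_Hfun hchar gr).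
have zd : pbw diag (divY k m * Hfun g * divX k m) by apply: (pbw_diag_Hfun hchar); exists r.
exists (divY k m * Hfun g * divX k m), ((i`!%:R * i`!%:R)^-1 *: piP p a i).
set q := _ *: piP _ _ _; split=> // e u hu.
set b := ev q * B e.
have bc : central1 b by apply: central1M; [exact: central1_ev | exact: block_central].
have bmu : muH a * b = b by rewrite /b mulrA muH_ev -mulrA block_muH.
have [T1 _ _] := central1_YXs hchar ip; have Tc := central1_YXs hchar ip.
have TB : divY k i * divX k i * B e = b.
  rewrite /b -(block_muH e) !mulrA; congr (_ * _).
  by rewrite (YX_muH hchar) // evZ fmorphV rmorphM rmorph_nat scalerAl.
have -> : bas k M N M = divY k (m * p) * Hfun (fun z => kb (z + 2 * i%:Z) N) * divX k (m * p)
    * (divY k i * divX k i).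
  rewrite (bas_Hfun hchar) {1 2}ME (divY_split hchar) // (divX_split hchar) //.
  rewrite -[RHS]mulrA T1 !mulrA; do 2 congr (_ * _).
  rewrite -mulrA (divY_Hfun hchar); last exact: loc_const_kbin.
  by rewrite mulrA; do 2 congr (_ * _); apply: eq_Hfun => z; congr kbin; ring.
rewrite -mulrA [_ * (phi _ _ * _)]mulrA -phi_central1 // -[phi _ u * _ * _]mulrA TB.
have [mu1 mu2 mu3] := central1_muH hchar a; have muc := central1_muH hchar a.
have lh : loc_const (fun z => kb (z + 2 * i%:Z) N).
  exact: loc_const_kbin.
have lg : loc_const (fun z => g ((z %/ p)%Z + d%:Z)) by apply: loc_const_divp => //; exists r.
have push h : loc_const h -> divY k (m * p) * Hfun h * divX k (m * p) * (phi d%:Z u * b) =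
    divY k (m * p) * (Hfun h * muH a) * divX k (m * p) * (phi d%:Z u * b).
  move=> hh; rewrite -{1}bmu [phi _ _ * (muH a * _)]mulrA phi_central1 // -!mulrA.
  by congr (_ * (_ * _)); rewrite mulrA mu1 -!mulrA.
rewrite push // (@Hfun_muH _ _ hchar a _ _ lh lg) => [|z za].
  rewrite -push // -(phi_Hfun hchar) //; last by exists r.
  have sw w b' : pbw diag w -> phi d%:Z w * (ev q * b') = ev q * (phi d%:Z w * b').
    by move=> hw; rewrite mulrA (phi_central1 _ hw (central1_ev hchar q)) mulrA.
  rewrite /b !sw //; last exact: (pbw_diagM hchar).
  by congr (_ * _); rewrite mulrA; exact: block_phi_mul.
rewrite /g addrK; congr kbin; have pz := pz_neq0 hchar.
rewrite {1}(divz_eq z p); have -> : (z %% p)%Z = a%:Z by have := modz_ge0 z pz; lia.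
by rewrite PoszD PoszM mulrC addrA.
Qed.

(** The coefficient of Y^(p-1) X^(p-1) in the top member is 1. As (m, i) is recovered from mp + i,
    the terms of index mp + p - 1 are independent and determine the torus parts of [b]. *)
Lemma block_top_neq0 b : pbw diag b -> phi d%:Z b * B (~~ forced0 p x) = 0 -> b = 0.
Proof.
move=> hb; have [N [g [lg eb]]] := pbw_diagE hb.
set e := ~~ _; have d0 : piP p a 0 %| f e by rewrite /piP big_ord0 dvd1p.
have [co [Bco _]] := B1_expansion (block_lt hx) erefl (block_B1 hx) (block_size hx) d0.
rewrite (block_top hx) => co1 e0.
suff g0 m z : (m < N)%N -> g m z = 0.
  rewrite eb big1 // => m _; have -> : Hfun (g m) = 0.
    by rewrite (eq_Hfun (g := fun=> 0)) ?(Hfun_cst hchar) ?scale0r // => z; exact: g0.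
  by rewrite mulr0 mul0r.
move=> mN; pose G m z := g m ((z %/ p)%Z + d%:Z) * ind a z.
have lG i : loc_const (G i).
  by apply: loc_constM; [exact: loc_const_divp | exact: loc_const_ind].
pose w i : k := emb (co i) * (i`!%:R * i`!%:R).
pose F M z := w (M %% p)%N * G (M %/ p)%N (z - 2 * (M %% p)%N%:Z).
pose h M := w (M %% p)%N *: Hfun (fun z => G (M %/ p)%N (z - 2 * (M %% p)%N%:Z)).
pose F2 (M M' : nat) z := (M == M')%:R * F M z.
pose h2 (M M' : nat) := (M == M')%:R *: h M.
have hF M M' : hval (h2 M M') (F2 M M').
  by apply/hvalZ/hvalZ/(HfunP hchar); exact: loc_const_shift.
have pp : (p.-1 < p)%N by lia.
(* After the shift by 2(p - 1) the chosen weight has residue a and floor quotient z - d, so the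
   function is read off at z. *)
have := @triangular_indep _ (N * p) h2 F2 hF _ (m * p + p.-1) (m * p + p.-1)
  (p%:Z * (z - d%:Z) + a%:Z + 2 * p.-1%:Z).
rewrite /F2 eqxx mul1r /F /w modnMDl modn_small // divnMDl // divn_small // addn0.
rewrite co1 rmorph1 mul1r /G addrK.
have -> : ((p%:Z * (z - d%:Z) + a%:Z) %/ p)%Z + d%:Z = z.
  by rewrite [p%:Z * _ + _]addrC (divp_shift hchar) divz_nat divn_small ?(block_lt hx) // add0r subrK.
have -> : ind a (p%:Z * (z - d%:Z) + a%:Z) = 1.
  by rewrite /ind mulrC modzMDl modz_small ?eqxx //; have := block_lt hx; lia.
rewrite mulr1 => h1; have /eqP : p.-1`!%:R * p.-1`!%:R * g m z = 0.
  have mNp : (m * p + p.-1 < N * p)%N.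
    by have : (m.+1 * p <= N * p)%N; [rewrite leq_mul2r mN orbT | rewrite mulSn; lia].
  apply: h1 => //.
  rewrite -[RHS]e0 eb phi_sum Bco mulr_suml.
  transitivity (\sum_(M < N * p) divY k M * h M * divX k M).
    apply: eq_bigr => M _; rewrite (bigD1 M) //= big1 => [|M' M'M].
      by rewrite /h2 eqxx scale1r addr0.
    by rewrite /h2 eq_sym val_eqE (negbTE M'M) scale0r mulr0 mul0r.
  rewrite (sum_divmod (fun M => divY k M * h M * divX k M)); apply: eq_bigr => m' _.
  rewrite (phi_Hfun hchar) // mulr_sumr mulr_sumr; apply: eq_bigr => i _.
  have ip := ltn_ord i; have [mu1 _ _] := central1_muH hchar a.
  have [T1 _ _] := central1_YXs hchar ip.
  rewrite /h modnMDl modn_small // divnMDl // divn_small // addn0.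
  rewrite -scalerAr -scalerAl -!scalerAr -scalerA; congr (_ *: _).
  have -> : hY k ^+ i * hX k ^+ i = (i`!%:R * i`!%:R) *: (divY k i * divX k i).
    by rewrite hY_exp hX_exp -scalerAl -scalerAr scalerA.
  rewrite -!scalerAr; congr (_ *: _).
  rewrite (divY_split hchar) // (divX_split hchar) //.
  have -> : divY k (m' * p) * divY k i * Hfun (fun z => G m' (z - 2 * i%:Z)) =
      divY k (m' * p) * (Hfun (fun z => g m' ((z %/ p)%Z + d%:Z)) * muH a) * divY k i.
    rewrite -mulrA -(Hfun_divY hchar) // mulrA (HfunM hchar) //.
    - exact: loc_const_divp.
    - exact: loc_const_ind.
  rewrite -!mulrA; congr (_ * (_ * _)).
  by rewrite [divX k (m' * p) * _]mulrA mu1 -mulrA T1 !mulrA.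
by rewrite !mulf_eq0 (negbTE (fact_lt_neq0 hchar pp)) => /eqP.
Qed.

End Block.
End OneLabel.

(** * Induction along a sequence of labels *)

Section LabelSequences.
Variables (k : closedFieldType) (p : nat).
Hypothesis hchar : p \in [pchar k].
Local Notation U := (hyper k).
Local Notation ev := (ev hchar).
Local Notation phi := (phi hchar).
Local Notation pbw := (@pbw k).
Local Notation zbox := (zbox p).
Let p_pr : prime p. Proof. exact: pcharf_prime hchar. Qed.
Let p0 : (0 < p)%N. Proof. exact: prime_gt0. Qed.

Local Notation Bs es xs := (B_seq k p (zip es xs)).
Local Notation dl x := (typeA p x || typeC p x)%:Z.

Lemma Ar_alg r : subalgebra (Ar_set p r : set U).
Proof.
split; first exact: Ar_subring.
by move=> c u [h1 h2]; split; [case: (hyperA_alg k p) => _; apply | case: (hyper_trunc_alg k p r) => _; apply].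
Qed.

Lemma zbox_diag r u : pbw (zbox r) u -> pbw diag u.
Proof. by apply: pbw_sub => m n m' []. Qed.

Lemma Ar_B1 r e x : in_P p x -> Ar_set p r.+1 (B1 k p e x).
Proof.
move=> hx; have [f [c [c' /block_B1 ->]]] := label_block hchar hx.
have A := Ar_alg r.+1; have p1 := prime_gt1 p_pr.
have pr1 : (1 < p ^ r.+1)%N by rewrite -(exp1n r.+1) ltn_exp2r.
apply: (algM A).
  elim/poly_ind: (f e) => [|q b IH]; first by rewrite ev0; exact: (alg0 A).
  rewrite evD evM evX evC; apply: (algD A); last by apply: (algZ A); exact: (alg1 A).
  apply: (algM A) => //; apply/(ArP hchar); apply: kspan_gen; exists 1%N, 0%N, 1%N.
  split; first by split=> //; lia.
  by rewrite /bas divX1 divY1 binH_binp binp0 rmorph1 to_hyper1 mulr1.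
have := @pbw_Hfun k p hchar (zbox r.+1) r.+1 (ind k p x.1) 0 0.
rewrite divX0 divY0 mulr1 mul1r => h; apply/(ArP hchar); apply: h.
  by apply: (periodic_leq (r := 1)) => //; exact: ind_periodic.
by move=> n nr; split=> //; rewrite expn_gt0 p0.
Qed.

Definition all_P (xs : seq label) : Prop := forall x, x \in xs -> in_P p x.

Lemma all_P_cons x xs : all_P (x :: xs) -> in_P p x /\ all_P xs.
Proof.
by move=> h; split=> [|y yx]; apply: h; rewrite inE ?eqxx // yx orbT.
Qed.

Lemma Bs_cons_diag x xs e es : in_P p x -> size es = size xs -> pbw diag (Bs es xs) ->
  Bs (e :: es) (x :: xs) = phi (dl x) (Bs es xs) * B1 k p e x.
Proof.
move=> hx; have [f [c [c' hb]]] := label_block hchar hx.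
(* For an empty tail [B_seq] is 1 and [phi] fixes 1, so the one-label case obeys the same
   recursion. *)
case: es xs => [|e' es] [|x' xs] //= _ h; first by rewrite phi1 mul1r.
by rewrite (block_Zmap hb).
Qed.

Lemma Bs_zbox xs es : all_P xs -> size es = size xs -> pbw (zbox (size xs)) (Bs es xs).
Proof.
elim: xs es => [|x xs IH] [|e es] //.
  by move=> _ _; rewrite /= -(bas000 k); apply: kspan_gen; exists 0%N, 0%N, 0%N.
move=> /all_P_cons[hx hxs] [sz]; have IHe := IH es hxs sz.
rewrite Bs_cons_diag //; last exact: zbox_diag IHe.
apply/(ArP hchar); apply: (algM (Ar_alg _)); last exact: Ar_B1.
by apply/(ArP hchar); exact: phi_zbox.
Qed.

Lemma Bs_diag xs es : all_P xs -> size es = size xs -> pbw diag (Bs es xs).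
Proof. by move=> hP sz; exact: zbox_diag (Bs_zbox hP sz). Qed.

Lemma Bs_cons x xs e es : all_P (x :: xs) -> size es = size xs ->
  Bs (e :: es) (x :: xs) = phi (dl x) (Bs es xs) * B1 k p e x.
Proof. by move=> /all_P_cons[hx hxs] sz; apply: Bs_cons_diag => //; exact: Bs_diag. Qed.

(** List versions of membership in X_r(a, j), of the union of supports and of supports meeting,
    which allow structural induction. *)
Definition okb (xs : seq label) (es : seq bool) := all2 (fun x e => forced0 p x ==> ~~ e) xs es.
Definition ors (es es' : seq bool) := [seq e.1 || e.2 | e <- zip es es'].
Definition meets (es es' : seq bool) := has (fun e => e.1 && e.2) (zip es es').

Lemma okb_size xs es : okb xs es -> size es = size xs.
Proof. by rewrite /okb all2E => /andP[/eqP ->]. Qed.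

Lemma size_ors es es' : size es = size es' -> size (ors es es') = size es'.
Proof. by move=> h; rewrite size_map size_zip h minnn. Qed.

(** The image of a tail under [phi] commutes with the B of the head, so heads and tails can be
    multiplied separately; tails multiply inside [phi] thanks to the factor B that follows. *)
Lemma Bs_mul xs es es' : all_P xs -> okb xs es -> okb xs es' ->
  Bs es xs * Bs es' xs = if meets es es' then 0 else Bs (ors es es') xs.
Proof.
elim: xs es es' => [|x xs IH] [|e es] [|e' es'] //; first by rewrite /= mulr1.
move=> hP; have [hx hxs] := all_P_cons hP; move=> /andP[oe oes] /andP[oe' oes'].
have sz := okb_size oes; have sz' := okb_size oes'.
have [f [c [c' hb]]] := label_block hchar hx.
rewrite (Bs_cons e hP sz) (Bs_cons e' hP sz') mulrA -[_ * B1 k p e x * _]mulrA.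
have de' := Bs_diag hxs sz'.
rewrite -(phi_central1 hchar _ de' (block_central hb e)) mulrA -[_ * B1 k p e x * _]mulrA.
rewrite (block_mul hb); last first.
  by move=> ff; move: oe oe'; rewrite ff /= => -> ->.
have -> : meets (e :: es) (e' :: es') = e && e' || meets es es' by [].
have -> : ors (e :: es) (e' :: es') = (e || e') :: ors es es' by [].
case: ifP => ee; first by rewrite mulr0.
rewrite orFb.
rewrite (block_phi_mul hb) ?IH //; try exact: Bs_diag.
case: ifP => m; last by rewrite Bs_cons // size_ors ?sz ?sz'.
have [lp _] : phi (dl x) 0 = 0 /\ True.
  by split=> //; have := phi_sum hchar (dl x) [::] xpredT (fun i : nat => 0); rewrite !big_nil.
by rewrite lp mul0r.
Qed.

(** [block_act] separates a basis element into an action on the tail, handled by induction, and a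
    polynomial in YX on the head, which [block_evB1] shows can only raise the bit. *)
Lemma Bs_act xs es z : all_P xs -> okb xs es -> pbw (zbox (size xs)) z ->
  kspan (fun u => exists es', [/\ okb xs es', all2 implb es es' & u = Bs es' xs])
    (z * Bs es xs).
Proof.
elim: xs es z => [|x xs IH] [|e es] z //.
  move=> _ _; move: z; apply: kspan_linear => [t u v|]; first by rewrite mulrDl scalerAl.
  move=> _ [m [n [_ [[<- mr nr] ->]]]]; apply: kspan_gen; exists [::]; split=> //.
  by move: mr nr; rewrite expn0 !ltnS !leqn0 => /eqP -> /eqP ->; rewrite bas000 mul1r.
move=> hP; have [hx hxs] := all_P_cons hP; move=> /andP[oe oes].
have sz := okb_size oes; have [f [c [c' hb]]] := label_block hchar hx.
move: z; apply: kspan_linear => [t u v|]; first by rewrite mulrDl scalerAl.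
move=> _ [m [n [_ [[<- mr nr] ->]]]].
have [w [q [wz ->]]] : exists w q, pbw (zbox (size xs)) w /\
    bas k m n m * Bs (e :: es) (x :: xs) = phi (dl x) (w * Bs es xs) * (ev q * B1 k p e x).
  have [w [q [wz hw]]] := block_act hb mr nr; exists w, q; split=> //.
  by rewrite Bs_cons // hw //; exact: Bs_diag.
have he : forced0 p x -> ~~ e by move=> ff; move: oe; rewrite ff.
have [al [be [-> hbe]]] := block_evB1 hb q he.
move: (w * _) (IH es w hxs oes wz); apply: kspan_linear => [t u v|].
  by rewrite phi_linear mulrDl scalerAl.
move=> _ [es' [oes' le ->]]; have sz' := okb_size oes'.
rewrite mulrDr -!scalerAr -!Bs_cons //; apply: kspanD; first apply: kspanZ.
  by apply: kspan_gen; exists (e :: es'); rewrite /okb /= oe implybb.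
have [hb0|hb0] := boolP (e || forced0 p x).
  by rewrite (hbe hb0) scale0r; exact: kspan0.
apply: kspanZ; apply: kspan_gen; exists (true :: es'); rewrite /okb /=.
by move: hb0; rewrite negb_or => /andP[/negbTE -> /negbTE ->].
Qed.

Lemma Bs_top_neq0 xs : all_P xs -> Bs [seq ~~ forced0 p x | x <- xs] xs != 0.
Proof.
elim: xs => [|x xs IH] hP; first by rewrite /= oner_neq0.
have [hx hxs] := all_P_cons hP; have [f [c [c' hb]]] := label_block hchar hx.
rewrite [map _ _]/= Bs_cons ?size_map //; apply: contra (IH hxs) => /eqP h; apply/eqP.
by apply: (block_top_neq0 hb) h; apply: Bs_diag; rewrite ?size_map.
Qed.

End LabelSequences.

Lemma subquotient_iso (R : pzRingType) (M V : lmodType R) (N1 N2 : submodule M)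
    (F : submodule_type N1 -> V) :
  linear F -> (forall v, exists x, F x = v) ->
  (forall x, F x = 0 <-> subm_set N2 (val x)) -> lmod_iso (subquotient N1 N2) V.
Proof.
move=> lF sF kF; pose Q := subquotient N1 N2.
pose cl (x : submodule_type N1) : Q := qclass (inner_submodule N1 N2) x.
pose g (q : Q) : V := F (repr (q : quotient_module (inner_submodule N1 N2))).
have FB x y : F (x - y) = F x - F y.
  by have -> : x - y = (-1) *: y + x; [rewrite scaleN1r addrC | rewrite lF scaleN1r addrC].
have gcl x : g (cl x) = F x.
  apply/eqP; rewrite -subr_eq0 -FB; apply/eqP/kF; exact: (repr_qclass (inner_submodule N1 N2)).
have clK q : exists x, q = cl x.
  by exists (repr (q : quotient_module (inner_submodule N1 N2))); rewrite /cl qclassK.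
have gl : linear g.
  move=> a u v; have [x ->] := clK u; have [y ->] := clK v.
  have -> : a *: cl x + cl y = cl (a *: x + y).
    by rewrite /cl -(qaddE (inner_submodule N1 N2)) -(qscaleE (inner_submodule N1 N2)).
  by rewrite !gcl lF.
pose gL : {linear Q -> V} := HB.pack g (GRing.isLinear.Build _ _ _ _ g gl).
exists gL; exists (fun v => cl (sval (cid (sF v)))) => [q|v].
  have [x ->] := clK q; rewrite [gL _]gcl; case: cid => y /= hy.
  by apply: qclass_eq; apply/kF; rewrite FB hy subrr.
by rewrite [gL _]gcl; case: cid.
Qed.

Lemma disjointDl (T : finType) (E F : {set T}) : [disjoint F :\: E & E].
Proof. by rewrite finset.disjoints_subset finset.setDE finset.subsetIr. Qed.

Lemma setDUK (T : finType) (E F : {set T}) : E \subset F -> F :\: E :|: E = F.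
Proof.
move=> /fintype.subsetP EF; apply/setP => x; rewrite !inE.
by case: (boolP (x \in E)) => [/EF ->|_]; rewrite ?orbT ?orbF.
Qed.

Lemma sum_of_sets_sum (V : zmodType) (I : finType) (P : pred I) (N : I -> set V)
    (J : Type) (s : seq J) (Q : pred J) (F : J -> V) :
  (forall i, N i 0) -> (forall i x y, N i x -> N i y -> N i (x + y)) ->
  (forall j, Q j -> sum_of_sets P N (F j)) -> sum_of_sets P N (\sum_(j <- s | Q j) F j).
Proof.
move=> N0 ND h; elim/big_ind: _ => //.
  by exists (fun=> 0); split=> //; rewrite big1.
move=> x y [v [hv ->]] [w [hw ->]]; exists (fun i => v i + w i); split=> [i Pi|].
  by apply: ND; [exact: hv | exact: hw].
by rewrite big_split.
Qed.

Lemma sum_of_sets_gen (V : zmodType) (I : finType) (P : pred I) (N : I -> set V) i x :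
  (forall j, N j 0) -> P i -> N i x -> sum_of_sets P N x.
Proof.
move=> N0 Pi Nx; exists (fun j => if j == i then x else 0); split=> [j _|].
  by case: eqP => [->|].
by rewrite (bigD1 i) //= eqxx big1 ?addr0 // => j /andP[_ /negbTE ->].
Qed.

Lemma subset_of_card (T : finType) (E : {set T}) n : (n <= #|E|)%N ->
  exists2 F : {set T}, F \subset E & #|F| = n.
Proof.
rewrite -bin_gt0 -cards_draws => /card_gt0P[F]; rewrite inE => /andP[FE /eqP cF].
by exists F.
Qed.

(** * Modules spanned by a Boolean lattice *)

Section BooleanModule.
Variables (k : fieldType) (A : algType k) (S : set A) (hS : subring S).
Hypothesis S_scale : forall (c : k) x, S x -> S (c *: x).
Variables (I : finType) (W : {set I}) (B : {set I} -> A).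
Hypothesis B_S : forall E : {set I}, E \subset W -> S (B E).
Hypothesis B_mul : forall E E' : {set I}, E \subset W -> E' \subset W ->
  B E * B E' = if [disjoint E & E'] then B (E :|: E') else 0.
Hypothesis B_act : forall z (E : {set I}), S z -> E \subset W -> exists c : {set I} -> k,
  z * B E = \sum_(E' : {set I} | (E \subset E') && (E' \subset W)) c E' *: B E'.
Hypothesis B_W : B W != 0.

Local Notation R := (subring_type hS).
Local Notation M := (restr_module hS).
Local Notation cyc v := (@cyclic_submodule R M v).

Lemma subring_valP (a : R) : S (val a).
Proof. exact/asboolP/(valP a). Qed.

Lemma subring_lift z : S z -> exists a : R, val a = z.
Proof.
by move=> hz; have h : subring_pred hS z by [exact/asboolP]; exists (exist _ z h).
Qed.

Lemma submodule_lift (N : submodule M) (u : A) : subm_set N u ->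
  exists x : submodule_type N, val x = u.
Proof. by move=> hu; have h : submodule_pred N u by [exact/asboolP]; exists (exist _ (u : M) h). Qed.

Lemma subm_scale (N : submodule M) (c : k) (u : A) : subm_set N u -> subm_set N (c *: u : A).
Proof.
have [a ea] : exists a : R, val a = c%:A by apply/subring_lift/S_scale; case: (hS).
by move=> /(submZ a); rewrite -[c *: u]mulr_algl -ea.
Qed.

Lemma subm_sum (N : submodule M) (J : Type) (s : seq J) (P : pred J) (F : J -> A) :
  (forall j, P j -> subm_set N (F j)) -> subm_set N (\sum_(j <- s | P j) F j : A).
Proof.
move=> h; elim/big_rec: _ => [|j x Pj]; first exact: subm0.
by apply: (@submD _ M) => //; exact: h.
Qed.

Definition comb (P : pred {set I}) (u : A) : Prop :=
  exists c : {set I} -> k, u = \sum_(E | P E) c E *: B E.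

Lemma comb_gen (P : pred {set I}) E : P E -> comb P (B E).
Proof.
move=> PE; exists (fun E' => (E' == E)%:R); rewrite (bigD1 E) //= eqxx scale1r big1 ?addr0 //.
by move=> E' /andP[_ /negbTE ->]; rewrite scale0r.
Qed.
Lemma comb0 P : comb P 0.
Proof. by exists (fun=> 0); rewrite big1 // => E _; rewrite scale0r. Qed.
Lemma combD P u v : comb P u -> comb P v -> comb P (u + v).
Proof.
move=> [c ->] [c' ->]; exists (fun E => c E + c' E); rewrite -big_split; apply: eq_bigr => E _.
by rewrite scalerDl.
Qed.
Lemma combZ P a u : comb P u -> comb P (a *: u).
Proof.
move=> [c ->]; exists (fun E => a * c E); rewrite scaler_sumr; apply: eq_bigr => E _.
by rewrite scalerA.
Qed.
Lemma comb_sum P (J : Type) (s : seq J) (Q : pred J) (F : J -> A) :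
  (forall j, Q j -> comb P (F j)) -> comb P (\sum_(j <- s | Q j) F j).
Proof. by move=> h; elim/big_ind: _ => //; [exact: comb0 | exact: combD]. Qed.

Lemma comb_linear (P Q : pred {set I}) z u :
  (forall E, P E -> comb Q (z * B E)) -> comb P u -> comb Q (z * u).
Proof.
move=> h [c ->]; rewrite mulr_sumr; apply: comb_sum => E PE; rewrite -scalerAr.
by apply: combZ; exact: h.
Qed.
Lemma comb_sub (P Q : pred {set I}) u : (forall E, P E -> Q E) -> comb P u -> comb Q u.
Proof.
move=> h hu; rewrite -[u]mul1r; apply: comb_linear hu => E PE; rewrite mul1r.
by apply: comb_gen; exact: h.
Qed.

(** The elements B commute by the product rule, and [z] sends each of them into their span, so B E
    slides past [z]. *)
Lemma B_comm (E : {set I}) z u : E \subset W -> S z -> comb (fun E' : {set I} => E' \subset W) u ->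
  B E * (z * u) = z * (B E * u).
Proof.
move=> EW hz [c ->]; rewrite !mulr_sumr; apply: eq_bigr => E' E'W; rewrite -!scalerAr; congr (_ *: _).
have BC (F : {set I}) : F \subset W -> B E * B F = B F * B E.
  by move=> FW; rewrite !B_mul // disjoint_sym finset.setUC.
rewrite BC // [RHS]mulrA; have [c' ->] := B_act hz E'W.
rewrite mulr_sumr mulr_suml; apply: eq_bigr => F /andP[_ FW].
by rewrite -scalerAr -scalerAl BC.
Qed.

(** Each F containing E is reached, because B (F \ E) B E = B F. *)
Lemma cycE (E : {set I}) u : E \subset W -> subm_set (cyc (B E)) u <-> comb (fun F : {set I} => (E \subset F) && (F \subset W)) u.
Proof.
move=> EW; split=> [[a ->]|].
  by have [c e] := B_act (subring_valP a) EW; exists c.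
move=> [c ->]; apply: subm_sum => F /andP[EF FW]; apply: subm_scale.
have sF : F :\: E \subset W by rewrite finset.subDset finset.subsetU // FW orbT.
have [a ea] := subring_lift (B_S sF); exists a.
rewrite -[RHS]/(val a * B E) ea B_mul //.
by rewrite disjointDl setDUK.
Qed.

(* Every [b * B E] squares to zero, so it cannot be a unit modulo a maximal left
   ideal. *)
Lemma B_jacobson (a : R) (E : {set I}) : E \subset W -> E != finset.set0 -> val a = B E -> jacobson a.
Proof.
move=> EW E0 ea J [J1 Jmax].
apply: contrapT => Ja.
pose L := fun u : R => exists x b : R, subm_set J x /\ u = x + b * a.
have L0 : L 0 by exists 0, 0; split; [exact: subm0 | rewrite mul0r addr0].
have LD u v : L u -> L v -> L (u + v).
  move=> [x [b [hx ->]]] [y [b' [hy ->]]]; exists (x + y), (b + b'); split; first exact: (@submD _ R^o).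
  by rewrite mulrDl addrACA.
have LZ (c : R) (u : R^o) : L u -> L (c *: u).
  move=> [x [b [hx ->]]]; exists (c * x), (c * b); split; first exact: (@submZ _ R^o).
  by rewrite -[_ *: _]/(c * (x + b * a)) mulrDr mulrA.
have JL : (J `<=` (@Submodule R R^o L L0 LD LZ))%classic.
  by move=> x hx; exists x, 0; split=> //; rewrite mul0r addr0.
have La : L a by exists 0, 1; split; [exact: subm0 | rewrite mul1r add0r].
have [L1|L1] := pselect (L 1); last by apply: Ja; exact: (Jmax _ JL L1).
have [x [b [hx e1]]] := L1; apply: J1.
have bab : val a * (val b * val a) = 0.
  rewrite ea; have [c ->] := B_act (subring_valP b) EW; rewrite mulr_sumr big1 // => F /andP[EF FW].
  rewrite -scalerAr B_mul //; case: ifP => [|_]; last by rewrite scaler0.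
  by rewrite -finset.setI_eq0 (finset.setIidPl EF) (negbTE E0).
(* Here x = 1 - ba, and (1 + ba)(1 - ba) = 1 because aba = 0; thus the ideal contains 1. *)
have -> : (1 : R) = (1 + b * a) * x.
  have -> : x = 1 - b * a by rewrite e1 addrK.
  apply: val_inj; rewrite rmorphM rmorphD rmorphB rmorphM rmorph1.
  rewrite mulrDl mul1r mulrBr mulr1 -[val b * val a * (_ * _)]mulrA bab mulr0 subr0.
  by rewrite subrK.
exact: (@submZ _ R^o).
Qed.

(** The annihilator of B W is a maximal left ideal: every element acts on B W by a scalar, and one
    outside the annihilator is invertible modulo it. *)
Lemma jacobson_W (a : R) : jacobson a -> val a * B W = 0.
Proof.
pose L := fun u : R => val u * B W = 0.
have L0 : L 0 by rewrite /L rmorph0 mul0r.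
have LD u v : L u -> L v -> L (u + v) by rewrite /L rmorphD mulrDl => -> ->; rewrite addr0.
have LZ (c : R) (u : R^o) : L u -> L (c *: u).
  by rewrite /L -[c *: u]/(c * u) rmorphM -mulrA => ->; rewrite mulr0.
move=> ja; apply: (ja (@Submodule R R^o L L0 LD LZ)); split.
  by rewrite /= /L rmorph1 mul1r; apply/eqP.
have act (z : R) : exists c : k, val z * B W = c *: B W.
  have [c ->] := B_act (subring_valP z) (subxx W); exists (c W).
  by rewrite (big_pred1 W) // => F; rewrite /= finset.eqEsubset andbC.
move=> J LJ J1 u Ju; rewrite /= /L; have [c uc] := act u.
have [c0|c0] := eqVneq c 0; first by rewrite uc c0 scale0r.
case: J1; have [b eb] : exists b : R, val b = c^-1%:A.
  by apply/subring_lift/S_scale; case: (hS).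
have -> : (1 : R) = (1 - b * u) + b * u by rewrite subrK.
apply: (@submD _ R^o); last exact: (@submZ _ R^o).
apply: LJ; change (val (1 - b * (u : R)) * B W = 0).
rewrite rmorphB rmorphM rmorph1 mulrBl mul1r -mulrA uc /= eb.
by rewrite mulr_algl scalerA mulVf // scale1r subrr.
Qed.

(** Multiplication by B (W \ E) reads the coefficient of B E in a B E as that of B W in a B W, which
    is zero for a in the radical. *)
Lemma jacobson_act (a : R) (E : {set I}) : jacobson a -> E \subset W ->
  comb (fun F : {set I} => (E \proper F) && (F \subset W)) (val a * B E).
Proof.
move=> ja EW; have [c e] := B_act (subring_valP a) EW.
have WE : W :\: E \subset W by rewrite finset.subsetDl.
have cE : c E = 0.
  have : B (W :\: E) * (val a * B E) = 0.
    rewrite B_comm //; [|exact: subring_valP|exact: comb_gen].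
    by rewrite B_mul // disjointDl setDUK // jacobson_W.
  rewrite e mulr_sumr (bigD1 E) ?subxx //= big1 => [|F /andP[/andP[EF FW] FE]].
    rewrite addr0 -scalerAr B_mul // disjointDl setDUK // => /eqP.
    by rewrite scaler_eq0 (negbTE B_W) orbF => /eqP.
  rewrite -scalerAr B_mul //; case: ifP => [|_]; last by rewrite scaler0.
  rewrite finset.disjoints_subset finset.subsetC => FE'.
  case/eqP: FE; apply/eqP; rewrite finset.eqEsubset EF andbT.
  apply/fintype.subsetP => i iF; move/fintype.subsetP: FE' => /(_ i iF); rewrite !inE.
  by move/fintype.subsetP: FW => -> //; rewrite andbT negbK.
exists c; rewrite e (bigD1 E) ?subxx //= cE scale0r add0r; apply: eq_bigl => F.
by rewrite finset.properEneq eq_sym andbC andbA.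
Qed.

Lemma jacobson_pow_act i (a : R) (E : {set I}) : ideal_pow (@jacobson R) i.+1 a -> E \subset W ->
  comb (fun F : {set I} => [&& E \subset F, F \subset W & (i < #|F :\: E|)%N]) (val a * B E).
Proof.
elim: i a => [|i IH] a.
  move=> ja EW; apply: comb_sub (jacobson_act ja EW) => F /andP[/properP[EF [x xF xE]] FW].
  by rewrite EF FW card_gt0; apply/finset.set0Pn; exists x; rewrite !inE xE.
move=> [n [b [v [hb hv ->]]]] EW.
have -> : val (\sum_(l < n) b l *: (v l : R^o) : R) = \sum_(l < n) val (b l) * val (v l).
  by rewrite rmorph_sum; apply: eq_bigr => l _; rewrite -[_ *: _]/(b l * v l) rmorphM.
rewrite mulr_suml; apply: comb_sum => l _; rewrite -mulrA.
apply: comb_linear (IH _ (hv l) EW) => F /and3P[EF FW iF].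
apply: comb_sub (jacobson_act (hb l) FW) => G /andP[FG GW].
have EG := fintype.subset_trans EF (proper_sub FG); rewrite EG GW /=.
have := proper_card FG; have := subset_leq_card EF; move: iF; rewrite !cardsDS //; lia.
Qed.

(** B E is the product of the B of its singletons, each of which lies in the radical. *)
Lemma B_jacobson_pow i (a : R) (E : {set I}) : E \subset W -> val a = B E -> (i < #|E|)%N ->
  ideal_pow (@jacobson R) i.+1 a.
Proof.
elim: i a E => [|i IH] a E EW ea iE.
  by apply: B_jacobson EW _ ea; rewrite -card_gt0.
have [s sE] : exists s, s \in E by apply/finset.set0Pn; rewrite -card_gt0; lia.
have sW : [set s]%SET \subset W by rewrite finset.sub1set (fintype.subsetP EW).
have dW : E :\ s \subset W by rewrite (fintype.subset_trans _ EW) // finset.subD1set.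
have [b eb] := subring_lift (B_S sW); have [d ed] := subring_lift (B_S dW).
exists 1%N, (fun=> b), (fun=> d); split=> [_|_|].
- by apply: B_jacobson sW _ eb; rewrite -card_gt0 finset.cards1.
- by apply: IH dW ed _; move: iE; rewrite (cardsD1 s E) sE.
rewrite big_ord1; apply: val_inj; rewrite -[_ *: _]/(b * d) rmorphM /= eb ed ea B_mul //.
by rewrite finset.disjoints1 !inE eqxx /= finset.setD1K.
Qed.

Lemma mod_radE i (e : {set I}) u : e \subset W -> subm_set (mod_rad i (cyc (B e))) u <->
  comb (fun F : {set I} => [&& e \subset F, F \subset W & (i <= #|F :\: e|)%N]) u.
Proof.
move=> eW; case: i => [|i].
  rewrite -[subm_set _ _]/(subm_set (cyc (B e)) u) cycE //.
  by split; apply: comb_sub => F; rewrite leq0n andbT.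
split=> [[n [a [v [ha hv ->]]]]|[c ->]].
  apply: comb_sum => l _; have /cycE-/(_ eW) := hv l.
  rewrite -[_ *: _]/(val (a l) * (v l : A)); apply: comb_linear => E /andP[eE EW].
  apply: comb_sub (jacobson_pow_act (ha l) EW) => F /and3P[EF FW iF].
  rewrite FW (fintype.subset_trans eE EF) /=; apply: leq_trans iF _.
  by apply: subset_leq_card; apply: finset.setDS.
apply: subm_sum => F /and3P[eF FW iF]; apply: subm_scale.
have dW : F :\: e \subset W by rewrite (fintype.subset_trans _ FW) // finset.subsetDl.
have [a ea] := subring_lift (B_S dW).
exists 1%N, (fun=> a), (fun=> B e : M); split=> [_|_|].
- exact: B_jacobson_pow dW ea iF.
- by exists 1; rewrite scale1r.
rewrite big_ord1 -[_ *: _]/(val a * B e) ea B_mul // disjointDl setDUK //.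
Qed.

Lemma mod_rad_lines i (e : {set I}) : e \subset W ->
  (mod_rad i (cyc (B e)) : set A) = sum_of_sets
    (fun F : {set I} => [&& e \subset F, F \subset W & (i <= #|F :\: e|)%N])
    (fun F => line (B F)).
Proof.
move=> eW; apply/funext => u; apply/propext; rewrite mod_radE //; split.
  by move=> [c ->]; exists (fun F => c F *: B F); split=> // F _; exists (c F).
move=> [v [hv ->]]; apply: comb_sum => F PF; have [c ->] := hv F PF.
by apply: combZ; exact: comb_gen.
Qed.

Lemma mod_rad_cyc i (e : {set I}) : e \subset W ->
  (mod_rad i (cyc (B e)) : set A) = sum_of_sets
    (fun F : {set I} => [&& e \subset F, F \subset W & #|F :\: e| == i])
    (fun F => cyc (B F) : set A).
Proof.
move=> eW; apply/funext => u; apply/propext; rewrite mod_radE //.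
have N0 (F : {set I}) : (cyc (B F) : set A) 0 by exact: (@subm0 _ M).
split=> [[c ->]|[v [hv ->]]].
  apply: sum_of_sets_sum => // [F x y|F /and3P[eF FW iF]]; first exact: (@submD _ M).
  (* A set F at distance at least i from e contains some e together with G at distance exactly i,
     and B F lies in the module generated there. *)
  have [G GF cG] := subset_of_card iF.
  have GF' : e :|: G \subset F by rewrite finset.subUset eF (fintype.subset_trans GF) ?finset.subsetDl.
  apply: (@sum_of_sets_gen _ _ _ _ (e :|: G)) => //.
    rewrite finset.subsetUl (fintype.subset_trans GF' FW) /=; apply/eqP; rewrite -[RHS]cG; congr #|pred_of_set _|.
    apply/setP => x; rewrite !inE; have := fintype.subsetP GF x; rewrite !inE.
    by case: (x \in G) => [/(_ isT)/andP[/negbTE ->]|_]; rewrite ?orbF ?andNb.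
  apply/cycE; first exact: fintype.subset_trans GF' FW.
  by apply: combZ; apply: comb_gen; rewrite GF' FW.
apply: comb_sum => F PF; have := hv F PF; case/and3P: PF => eF FW /eqP cF.
move=> /(cycE _ FW); apply: comb_sub => G /andP[FG GW].
rewrite (fintype.subset_trans eF FG) GW -cF /=; apply: subset_leq_card; exact: finset.setSD.
Qed.

(** B W is the element that survives longest: it sits at distance #|W| - #|e|, and no set lies
    further away. *)
Lemma mod_rad_loewy (e : {set I}) : e \subset W ->
  has_loewy_length (cyc (B e)) (#|W| + 1 - #|e|)%N.
Proof.
move=> eW; have ce := subset_leq_card eW; split.
  apply/funext => u; apply/propext; rewrite mod_radE //; split=> [[c ->]|->]; last exact: comb0.
  rewrite big_pred0 // => F; apply/negP => /and3P[eF FW]; rewrite cardsDS //.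
  by have := subset_leq_card FW; lia.
move=> m h0; rewrite leqNgt; apply/negP => hm.
have : (mod_rad m (cyc (B e)) : set A) (B W).
  rewrite mod_radE //; apply: comb_gen; rewrite eW subxx cardsDS //=; lia.
by rewrite h0 => /eqP; rewrite (negbTE B_W).
Qed.

(* [B (W :\: E)] kills every [B F] of the sum except [B E]: disjointness forces
   [F \subset E]. *)
Lemma top_coef i (e E : {set I}) (c : {set I} -> k) : e \subset E -> E \subset W -> #|E :\: e| = i ->
  B (W :\: E) * (\sum_(F : {set I} | [&& e \subset F, F \subset W & (i <= #|F :\: e|)%N]) c F *: B F)
  = c E *: B W.
Proof.
move=> eE EW cE; have WE : W :\: E \subset W by rewrite finset.subsetDl.
rewrite mulr_sumr (bigD1 E) /=; last by rewrite eE EW cE leqnn.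
rewrite -scalerAr B_mul // disjointDl setDUK // big1 ?addr0 // => F /andP[/and3P[eF FW iF] FE].
rewrite -scalerAr B_mul //; case: ifP => [|_]; last by rewrite scaler0.
rewrite finset.disjoints_subset finset.subsetC => FE'.
have FsE : F \subset E.
  apply/fintype.subsetP => x xF; move/fintype.subsetP: FE' => /(_ x xF); rewrite !inE.
  by move/fintype.subsetP: FW => -> //; rewrite andbT negbK.
case/eqP: FE; apply/eqP; rewrite eqEcard FsE; move: iF; rewrite -cE !cardsDS //.
by have := subset_leq_card eF; have := subset_leq_card eE; lia.
Qed.

Lemma cycW u : subm_set (cyc (B W)) u <-> exists c : k, u = c *: B W.
Proof.
rewrite cycE //; split=> [[c ->]|[c ->]].
  by exists (c W); rewrite (big_pred1 W) // => F; rewrite /= finset.eqEsubset andbC.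
by apply: combZ; apply: comb_gen; rewrite subxx.
Qed.

Lemma comb_next i (e : {set I}) (c : {set I} -> k) :
  (forall E : {set I}, [&& e \subset E, E \subset W & #|E :\: e| == i] -> c E = 0) ->
  comb (fun F : {set I} => [&& e \subset F, F \subset W & (i < #|F :\: e|)%N])
    (\sum_(F : {set I} | [&& e \subset F, F \subset W & (i <= #|F :\: e|)%N]) c F *: B F).
Proof.
move=> c0; apply: comb_sum => F /and3P[eF FW]; rewrite leq_eqVlt => /predU1P[iF|iF].
  have -> : c F = 0 by apply: c0; rewrite eF FW -iF eqxx.
  by rewrite scale0r; exact: comb0.
by apply: combZ; apply: comb_gen; rewrite eF FW.
Qed.

Lemma top_kill i (e E : {set I}) u : e \subset E -> E \subset W -> #|E :\: e| = i ->
  comb (fun F : {set I} => [&& e \subset F, F \subset W & (i < #|F :\: e|)%N]) u ->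
  B (W :\: E) * u = 0.
Proof.
move=> eE EW cE [c ->].
have -> : \sum_(F : {set I} | [&& e \subset F, F \subset W & (i < #|F :\: e|)%N]) c F *: B F =
  \sum_(F : {set I} | [&& e \subset F, F \subset W & (i <= #|F :\: e|)%N])
    (if (i < #|F :\: e|)%N then c F else 0) *: B F.
  rewrite big_mkcond [RHS]big_mkcond; apply: eq_bigr => F _.
  case: (e \subset F); case: (F \subset W) => //=; case: ltngtP => //= _.
  by rewrite scale0r.
by rewrite top_coef // cE ltnn scale0r.
Qed.

Section Projections.
Variables (e : {set I}) (i : nat) (N : submodule M).
Hypothesis N_comb : forall u : A, subm_set N u ->
  comb (fun F : {set I} => [&& e \subset F, F \subset W & (i <= #|F :\: e|)%N]) u.

Local Notation T := (submodule_type (cyc (B W))).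
Local Notation layer E := [&& e \subset E, E \subset W & #|E :\: e| == i].

(** Reads off the coefficient of B E as a multiple of B W. [insubd] avoids a proof argument;
    [top_projE] shows that on a layer its default does not intervene. *)
Definition top_proj (E : {set I}) (u : submodule_type N) : T :=
  insubd (0 : T) (B (W :\: E) * (val u : A) : M).

Lemma submodule_valP (N' : submodule M) (u : submodule_type N') : subm_set N' (val u).
Proof. exact/asboolP/(valP u). Qed.

Lemma top_projE (E : {set I}) u : layer E -> val (top_proj E u) = B (W :\: E) * (val u : A) :> A.
Proof.
move=> /and3P[eE EW /eqP cE]; rewrite insubdK //; apply/asboolP/cycW.
by have [c ->] := N_comb (submodule_valP u); exists (c E); exact: top_coef.
Qed.

Lemma top_proj_linear (E : {set I}) : layer E -> linear (top_proj E).
Proof.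
move=> lE a u v; apply: val_inj.
have WE : W :\: E \subset W by rewrite finset.subsetDl.
rewrite -[RHS]/(val a * (val (top_proj E u) : A) + val (top_proj E v) : A) !top_projE //.
rewrite -[X in B _ * X]/(val a * (val u : A) + val v) mulrDr B_comm //; first exact: subring_valP.
by apply: comb_sub (N_comb (submodule_valP u)) => F /and3P[].
Qed.

End Projections.

(** The layer at distance 0 consists of e alone, so a single projection realises the quotient as S
    itself. *)
Lemma head_iso (e : {set I}) : e \subset W ->
  lmod_iso (subquotient (cyc (B e)) (mod_rad 1 (cyc (B e)))) (submodule_type (cyc (B W))).
Proof.
move=> eW; have NC u : subm_set (cyc (B e)) u ->
    comb (fun F : {set I} => [&& e \subset F, F \subset W & (0 <= #|F :\: e|)%N]) u.
  by move=> /(cycE _ eW); apply: comb_sub => F; rewrite leq0n andbT.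
have le : [&& e \subset e, e \subset W & #|e :\: e| == 0%N].
  by rewrite subxx eW finset.setDv finset.cards0.
have c0 : #|e :\: e| = 0%N by rewrite finset.setDv finset.cards0.
apply: (@subquotient_iso _ _ _ _ _ (@top_proj _ e)).
- exact (top_proj_linear NC le).
- move=> w; have [c ec] := (cycW _).1 (submodule_valP w).
  have [u eu] : exists u : submodule_type (cyc (B e)), val u = c *: B e.
    by apply/submodule_lift/cycE => //; apply: combZ; apply: comb_gen; rewrite subxx.
  exists u; apply: val_inj; rewrite (top_projE NC _ le) ec eu -scalerAr.
  by rewrite B_mul ?finset.subsetDl // disjointDl setDUK.
move=> u; have [c ec] := NC _ (submodule_valP u).
have vE : val (top_proj e u) = c e *: B W :> A.
  by rewrite (top_projE NC _ le) ec (top_coef c (subxx e) eW c0).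
rewrite mod_radE //; split=> [h0|hu].
  have /eqP : c e *: B W = 0 by rewrite -vE h0.
  rewrite scaler_eq0 (negbTE B_W) orbF ec => /eqP ce0; apply: comb_next => E /and3P[eE EW].
  rewrite finset.cards_eq0 finset.setD_eq0 => Ee.
  by have -> : E = e by apply/eqP; rewrite finset.eqEsubset eE Ee.
apply: val_inj; rewrite (top_projE NC _ le).
exact: top_kill (subxx e) eW c0 hu.
Qed.

(** The projections to the sets at distance i, taken together, have the next radical power as kernel
    and are onto because the coefficients can be prescribed freely. *)
Lemma layer_iso i (e : {set I}) : e \subset W -> (i <= #|W| - #|e|)%N ->
  lmod_iso (subquotient (mod_rad i (cyc (B e))) (mod_rad i.+1 (cyc (B e))))
    {ffun 'I_('C(#|W| - #|e|, i)) -> submodule_type (cyc (B W))}.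
Proof.
move=> eW hi; set n := 'C(_, _).
(* The sets at distance i from e correspond to the i-element subsets of W \ e, whose enumeration
   matches the ordinal index of the direct sum. *)
pose D := [set X : {set I} | (X \subset W :\: e) && (#|X| == i)]%SET.
have cD : #|D| = n by rewrite cards_draws cardsDS.
pose X (l : 'I_n) : {set I} := enum_val (cast_ord (esym cD) l).
pose E l := e :|: X l.
have XD l : X l \subset W :\: e /\ #|X l| = i.
  by have := enum_valP (cast_ord (esym cD) l); rewrite inE => /andP[? /eqP].
have XE l : E l :\: e = X l.
  have /fintype.subsetP h := (XD l).1.
  apply/setP => x; have := h x; rewrite !inE; case: (x \in X l) => [/(_ isT)/andP[-> _]|_].
    by rewrite orbT.
  by rewrite orbF andNb.
have EL l : [&& e \subset E l, E l \subset W & #|E l :\: e| == i].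
  rewrite XE (XD l).2 eqxx andbT finset.subsetUl finset.subUset eW /=.
  exact: fintype.subset_trans (XD l).1 (finset.subsetDl _ _).
have Einj l l' : E l = E l' -> l = l'.
  by move=> h; have := XE l; rewrite h XE => /enum_val_inj/cast_ord_inj.
have Eall (F : {set I}) : [&& e \subset F, F \subset W & #|F :\: e| == i] -> exists l, F = E l.
  move=> /and3P[eF FW cF]; have FD : F :\: e \in D by rewrite inE finset.setSD.
  exists (cast_ord cD (enum_rank_in FD (F :\: e))).
  by rewrite /E /X cast_ordK enum_rankK_in // finset.setUC setDUK.
have NC u : subm_set (mod_rad i (cyc (B e))) u ->
    comb (fun F : {set I} => [&& e \subset F, F \subset W & (i <= #|F :\: e|)%N]) u.
  by rewrite mod_radE.
apply: (@subquotient_iso _ _ _ _ _ (fun u => [ffun l => @top_proj _ (E l) u])).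
- move=> a u v; apply/ffunP => l; rewrite !ffunE; exact (top_proj_linear NC (EL l) a u v).
- move=> w; have /choice[c hc] : forall l, exists c : k, (val (w l) : A) = c *: B W.
    by move=> l; exact: (cycW _).1 (submodule_valP (w l)).
  pose c' (F : {set I}) := \sum_l (F == E l)%:R * c l.
  pose u := \sum_(F : {set I} | [&& e \subset F, F \subset W & (i <= #|F :\: e|)%N]) c' F *: B F.
  have [x ex] : exists x : submodule_type (mod_rad i (cyc (B e))), val x = u.
    by apply: submodule_lift; rewrite mod_radE //; exists c'.
  exists x; apply/ffunP => l; rewrite ffunE; apply: val_inj.
  have /and3P[eE EW /eqP cE] := EL l.
  rewrite (top_projE NC _ (EL l)) ex top_coef // hc /c' (bigD1 l) //= eqxx mul1r big1 ?addr0 //.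
  by move=> l' /negbTE l'l; case: eqP => [/Einj h|_]; rewrite ?mul0r // h eqxx in l'l *.
move=> u; have [c ec] := NC _ (submodule_valP u).
have vE l : val (top_proj (E l) u) = c (E l) *: B W :> A.
  by have /and3P[eE EW /eqP cE] := EL l; rewrite (top_projE NC _ (EL l)) ec top_coef.
rewrite mod_radE //; split=> [/ffunP h0|hu].
  rewrite ec; apply: comb_next => F /Eall[l ->].
  have /eqP : c (E l) *: B W = 0 by rewrite -vE; have := h0 l; rewrite !ffunE => ->.
  by rewrite scaler_eq0 (negbTE B_W) orbF => /eqP.
apply/ffunP => l; rewrite !ffunE; apply: val_inj; rewrite (top_projE NC _ (EL l)).
by have /and3P[eE EW /eqP cE] := EL l; exact: top_kill eE EW cE hu.
Qed.

(** Every nonzero submodule contains B W, so two nonzero submodules cannot meet in zero. *)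
Lemma cyc_indecomposable (e : {set I}) : e \subset W ->
  indecomposable (submodule_type (cyc (B e))).
Proof.
move=> eW; have We : W :\: e \subset W by rewrite finset.subsetDl.
have [top etop] : exists u : submodule_type (cyc (B e)), val u = B W.
  by apply/submodule_lift/cycE => //; apply: comb_gen; rewrite eW subxx.
split; first by exists top => /(congr1 val); rewrite etop => /eqP; apply/negP.
have socle (N : submodule (submodule_type (cyc (B e)))) :
    N <> [set 0]%classic :> set _ -> subm_set N top.
  move=> N0; have [u [Nu u0]] : exists u, subm_set N u /\ u != 0.
    apply: contrapT => h; apply: N0; apply/funext => u; apply/propext; split=> [Nu|->].
      by apply: contrapT => u0; apply: h; exists u; split=> //; apply/eqP.
    exact: subm0.
  have [c ec] := (cycE _ eW).1 (submodule_valP u).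
  have [F0 PF0] : exists F : {set I}, [&& e \subset F, F \subset W & c F != 0].
    apply: contrapT => h; case/eqP: u0; apply: val_inj; rewrite /= [LHS]ec big1 // => F /andP[eF FW].
    have [->|cF] := eqVneq (c F) 0; first by rewrite scale0r.
    by case: h; exists F; rewrite eF FW.
  pose Q := [pred F : {set I} | [&& e \subset F, F \subset W & c F != 0]].
  (* With F of least size in the support, [top_coef] applies at the distance of F and multiplication
     by B (W \ F) leaves a nonzero multiple of B W. *)
  have [F /and3P[eF FW cF] Fmin] := @arg_minnP _ F0 Q (fun F : {set I} => #|F|) PF0.
  have WF : W :\: F \subset W by rewrite finset.subsetDl.
  have eu : (val u : A) =
      \sum_(G : {set I} | [&& e \subset G, G \subset W & (#|F :\: e| <= #|G :\: e|)%N]) c G *: B G.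
    rewrite [LHS]ec big_mkcond [RHS]big_mkcond; apply: eq_bigr => G _.
    case eG : (e \subset G) => //=; case GW : (G \subset W) => //=.
    rewrite !cardsDS //; case: ifP => // h; have [->|cG] := eqVneq (c G) 0; first by rewrite scale0r.
    by have := Fmin G; rewrite /= eG GW cG => /(_ isT) h'; rewrite leq_sub2r in h.
  have [a ea] : exists a : R, val a = (c F)^-1 *: B (W :\: F).
    by apply/subring_lift/S_scale; exact: B_S.
  have -> : top = a *: u; last exact: submZ.
  apply: val_inj; rewrite etop -[RHS]/(val a * (val u : A)) ea -scalerAl eu (top_coef c eF FW erefl).
  by rewrite scalerA mulVf // scale1r.
move=> N1 N2 _ N12; apply: contrapT => /not_orP[/socle h1 /socle h2].
have : (N1 `&` N2)%classic top by split.
by rewrite N12 => /(congr1 val); rewrite etop => /eqP; apply/negP.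
Qed.

End BooleanModule.

(** * From bit tuples to subsets of positions *)

Lemma tnth_zip n (S T : Type) (s : n.-tuple S) (t : n.-tuple T) i :
  tnth (zip_tuple s t) i = (tnth s i, tnth t i).
Proof.
by rewrite (tnth_nth (tnth s i, tnth t i)) /= nth_zip ?size_tuple // -!tnth_nth.
Qed.

Lemma all2_tuple n (S T : Type) (P : S -> T -> bool) (s : n.-tuple S) (t : n.-tuple T) :
  all2 P s t = [forall i, P (tnth s i) (tnth t i)].
Proof.
rewrite all2E !size_tuple eqxx /=; apply/(all_tnthP (t := zip_tuple s t))/forallP => h i;
  by have := h i; rewrite tnth_zip.
Qed.

Definition bits n (E : {set 'I_n}) : n.-tuple bool := [tuple i \in E | i < n].
Definition ones n (e : n.-tuple bool) : {set 'I_n} := [set i | tnth e i]%SET.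

Lemma onesK n : cancel (@ones n) (@bits n).
Proof. by move=> e; apply: eq_from_tnth => i; rewrite tnth_mktuple inE. Qed.

Lemma bitsK n : cancel (@bits n) (@ones n).
Proof. by move=> E; apply/setP => i; rewrite inE tnth_mktuple. Qed.

Lemma bits_meets n (E E' : {set 'I_n}) : meets (bits E) (bits E') = ~~ [disjoint E & E'].
Proof.
apply/(has_tnthP (t := zip_tuple (bits E) (bits E')))/pred0Pn.
  by move=> [l]; rewrite tnth_zip !tnth_mktuple => h; exists l.
by move=> [l h]; exists l; rewrite tnth_zip !tnth_mktuple.
Qed.

Lemma bits_ors n (E E' : {set 'I_n}) : ors (bits E) (bits E') = bits (E :|: E').
Proof.
apply: (congr1 val (x := map_tuple (fun e => e.1 || e.2) (zip_tuple (bits E) (bits E')))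
  (y := bits (E :|: E'))).
by apply: eq_from_tnth => i; rewrite tnth_map tnth_zip !tnth_mktuple inE.
Qed.

Lemma sum_of_sets_reindex (V : zmodType) (I J : finType) (h : J -> I) (h' : I -> J)
    (P : pred I) (Q : pred J) (N : I -> set V) (N' : J -> set V) :
  cancel h h' -> cancel h' h -> (forall j, P (h j) = Q j) -> (forall j, N (h j) = N' j) ->
  sum_of_sets P N = sum_of_sets Q N'.
Proof.
move=> hK h'K hPQ hN; apply/funext => u; apply/propext; split=> [[v [hv ->]]|[v [hv ->]]].
  exists (v \o h); split=> [j Qj|]; first by rewrite -hN; apply: hv; rewrite hPQ.
  by rewrite (reindex h) /=; [apply: eq_bigl => j; exact: hPQ | exists h' => j _].
exists (v \o h'); split=> [i Pi|].
  by rewrite -(h'K i) hN /= hK; apply: hv; rewrite -hPQ h'K.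
rewrite (reindex h') /=; last by exists h => j _.
by apply: eq_bigl => i; rewrite -hPQ h'K.
Qed.

Section LabelTuple.
Variables (k : closedFieldType) (p r : nat).
Hypothesis hchar : p \in [pchar k].
Variable x : r.-tuple label.
Hypothesis hx : forall s : 'I_r, in_P p (tnth x s).

Let W : {set 'I_r} := [set i | ~~ forced0 p (tnth x i)]%SET.
Let B (E : {set 'I_r}) : hyper k := Bvec k p (bits E) x.

Lemma labels_P : all_P p x.
Proof. by move=> y /tnthP[i ->]; exact: hx. Qed.

Lemma okb_bits (E : {set 'I_r}) : okb p x (bits E) = (E \subset W).
Proof.
rewrite /okb all2_tuple; apply/forallP/fintype.subsetP => h i; have := h i.
  by rewrite tnth_mktuple inE implybN => /implyP.
by rewrite tnth_mktuple inE implybN => ?; apply/implyP.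
Qed.

Lemma bits_S (E : {set 'I_r}) : E \subset W -> Ar_set p r (B E).
Proof.
by move=> _; apply/(ArP hchar); rewrite -{1}(size_tuple x); apply: (Bs_zbox hchar labels_P); rewrite !size_tuple.
Qed.

Lemma bits_mul (E E' : {set 'I_r}) : E \subset W -> E' \subset W ->
  B E * B E' = if [disjoint E & E'] then B (E :|: E') else 0.
Proof.
rewrite -!okb_bits => h h'; rewrite /B /Bvec (Bs_mul hchar labels_P h h') bits_meets bits_ors.
by case: [disjoint _ & _].
Qed.

Lemma bits_act z (E : {set 'I_r}) : Ar_set p r z -> E \subset W -> exists c : {set 'I_r} -> k,
  z * B E = \sum_(F : {set 'I_r} | (E \subset F) && (F \subset W)) c F *: B F.
Proof.
move=> /(ArP hchar) hz; rewrite -okb_bits => hE.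
rewrite -(size_tuple x) in hz; have h := Bs_act hchar labels_P hE hz.
apply: (h (comb B (fun F : {set 'I_r} => (E \subset F) && (F \subset W)))); first exact: comb0.
- by move=> u v; exact: combD.
- by move=> c u; exact: combZ.
move=> _ [es [hes le ->]]; have sz : size es == r by rewrite (okb_size hes) size_tuple.
have -> : B_seq k p (zip es x) = B (ones (Tuple sz)) by rewrite /B onesK.
apply: comb_gen; rewrite -okb_bits onesK hes andbT.
move: le; rewrite -[es]/(val (Tuple sz)) all2_tuple => /forallP le.
by apply/fintype.subsetP => i iE; have := le i; rewrite tnth_mktuple iE inE.
Qed.

Lemma bits_W : B W != 0.
Proof.
have := Bs_top_neq0 hchar labels_P; congr (B_seq _ _ (zip _ _) != 0).
apply: (congr1 val (x := map_tuple (fun y => ~~ forced0 p y) x) (y := bits W)).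
by apply: eq_from_tnth => i; rewrite tnth_map tnth_mktuple inE.
Qed.

Lemma in_X_ones e : in_X p x e = (ones e \subset W).
Proof. by rewrite -okb_bits onesK /okb all2_tuple. Qed.

Lemma tau_bits : tau p x = bits W.
Proof. by apply: eq_from_tnth => i; rewrite !tnth_mktuple inE. Qed.

End LabelTuple.

Lemma tuple_le_ones n (e f : n.-tuple bool) : tuple_le e f = (ones e \subset ones f).
Proof.
apply/forallP/fintype.subsetP => h i; have := h i; rewrite !inE; first by move/implyP.
by move=> ?; apply/implyP.
Qed.

Lemma hamming_dist_ones n (e f : n.-tuple bool) : ones e \subset ones f ->
  hamming_dist f e = #|ones f :\: ones e|.
Proof.
move=> /fintype.subsetP h; apply: eq_card => i; rewrite !inE.
by have := h i; rewrite !inE; case: (tnth e i) (tnth f i) => -[] // /(_ isT).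
Qed.

Theorem theorem3p11 (k : closedFieldType) (p : nat) (hp : p \in [pchar k])
    (r : nat) (hr : (1 <= r)%N)
    (x : r.-tuple label) (hx : forall s : 'I_r, in_P p (tnth x s))
    (e : r.-tuple bool) (he : in_X p x e) :
  let M (th : r.-tuple bool) : submodule (U_mod k p r) :=
    cyc p r (Bvec k p th x) in
  let S : submodule (U_mod k p r) := S_mod k p x in
  let n := (w_of p x - hamming_weight e)%N in
  [/\ forall i : nat,
        (mod_rad i (M e) : set (hyper k)) =
          sum_of_sets
            (fun th => [&& in_X p x th, hamming_dist th e == i & tuple_le e th])
            (fun th => M th : set (hyper k)) /\
        (mod_rad i (M e) : set (hyper k)) =
          sum_of_sets
            (fun th => [&& in_X p x th, (i <= hamming_dist th e)%N
                         & tuple_le e th])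
            (fun th => line (Bvec k p th x)),
      has_loewy_length (M e) (w_of p x + 1 - hamming_weight e)%N,
      forall i : nat, (i <= n)%N ->
        lmod_iso (subquotient (mod_rad i (M e)) (mod_rad i.+1 (M e)))
                 {ffun 'I_('C(n, i)) -> submodule_type S},
      indecomposable (submodule_type (M e))
    & lmod_iso (subquotient (M e) (mod_rad 1 (M e))) (submodule_type S)].
Proof.
move=> M S n.
pose W := [set i | ~~ forced0 p (tnth x i)]%SET.
pose B (E : {set 'I_r}) : hyper k := Bvec k p (bits E) x.
have Sc (c : k) u : Ar_set p r u -> Ar_set p r (c *: u) by case: (Ar_alg k p r) => _; apply.
pose hS := @Ar_subring k p r.
have BS := bits_S hp hx; have BM := bits_mul hp hx; have BA := bits_act hp hx.
have BW := bits_W hp hx.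
have eW : ones e \subset W by rewrite -in_X_ones.
have SE : S = cyc p r (B W) by rewrite /S /S_mod tau_bits.
have ME : M e = cyc p r (B (ones e)) by rewrite /M /B onesK.
have lay (i : nat) (F : {set 'I_r}) : [/\
   [&& in_X p x (bits F), hamming_dist (bits F) e == i & tuple_le e (bits F)] =
   [&& ones e \subset F, F \subset W & #|F :\: ones e| == i] &
   [&& in_X p x (bits F), (i <= hamming_dist (bits F) e)%N & tuple_le e (bits F)] =
   [&& ones e \subset F, F \subset W & (i <= #|F :\: ones e|)%N]].
  rewrite tuple_le_ones in_X_ones bitsK -/W.
  (* The Hamming distance is the size of the set difference only under inclusion; otherwise the
     order condition makes all sides false. *)
  have [eF|] := boolP (ones e \subset F); last by rewrite !andbF.
  by rewrite hamming_dist_ones bitsK // !andbT.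
split.
- move=> i; rewrite ME; split.
    apply: (etrans (mod_rad_cyc hS Sc BS BM BA BW i eW)).
    by apply/esym/(sum_of_sets_reindex (@bitsK r) (@onesK r)) => [F|F //]; case: (lay i F).
  apply: (etrans (mod_rad_lines hS Sc BS BM BA BW i eW)).
  by apply/esym/(sum_of_sets_reindex (@bitsK r) (@onesK r)) => [F|F //]; case: (lay i F).
- by rewrite ME; exact: (mod_rad_loewy hS Sc BS BM BA BW eW).
- by move=> i hi; rewrite ME SE; exact: (layer_iso hS Sc BS BM BA BW eW hi).
- by rewrite ME; exact: (cyc_indecomposable hS Sc BS BM BA BW eW).
by rewrite ME SE; exact: (head_iso hS Sc BS BM BA BW eW).
Qed.
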